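(* Let $(M,g)$ be a connected closed oriented Riemannian $4$-manifold. (i) For every $h\in\Omega^0_+(\operatorname{Sym}^2(\Lambda^+))$ satisfying $\Phi(h)=0$, the $\operatorname{SO}(3)$ connection $A(h)$ on $\Lambda^+$ is Yang--Mills and its self-dual curvature $F_{A(h)}^+$, regarded as an endomorphism of $\Lambda^+$, is equal to $h$. (ii) Conversely, let $A$ be a smooth $\operatorname{SO}(3)$ Yang--Mills connection on an oriented Euclidean vector bundle $\mathcal{E}\rightarrow M$ of rank three, and suppose that the curvature homomorphism $F_A^+\colon\mathcal{E}\rightarrow\Lambda^+$ is an orientation-preserving isomorphism at every point of $M$. Then there is a unique orientation-preserving bundle isometry $R\colon\mathcal{E}\rightarrow\Lambda^+$ covering the identity of $M$ such that the self-dual curvature of $R_*A$, regarded as an endomorphism of $\Lambda^+$, is a positive self-adjoint endomorphism $h$. Moreover, $R_*A=A(h)$ and $\Phi(h)=0$. If $\mathcal{E}=\Lambda^+$, then $R$ is a gauge transformation.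
   Context: Everything is smooth. $\Lambda^k=\bigwedge^kT^*M$; $\Omega^k(\mathcal{E})$ is the space of smooth $\mathcal{E}$-valued $k$-forms; $\star$ is the Hodge star of $g$, acting on the ordinary form factor of bundle-valued forms; $T^\pm=\frac12(T\pm\star T)$ for a bundle-valued $2$-form $T$. The bundle $\Lambda^+\subset\Lambda^2$ of self-dual $2$-forms ($\star\sigma=\sigma$) has rank three and carries the Euclidean metric induced by $g$ (for an orthonormal co-frame, the $\theta_a\wedge\theta_b$, $a<b$, are orthonormal in $\Lambda^2$). It is oriented by declaring positive the local orthonormal frame $\Sigma_i=-(\theta_0\wedge\theta_i+\theta_j\wedge\theta_k)/\sqrt2$, $(i,j,k)$ a cyclic permutation of $(1,2,3)$, where $(\theta_0,\theta_1,\theta_2,\theta_3)$ is a local oriented orthonormal co-frame. For an oriented Euclidean rank-three bundle $\mathcal{E}$, $[-,-]$ denotes the fibrewise cross product ($[e_i,e_j]=\sum_k\epsilon_{ijk}e_k$ for oriented orthonormal frames), and $\mathfrak{so}(\mathcal{E})$ is identified with $\mathcal{E}$ by letting $f$ correspond to the skew endomorphism $v\mapsto[f,v]$. For $\mathcal{E}$-valued forms $\alpha=\sum\alpha_i\otimes e_i$, $\beta=\sum\beta_j\otimes e_j$, $[\alpha,\beta]=\sum_{i,j}\alpha_i\wedge\beta_j\otimes[e_i,e_j]$. An $\operatorname{SO}(3)$ connection $A$ on $\mathcal{E}$ is a metric connection $\nabla^A$, with exterior covariant derivative $d_A$ on $\mathcal{E}$-valued forms and curvature $F_A\in\Omega^2(\mathcal{E})$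 (via the identification $\mathfrak{so}(\mathcal{E})\cong\mathcal{E}$), so $d_A^2\alpha=[F_A,\alpha]$; for $a\in\Omega^1(\mathcal{E})$, $A+a$ is the connection with $\nabla^{A+a}v=\nabla^Av+[a,v]$. $A$ is Yang--Mills if $d_A\star F_A=0$. An $\mathcal{E}$-valued self-dual $2$-form $T=\sum_{i,j}T_{ji}\Sigma_j\otimes e_i$ (first factor: ordinary form; second: coefficient; orthonormal frames) is regarded as the bundle homomorphism $\mathcal{E}\to\Lambda^+$, $v\mapsto\sum_{i,j}T_{ji}\langle e_i,v\rangle\Sigma_j$. In particular $F_A^+$ is regarded as a homomorphism $\mathcal{E}\to\Lambda^+$ (the curvature homomorphism), and as an endomorphism of $\Lambda^+$ when $\mathcal{E}=\Lambda^+$. $\operatorname{Sym}^2(\Lambda^+)$ is the bundle of self-adjoint endomorphisms of $\Lambda^+$, and $\Omega^0_+(\operatorname{Sym}^2(\Lambda^+))$ is the set of its smooth sections $h$ with $h>0$ (positive definite at every point). For an endomorphism field $h$ of $\Lambda^+$, $B_h\in\Omega^2(\Lambda^+)$ is given locally by $B_h=\sum_{i=1}^3h(\Sigma_i)\otimes\Sigma_i$ (first factor: ordinary $2$-form; second: coefficient), for any local oriented orthonormal frame; it corresponds to the endomorphism $h$. For $h\in\Omega^0_+(\operatorname{Sym}^2(\Lambda^+))$, the map $\operatorname{ad}_h\colon\Omega^1(\Lambda^+)\to\Omega^3(\Lambda^+)$, $\operatorname{ad}_h(a)=[a,B_h]$, is invertible, and $A(h):=\Gamma-\operatorname{ad}_h^{-1}(d_\Gamma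 B_h)$, where $\Gamma$ is the connection on $\Lambda^+$ induced by the Levi--Civita connection of $g$. Finally $\Phi(h)=\Phi_g(h):=F_{A(h)}^+h^{-1}-\operatorname{Id}$ (composition of endomorphisms of $\Lambda^+$), which is a section of $\operatorname{Sym}^2(\Lambda^+)$. For an orientation-preserving bundle isometry $R\colon\mathcal{E}\to\Lambda^+$ covering $\operatorname{id}_M$, $R_*A$ is the connection on $\Lambda^+$ with $\nabla^{R_*A}_Xv=R\nabla^A_X(R^{-1}v)$; ordinary forms on $M$ are not acted on. A gauge transformation of $\Lambda^+$ is an orientation-preserving isometric automorphism of $\Lambda^+$ covering $\operatorname{id}_M$. *)

(* Defs.v *)
From HB Require Import structures.
From mathcomp Require Export all_boot all_order all_algebra all_fingroup.
From mathcomp Require Export all_classical all_reals all_analysis.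
Export Order.TTheory GRing.Theory Num.Theory.
Export numFieldNormedType.Exports.

Set Implicit Arguments.
Unset Strict Implicit.
Unset Printing Implicit Defensive.

Local Open Scope classical_set_scope.
Local Open Scope ring_scope.

Section EuclideanCalculus.
Context (R : realType).
Local Notation T := 'rV[R]_4.

Fixpoint Ck (k : nat) (U : set T) (f : T -> R) : Prop :=
  match k with
  | 0 => forall z, U z -> {for z, continuous f}
  | k'.+1 => (forall z, U z -> differentiable f z) /\
             forall v : T, Ck k' U (fun z => 'D_v f z)
  end.

(* Only used when U is open. *)
Definition smooth (U : set T) (f : T -> R) : Prop := forall k, Ck k U f.

Definition dvec (i : 'I_4) : T := delta_mx 0 i.

Definition bil (S : 'M[R]_4) (v w : T) : R := (v *m S *m w^T) 0 0.

Definition fam (k : nat) (s : seq T) : 'I_k -> T := fun i => s`_i.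

Definition upd (k : nat) (v : 'I_k -> T) (i : 'I_k) (u : T) : 'I_k -> T :=
  fun j => if j == i then u else v j.

End EuclideanCalculus.
Arguments dvec {R} i.
Arguments fam {R} k s.

Record chart (R : realType) (M : topologicalType) := Chart {
  cdom : set M;
  cmap : M -> 'rV[R]_4;
  cinv : 'rV[R]_4 -> M
}.

Definition chart_image (R : realType) (M : topologicalType) (c : chart R M)
  (U : set M) : set 'rV[R]_4 := cmap c @` (cdom c `&` U).

(* A homeomorphism, with inverse cinv c, from the open set cdom c onto an open
   subset of R^4; cmap c and cinv c are irrelevant outside these sets. *)
Definition is_chart (R : realType) (M : topologicalType) (c : chart R M) : Prop :=
  [/\ open (cdom c),
      open (chart_image c setT),
      forall x, cdom c x -> cinv c (cmap c x) = x,
      forall x, cdom c x -> {for x, continuous (cmap c)} &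
      forall z, chart_image c setT z -> {for z, continuous (cinv c)}].

(* The smooth oriented atlas is indexed by the points of M, chart_at p being a
   chart around p.  The tangent space T_x M is modelled by 'rV_4: a row vector
   is a tangent vector at x through its coordinates in the chart chart_at x.
   Accordingly gram x is the matrix of the metric at x in the basis of T_x M
   given by the coordinate vectors of chart_at x.  'J is the transposed
   Jacobian matrix (it acts on row vectors on the right). *)
Record oriented_riemannian4 (R : realType) (M : topologicalType) := ORM4 {
  chart_at : M -> chart R M;
  gram : M -> 'M[R]_4;
  chart_atP : forall p, is_chart (chart_at p) /\ cdom (chart_at p) p;
  chart_smooth : forall (p q : M) (i : 'I_4),
    smooth (chart_image (chart_at p) (cdom (chart_at q)))
      (fun z => cmap (chart_at q) (cinv (chart_at p) z) 0 i);
  chart_oriented : forall (p q x : M),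
    cdom (chart_at p) x -> cdom (chart_at q) x ->
    0 < \det ('J (cmap (chart_at q) \o cinv (chart_at p)) (cmap (chart_at p) x));
  gram_sym : forall x, (gram x)^T = gram x;
  gram_pos : forall x (v : 'rV[R]_4), v != 0 -> 0 < bil (gram x) v v;
  gram_smooth : forall (p : M) (u v : 'rV[R]_4),
    smooth (chart_image (chart_at p) setT)
      (fun z => let y := cinv (chart_at p) z in
        let J := 'J (cmap (chart_at y) \o cinv (chart_at p)) z in
        bil (gram y) (u *m J) (v *m J))
}.

Section Manifold.
Context (R : realType) (M : topologicalType) (X : oriented_riemannian4 R M).
Local Notation T := 'rV[R]_4.
Local Notation ch := (chart_at X).
Local Notation g := (gram X).

(* The vector field with constant components u in the chart chart_at p;
   meaningful for y in the domain of that chart. *)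
Definition cfield (p : M) (u : T) (y : M) : T :=
  u *m 'J (cmap (ch y) \o cinv (ch p)) (cmap (ch p) y).

Definition smooth_fun (U : set M) (f : M -> R) : Prop :=
  forall p, smooth (chart_image (ch p) U) (f \o cinv (ch p)).

Definition smooth_fun_near (x : M) (f : M -> R) : Prop :=
  exists U : set M, [/\ open U, U x & smooth_fun U f].

Definition dfun (f : M -> R) (x : M) (v : T) : R :=
  'D_v (f \o cinv (ch x)) (cmap (ch x) x).

Definition inner (x : M) (v w : T) : R := bil (g x) v w.

(* The Riemannian volume form on T_x M; the charts being oriented, the
   coordinate basis is positive. *)
Definition vol (x : M) (v : 'I_4 -> T) : R :=
  Num.sqrt (\det (g x)) * \det (\matrix_i v i).

Definition ginv (x : M) (i j : 'I_4) : R := invmx (g x) i j.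

(* On 2-forms, (star w)(v, w') = sum_{i,j} w(d_i, d_j) starc i j v w'
   = 1/2 sum_{a,b} w(e_a, e_b) vol(e_a, e_b, v, w') for e an orthonormal basis. *)
Definition starc (x : M) (i j : 'I_4) (v w : T) : R :=
  2^-1 * \sum_k \sum_l
    ginv x i k * ginv x j l * vol x (fam 4 [:: dvec k; dvec l; v; w]).

(* lframe U e means that e is an oriented orthonormal smooth frame over the open set U. *)
Record bundle3 := Bundle3 {
  fib : M -> vectType R;
  ip : forall x, fib x -> fib x -> R;
  lframe : set M -> (forall x, 'I_3 -> fib x) -> Prop
}.

Section Bundle.
Context (E : bundle3).

Definition smooth_sec (U : set M) (s : forall x, fib E x) : Prop :=
  forall (V : set M) (e : forall x, 'I_3 -> fib E x), lframe V e ->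
  forall i, smooth_fun (U `&` V) (fun y => ip (s y) (e y i)).

Definition smooth_sec_near (x : M) (s : forall x, fib E x) : Prop :=
  exists U : set M, [/\ open U, U x & smooth_sec U s].

(* An oriented Euclidean vector bundle of rank three, given by an atlas of
   oriented orthonormal frames; its smooth structure and its orientation are
   those for which these frames are smooth and positive. *)
Record oriented_euclidean3 : Prop := {
  fib_dim : forall x, \dim {: fib E x} = 3%N;
  ip_sym : forall x (u v : fib E x), ip u v = ip v u;
  ip_lin : forall x (a : R) (u v w : fib E x),
    ip (a *: u + v) w = a * ip u w + ip v w;
  ip_pos : forall x (u : fib E x), u != 0 -> 0 < ip u u;
  lframe_open : forall U (e : forall x, 'I_3 -> fib E x), lframe U e -> open U;
  lframe_on : forall U (e : forall x, 'I_3 -> fib E x), lframe U e ->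
    forall x, U x -> forall i j, ip (e x i) (e x j) = (i == j)%:R;
  lframe_cover : forall x, exists U (e : forall x, 'I_3 -> fib E x),
    lframe U e /\ U x;
  lframe_smooth : forall U (e : forall x, 'I_3 -> fib E x), lframe U e ->
    forall i, smooth_sec U (fun x => e x i);
  lframe_oriented : forall U V (e f : forall x, 'I_3 -> fib E x),
    lframe U e -> lframe V f -> forall x, U x -> V x ->
    0 < \det (\matrix_(i, j) ip (e x i) (f x j))
}.

(* A choice of oriented orthonormal basis of the fibre; no notion below depends
   on this choice. *)
Definition onb (x : M) : 'I_3 -> fib E x :=
  xget (fun=> 0) [set b : 'I_3 -> fib E x |
    exists U (e : forall x, 'I_3 -> fib E x), [/\ lframe U e, U x & b = e x]].

(* Cross product; indices are taken in Z/3. *)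
Definition cross (x : M) (u v : fib E x) : fib E x :=
  let c (w : fib E x) (i : 'I_3) : R := ip w (onb x i) in
  \sum_(i < 3) (c u (i + 1) * c v (i + 2) - c u (i + 2) * c v (i + 1)) *: onb x i.

Definition Form (k : nat) := forall x : M, ('I_k -> T) -> fib E x.

Definition is_form (k : nat) (w : Form k) : Prop :=
  [/\ forall x v i (a : R) (u u' : T),
        w x (upd v i (a *: u + u')) = a *: w x (upd v i u) + w x (upd v i u'),
      forall x v i j, i != j -> v i = v j -> w x v = 0 &
      forall p (u : 'I_k -> T),
        smooth_sec (cdom (ch p)) (fun y => w y (fun i => cfield p (u i) y))].

(* [alpha, beta], for the convention (a /\ b)(v, w) = a(v) b(w) - a(w) b(v). *)
Definition wedge_bracket (p q : nat) (a : Form p) (b : Form q) : Form (p + q) :=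
  fun x v => ((p`! * q`!)%N%:R : R)^-1 *: \sum_(s : 'S_(p + q))
    ((-1) ^+ s : R) *: cross (a x (fun i => v (s (lshift q i))))
                             (b x (fun j => v (s (rshift p j)))).

Definition hodge (w : Form 2) : Form 2 := fun x v =>
  \sum_i \sum_j starc x i j (v 0) (v 1) *: w x (fam 2 [:: dvec i; dvec j]).

Definition sdpart (w : Form 2) : Form 2 :=
  fun x v => (2^-1 : R) *: (w x v + hodge w x v).

(* Covariant derivatives D x v s of local sections s at x along v in T_x M;
   the value is irrelevant when s is not smooth near x. *)
Definition Conn := forall x : M, T -> (forall y, fib E y) -> fib E x.

Record so3_connection (D : Conn) : Prop := {
  conn_linv : forall x (a : R) u v s, smooth_sec_near x s ->
    D x (a *: u + v) s = a *: D x u s + D x v s;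
  conn_add : forall x v s t, smooth_sec_near x s -> smooth_sec_near x t ->
    D x v (fun y => s y + t y) = D x v s + D x v t;
  conn_leibniz : forall x v (f : M -> R) s,
    smooth_fun_near x f -> smooth_sec_near x s ->
    D x v (fun y => f y *: s y) = dfun f x v *: s x + f x *: D x v s;
  conn_smooth : forall U s, open U -> smooth_sec U s -> forall p u,
    smooth_sec (U `&` cdom (ch p)) (fun y => D y (cfield p u y) s);
  conn_metric : forall x v s t, smooth_sec_near x s -> smooth_sec_near x t ->
    dfun (fun y => ip (s y) (t y)) x v = ip (D x v s) (t x) + ip (s x) (D x v t)
}.

Definition same_conn (D D' : Conn) : Prop :=
  forall x v s, smooth_sec_near x s -> D x v s = D' x v s.

Definition conn_plus (D : Conn) (a : Form 1) : Conn :=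
  fun x v s => D x v s + cross (a x (fun=> v)) (s x).

(* d_D, evaluated on the constant extensions of v_0, ..., v_k in the chart
   chart_at x: these commute, so the terms with Lie brackets vanish. *)
Definition dcov (D : Conn) (k : nat) (w : Form k) : Form k.+1 := fun x v =>
  \sum_(j < k.+1) ((-1) ^+ j : R) *:
    D x (v j) (fun y => w y (fun i => cfield x (v (lift j i)) y)).

(* d_D (d_D s) (v, w), as an operator on sections. *)
Definition curv_op (D : Conn) (x : M) (v w : T) (s : forall y, fib E y) : fib E x :=
  D x v (fun y => D y (cfield x w y) s) - D x w (fun y => D y (cfield x v y) s).

(* F_D, through the identification of so(E) with E: d_D (d_D s) = [F_D, s]. *)
Definition curv (D : Conn) : Form 2 := fun x v =>
  xget 0 [set f : fib E x |
    forall s, smooth_sec_near x s -> curv_op D x (v 0) (v 1) s = cross f (s x)].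

Definition yang_mills (D : Conn) : Prop :=
  so3_connection D /\ forall x v, dcov D (hodge (curv D)) x v = 0.

End Bundle.

Section Hom.
Context (E F : bundle3).

Definition smooth_hom (f : forall x, 'Hom(fib E x, fib F x)) : Prop :=
  forall (U V : set M) (e : forall x, 'I_3 -> fib E x)
    (e' : forall x, 'I_3 -> fib F x), lframe U e -> lframe V e' ->
  forall i j, smooth_fun (U `&` V) (fun y => ip (f y (e y i)) (e' y j)).

Definition orientation_preserving_iso (x : M) (f : 'Hom(fib E x, fib F x)) : Prop :=
  bijective f /\ 0 < \det (\matrix_(i, j) ip (f (onb E x i)) (onb F x j)).

Definition orientation_preserving_isometry
    (f : forall x, 'Hom(fib E x, fib F x)) : Prop :=
  [/\ smooth_hom f,
      forall x (u v : fib E x), ip (f x u) (f x v) = ip u v &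
      forall x, orientation_preserving_iso (f x)].

Definition push_conn (f : forall x, 'Hom(fib E x, fib F x)) (D : Conn E) : Conn F :=
  fun x v s => f x (D x v (fun y => (f y)^-1%VF (s y))).

End Hom.

(* A 2-form at x is the matrix S of its components in the chart chart_at x,
   with value bil S v w on the tangent vectors v, w. *)
Definition hodge_mx (x : M) (S : 'M[R]_4) : 'M[R]_4 :=
  \matrix_(a, b) \sum_i \sum_j starc x i j (dvec a) (dvec b) * S i j.

Definition selfdual (x : M) : {vspace 'M[R]_4} :=
  (lker (linfun (fun S : 'M[R]_4 => (S^T + S)%R)) :&:
   lker (linfun (fun S : 'M[R]_4 => (hodge_mx x S - S)%R)))%VS.

(* With the factor 1/2, the theta_a /\ theta_b with a < b are orthonormal, for
   theta an orthonormal coframe. *)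
Definition ip2 (x : M) (S S' : 'M[R]_4) : R :=
  2^-1 * \sum_i \sum_j \sum_k \sum_l ginv x i k * ginv x j l * S i j * S' k l.

(* Covectors are given by their components in the chart chart_at x. *)
Definition wedge1 (t t' : T) : 'M[R]_4 := t^T *m t' - t'^T *m t.

Record oriented_coframe (U : set M) (t : M -> 'I_4 -> T) : Prop := {
  coframe_open : open U;
  coframe_on : forall x, U x -> forall a b,
    bil (invmx (g x)) (t x a) (t x b) = (a == b)%:R;
  coframe_pos : forall x, U x -> 0 < \det (\matrix_a t x a);
  coframe_smooth : forall a p u,
    smooth_fun (U `&` cdom (ch p)) (fun y => (cfield p u y *m (t y a)^T) 0 0)
}.

(* The coframe vectors of index 1, 2, 3 are those of index lift ord0 i, i in Z/3. *)
Definition Sigma (t : 'I_4 -> T) (i : 'I_3) : 'M[R]_4 :=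
  - (Num.sqrt 2)^-1 *:
    (wedge1 (t 0) (t (lift ord0 i)) +
     wedge1 (t (lift ord0 (i + 1))) (t (lift ord0 (i + 2)))).

Definition LambdaP : bundle3 := {|
  fib := fun x => subvs_of (selfdual x);
  ip := fun x S S' => ip2 x (vsval S) (vsval S');
  lframe := fun U e => exists2 t, oriented_coframe U t &
    forall x, U x -> forall i, vsval (e x i) = Sigma (t x) i
|}.

Definition mx_of (x : M) (S : fib LambdaP x) : 'M[R]_4 := vsval S.

Definition of_mx (x : M) (S : 'M[R]_4) : fib LambdaP x := vsproj (selfdual x) S.

(* Levi-Civita derivative at x, along u, of the field with constant components
   v in the chart chart_at x, by the Koszul formula. *)
Definition levi_civita (x : M) (u v : T) : T :=
  let G (a b : T) (y : M) := inner y (cfield x a y) (cfield x b y) in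
  (2^-1 *: \row_k (dfun (G v (dvec k)) x u + dfun (G u (dvec k)) x v
                   - dfun (G u v) x (dvec k))) *m invmx (g x).

(* The Levi-Civita derivative of a 2-form, D_u s (v, w) =
   u (s (v, w)) - s (D_u v, w) - s (v, D_u w).  It preserves self-duality, so
   that the self-dual projection below is the identity. *)
Definition Gamma : Conn LambdaP := fun x u s =>
  let S : 'M[R]_4 := \matrix_(i, j)
    (dfun (fun y => bil (mx_of (s y)) (cfield x (dvec i) y) (cfield x (dvec j) y)) x u
     - bil (mx_of (s x)) (levi_civita x u (dvec i)) (dvec j)
     - bil (mx_of (s x)) (dvec i) (levi_civita x u (dvec j))) in
  of_mx x (2^-1 *: (S + hodge_mx x S)).

(* The homomorphism E -> Lambda^+ given by the self-dual part of the curvature: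
   v is sent to the 2-form (X, Y) |-> <F^+(X, Y), v>. *)
Definition curv_hom (E : bundle3) (D : Conn E) (x : M) :
    'Hom(fib E x, fib LambdaP x) :=
  linfun (fun v : fib E x => of_mx x
    (\matrix_(i, j) ip (sdpart (curv D) x (fam 2 [:: dvec i; dvec j])) v)).

Definition Endo := forall x : M, 'End(fib LambdaP x).

Definition positive_selfadjoint (h : Endo) : Prop :=
  (forall x (u v : fib LambdaP x), ip (h x u) v = ip u (h x v)) /\
  (forall x (u : fib LambdaP x), u != 0 -> 0 < ip (h x u) u).

Definition Omega0p (h : Endo) : Prop :=
  smooth_hom h /\ positive_selfadjoint h.

Definition B_of (h : Endo) : Form LambdaP 2 := fun x v =>
  \sum_(i < 3) bil (mx_of (h x (onb LambdaP x i))) (v 0) (v 1) *: onb LambdaP x i.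

Definition ad (h : Endo) (a : Form LambdaP 1) : Form LambdaP 3 :=
  wedge_bracket a (B_of h).

Definition ad_inv (h : Endo) (w : Form LambdaP 3) : Form LambdaP 1 :=
  xget (fun _ _ => 0) [set a | is_form a /\ ad h a = w].

Definition conn_of (h : Endo) : Conn LambdaP :=
  conn_plus Gamma (fun x v => - ad_inv h (dcov Gamma (B_of h)) x v).

Definition Phi (h : Endo) : Endo := fun x =>
  (curv_hom (conn_of h) x \o (h x)^-1 - \1)%VF.

Definition gauge_transformation (f : Endo) : Prop :=
  orientation_preserving_isometry f.

End Manifold.

(* Main.v *)
From HB Require Import structures.
Require Import Defs.
From mathcomp Require Import ring lra.

(** Let B_h be the two-form with values in the bundle of self-dual forms that
    corresponds to h. The connection A(h) differs from the Levi-Civita connection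
    Gamma by the one-form a with [a, B_h] = - d_Gamma B_h, which says precisely
    that B_h is closed for A(h). If Phi(h) = 0, the self-dual curvature of A(h)
    is B_h, so that F^+ is closed; since the star of F is 2 F^+ - F and F is
    closed by the Bianchi identity, A(h) is Yang-Mills (equation_yang_mills).
    Conversely, let A be Yang-Mills. The same computation shows that F^+ is
    closed. The polar decomposition of the curvature homomorphism is the only
    way to write it as h R, with R an isometry and h positive; transporting A by
    R gives a connection with self-dual curvature B_h (normalise). Then B_h is
    closed for that connection, which is therefore Gamma + a with a as above, by
    uniqueness of a (yang_mills_equation).

    Three points need work.

    The bracket with B_h has to be inverted smoothly. In an orthonormal coframe,
    the self-dual forms h(Sigma_i) act as imaginary quaternions Q_i, and
    three-forms are covectors, for which the equation reads, up to a constant,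
    a_1 Q_2 - a_2 Q_1 = c_0 and cyclically. For imaginary quaternions x y z - z y x is
    real, so that a_i is a multiple of the sum over j of c_j Q_i Q_j, with a
    factor 1 / det h (brkK, unbrkK, ad_inj, ad_surj).

    The isometry R has to be smooth. Pointwise it comes from maximising a trace
    over the orthogonal group (polar_decomposition); it is smooth because the
    square root of a smooth family of positive definite matrices is
    (smooth_sqrtm), and unique because the square root is.

    The connection Gamma, the curvature and the exterior derivatives are defined
    at each point in a chart attached to that point. They are smooth tensors
    because the second derivatives of coordinate changes, which appear when the
    chart varies, are symmetric and cancel (K_chart, dcov3_chart, kos_chart).
    The curvature exists because a skew endomorphism in dimension three is a
    cross product, and the Bianchi identity is the Jacobi identity for
    commutators of covariant derivatives. *)

Set Implicit Arguments.
Unset Strict Implicit.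
Unset Printing Implicit Defensive.

Local Open Scope classical_set_scope.
Local Open Scope ring_scope.

(** * Smooth functions on open subsets of R^4 *)

Section Calculus.
Context (R : realType).
Local Notation T := 'rV[R]_4.
Implicit Types (U V : set T) (f g : T -> R).

Lemma Ck_sub k U V f : U `<=` V -> Ck k V f -> Ck k U f.
Proof.
elim: k f => [|k IH] f UV /=; first by move=> h z Uz; apply: h; exact: UV.
by case=> h1 h2; split=> [z Uz|v]; [apply: h1; exact: UV | apply: IH].
Qed.

Lemma Ck_points k U f : (forall z, U z -> exists2 V, V z & Ck k V f) -> Ck k U f.
Proof.
elim: k f => [|k IH] f /= h; first by move=> z Uz; have [V Vz] := h z Uz; apply.
split=> [z Uz|v]; first by have [V Vz [+ _]] := h z Uz; apply.
by apply: IH => z Uz; have [V Vz [_ +]] := h z Uz => /(_ v); exists V.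
Qed.

Lemma Ck_cts k U f : Ck k U f -> forall z, U z -> {for z, continuous f}.
Proof.
case: k => [//|k] [h _] z Uz.
exact: differentiable_continuous (h z Uz).
Qed.

Lemma Ck_lt k U f : Ck k.+1 U f -> Ck k U f.
Proof.
elim: k f => [|k IH] f h; first exact: (Ck_cts h).
by case: h => h1 h2; split=> // v; apply: IH.
Qed.

Lemma near_open U z (P : T -> Prop) : open U -> U z -> (forall y, U y -> P y) ->
  \near z, P z.
Proof. by move=> oU Uz h; near=> y; apply: h; near: y; exact: open_nbhs_nbhs. Unshelve. all: by end_near. Qed.

Lemma diff_criterion (V : normedModType R) (f : V -> R) (L : {linear V -> R}) x :
  continuous L ->
  (forall e, 0 < e -> \forall h \near 0, `|f (h + x) - f x - L h| <= e * `|h|) ->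
  differentiable f x /\ 'd f x = L :> (V -> R).
Proof.
move=> cL H.
have E : f \o shift x = cst (f x) + L +o_ 0 id.
  apply/eqaddoP => e e0; near=> h.
  rewrite /= !fctE opprD addrA; near: h; exact: H.
have dL := diff_unique cL E.
split=> //; apply/diff_locallyP; split; first by rewrite dL.
by rewrite {1}E dL.
Unshelve. all: by end_near. Qed.

Lemma diff_estimate (V : normedModType R) (f : V -> R) x : differentiable f x ->
  forall e, 0 < e -> \forall h \near 0, `|f (h + x) - f x - 'd f x h| <= e * `|h|.
Proof.
move=> /diff_locally /eqaddoP H e e0; apply: filterS (H e e0) => h.
by rewrite /= !fctE opprD addrA.
Qed.

Lemma near_eq_differentiable (V : normedModType R) (f g : V -> R) z : (\near z, f z = g z) ->
  differentiable f z -> differentiable g z.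
Proof.
move=> fg df; have e := nbhs_singleton fg.
have [] // := @diff_criterion V g ('d f z) z (diff_continuous df).
move=> e' e0; have H := diff_estimate df e0.
have fg0 : \forall h \near 0, f (h + z) = g (h + z).
  by move: fg; rewrite (near_shift 0 z) subr0.
by near=> h; rewrite -e -(near fg0 h)//; near: h.
Unshelve. all: by end_near. Qed.

Lemma Ck_ext k U f g : open U -> (forall z, U z -> f z = g z) -> Ck k U f -> Ck k U g.
Proof.
move=> oU; elim: k f g => [|k IH] f g fg /=.
  move=> cf z Uz; have nfg : \near z, f z = g z by exact: near_open oU Uz fg.
  have cfz : f x @[x --> z] --> g z by rewrite -fg//; exact: cf.
  exact: cvg_trans (near_eq_cvg nfg) cfz.
case=> h1 h2; split=> [z Uz|v].
  by apply: near_eq_differentiable (h1 z Uz); exact: near_open oU Uz fg.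
apply: IH (h2 v) => z Uz; apply: near_eq_derive; exact: near_open oU Uz fg.
Qed.

Lemma Ck_diff k U f z : Ck k.+1 U f -> U z -> differentiable f z.
Proof. by case=> + _ Uz; apply. Qed.

Lemma Ck_derive k U f v : Ck k.+1 U f -> Ck k U (fun z => 'D_v f z).
Proof. by case=> _; apply. Qed.

Lemma Ck_cst k U (a : R) : Ck k U (fun=> a).
Proof.
elim: k a => [|k IH] a /=; first by move=> z Uz; exact: cst_continuous.
split=> [z _|v]; first exact: differentiable_cst.
by rewrite [X in Ck k U X](_ : _ = fun=> 0)//; apply/funext => z; exact: derive_cst.
Qed.

Lemma Ck_add k U f g : open U -> Ck k U f -> Ck k U g -> Ck k U (fun z => f z + g z).
Proof.
move=> oU; elim: k f g => [|k IH] f g.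
  move=> cf cg z Uz; have h1 := cf z Uz; have h2 := cg z Uz. exact: cvgD h1 h2.
move=> cf cg; split=> [z Uz|v].
  exact: differentiableD (Ck_diff cf Uz) (Ck_diff cg Uz).
apply: Ck_ext oU _ (IH _ _ (Ck_derive v cf) (Ck_derive v cg)) => z Uz.
by rewrite -deriveD//; apply: diff_derivable; [exact: Ck_diff cf Uz | exact: Ck_diff cg Uz].
Qed.

Lemma Ck_mul k U f g : open U -> Ck k U f -> Ck k U g -> Ck k U (fun z => f z * g z).
Proof.
move=> oU; elim: k f g => [|k IH] f g.
  by move=> cf cg z Uz; have h1 := cf z Uz; have h2 := cg z Uz; exact: cvgM h1 h2.
move=> cf cg; split=> [z Uz|v].
  exact: differentiableM (Ck_diff cf Uz) (Ck_diff cg Uz).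
have h1 := IH _ _ (Ck_lt cf) (Ck_derive v cg).
have h2 := IH _ _ (Ck_lt cg) (Ck_derive v cf).
apply: Ck_ext oU _ (Ck_add oU h1 h2) => z Uz.
by rewrite -deriveM//; apply: diff_derivable; [exact: Ck_diff cf Uz | exact: Ck_diff cg Uz].
Qed.

Lemma Ck_scale k U (a : R) f : open U -> Ck k U f -> Ck k U (fun z => a * f z).
Proof. by move=> oU; apply: Ck_mul => //; exact: Ck_cst. Qed.

Lemma Ck_opp k U f : open U -> Ck k U f -> Ck k U (fun z => - f z).
Proof.
by move=> oU /(Ck_scale (-1) oU); apply: Ck_ext => // z _; rewrite mulN1r.
Qed.

Lemma Ck_sub2 k U f g : open U -> Ck k U f -> Ck k U g -> Ck k U (fun z => f z - g z).
Proof. by move=> oU cf cg; apply: Ck_add => //; exact: Ck_opp. Qed.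

Lemma Ck_sum k U (I : Type) (r : seq I) (P : pred I) (F : I -> T -> R) : open U ->
  (forall i, P i -> Ck k U (F i)) -> Ck k U (fun z => \sum_(i <- r | P i) F i z).
Proof.
move=> oU h; elim: r => [|i r IH].
  by apply: Ck_ext oU _ (Ck_cst k U 0) => z _; rewrite big_nil.
case Pi : (P i); last by apply: Ck_ext oU _ IH => z _; rewrite big_cons Pi.
by apply: Ck_ext oU _ (Ck_add oU (h i Pi) IH) => z _; rewrite big_cons Pi.
Qed.

Lemma Ck_prod k U (I : Type) (r : seq I) (P : pred I) (F : I -> T -> R) : open U ->
  (forall i, P i -> Ck k U (F i)) -> Ck k U (fun z => \prod_(i <- r | P i) F i z).
Proof.
move=> oU h; elim: r => [|i r IH].
  by apply: Ck_ext oU _ (Ck_cst k U 1) => z _; rewrite big_nil.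
case Pi : (P i); last by apply: Ck_ext oU _ IH => z _; rewrite big_cons Pi.
by apply: Ck_ext oU _ (Ck_mul oU (h i Pi) IH) => z _; rewrite big_cons Pi.
Qed.

Lemma Ck_inv k U f : open U -> (forall z, U z -> f z != 0) -> Ck k U f ->
  Ck k U (fun z => (f z)^-1).
Proof.
move=> oU f0; elim: k => [|k IH] cf.
  by move=> z Uz; have h1 := cf z Uz; exact: (cvgV (f0 z Uz) h1).
split=> [z Uz|v].
  by apply: differentiableV (f0 z Uz); exact: Ck_diff cf Uz.
have h := IH (Ck_lt cf).
apply: Ck_ext oU _ (Ck_opp oU (Ck_mul oU (Ck_mul oU h h) (Ck_derive v cf))) => z Uz.
rewrite deriveV; [|exact: f0|exact: diff_derivable (Ck_diff cf Uz)].
by rewrite -exprVn expr2 -mulNr.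
Qed.

Lemma Ck_sqrt k U f : open U -> (forall z, U z -> 0 < f z) -> Ck k U f ->
  Ck k U (fun z => Num.sqrt (f z)).
Proof.
move=> oU f0; elim: k => [|k IH] cf.
  by move=> z Uz; apply: continuous_comp; [exact: (cf z Uz) | exact: sqrt_continuous].
have ds z : U z -> differentiable (@Num.sqrt R) (f z).
  by move=> Uz; apply/derivable1_diffP; have [] := is_derive1_sqrt (f0 z Uz).
split=> [z Uz|v].
  exact: differentiable_comp (Ck_diff cf Uz) (ds z Uz).
have h := Ck_inv oU (fun z Uz => lt0r_neq0 (etrans (sqrtr_gt0 _) (f0 z Uz))) (IH (Ck_lt cf)).
apply: Ck_ext oU _ (Ck_scale 2^-1 oU (Ck_mul oU h (Ck_derive v cf))) => z Uz.
have dz := Ck_diff cf Uz.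
rewrite [RHS]deriveE; last exact: differentiable_comp (Ck_diff cf Uz) (ds z Uz).
have d1 : derivable (@Num.sqrt R) (f z) 1 by apply: diff_derivable; exact: ds.
rewrite (diff_comp dz (ds z Uz)) /= (deriv1E d1) derive1E derive_sqrt ?f0//.
by rewrite -deriveE// /GRing.scale /= invfM mulrA mulrC.
Qed.

Lemma is_derive_line f z u (s : R) : derivable f (z + s *: u) u ->
  is_derive s 1 (fun s : R => f (z + s *: u)) ('D_u f (z + s *: u)).
Proof.
have E : (fun h : R => h^-1 *: (((fun s : R => f (z + s *: u)) \o shift s) (h *: 1) - f (z + s *: u)))
   = (fun h : R => h^-1 *: ((f \o shift (z + s *: u)) (h *: u) - f (z + s *: u))).
  apply/funext => h /=; congr (_ *: (f _ - _)).
  by rewrite [h%:A]mulr1 scalerDl addrCA.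
by move=> df; apply: DeriveDef; rewrite /derivable /derive E.
Qed.

Lemma mvt_line f z u (d : R) : 0 <= d ->
  (forall s, 0 <= s <= d -> derivable f (z + s *: u) u) ->
  exists2 s, 0 <= s <= d & f (z + d *: u) - f z = 'D_u f (z + s *: u) * d.
Proof.
move=> d0 df; pose ph (s : R) := f (z + s *: u).
have dph s : 0 <= s <= d -> is_derive s 1 ph ('D_u f (z + s *: u)).
  by move=> sd; apply: is_derive_line; exact: df.
have [s'|s'|c] := @MVT_segment _ ph (fun s => 'D_u f (z + s *: u)) 0 d d0.
- by rewrite in_itv /= => /andP[s0 sd]; apply: dph; rewrite !ltW.
- apply: derivable_within_continuous => s; rewrite in_itv /= => sd.
  by have [] := dph s sd.
rewrite in_itv /= => cd E; exists c => //.
by move: E; rewrite /ph scale0r addr0 subr0.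
Qed.

Lemma dist_half (a b c e : R) : `|b - c| <= e / 2 -> `|a - c| <= e / 2 -> `|a - b| <= e.
Proof. by rewrite !ler_norml => /andP[h1 h2] /andP[h3 h4]; apply/andP; split; lra. Qed.

Lemma common_ball z (A B C : set T) : nbhs z A -> nbhs z B -> nbhs z C ->
  exists2 r : R, 0 < r & forall y, ball z r y -> [/\ A y, B y & C y].
Proof.
move=> nA nB nC; have /nbhs_ballP[r r0 h] : nbhs z (A `&` (B `&` C)).
  by apply: filterI => //; exact: filterI.
by exists r => // y /h [? []].
Qed.

(** Two applications of the mean value theorem. *)
Lemma second_difference f U z u v (d : R) : Ck 2 U f -> 0 <= d ->
  (forall s t, 0 <= s <= d -> 0 <= t <= d -> U (z + s *: u + t *: v)) ->
  exists s t, [/\ 0 <= s <= d, 0 <= t <= d &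
    f (z + d *: u + d *: v) - f (z + d *: u) - (f (z + d *: v) - f z)
    = 'D_v (fun z => 'D_u f z) (z + s *: u + t *: v) * d * d].
Proof.
move=> cf d0 hU.
have d0d : 0 <= d <= d by rewrite d0 lexx.
have o0d : 0 <= (0 : R) <= d by rewrite d0 lexx.
pose F y := f (y + d *: v) - f y.
have df y : U y -> derivable f y u by move=> Uy; exact: diff_derivable (Ck_diff cf Uy).
have shf y : U (y + d *: v) -> is_derive y u (fun y => f (y + d *: v)) ('D_u f (y + d *: v)).
  move=> Uy; have E : (fun h : R => h^-1 *: (((fun y => f (y + d *: v)) \o shift y) (h *: u) - f (y + d *: v)))
   = (fun h : R => h^-1 *: ((f \o shift (y + d *: v)) (h *: u) - f (y + d *: v))).
    by apply/funext => h /=; congr (_ *: (f _ - _)); rewrite addrA.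
  by have dy := df _ Uy; apply: DeriveDef; rewrite /derivable /derive E.
have dF s : 0 <= s <= d -> is_derive (z + s *: u) u F ('D_u f (z + s *: u + d *: v) - 'D_u f (z + s *: u)).
  move=> sd; apply: is_deriveB; first by apply: shf; exact: hU.
  by apply: derivableP; apply: df; have := hU s 0 sd o0d; rewrite scale0r addr0.
have [s sd E1] := mvt_line d0 (fun s sd => @ex_derive _ _ _ _ _ _ _ (dF s sd)).
have [|t td E2] := @mvt_line (fun z => 'D_u f z) (z + s *: u) v d d0.
  by move=> t td; exact: diff_derivable (Ck_diff (Ck_derive u cf) (hU s t sd td)).
exists s, t; split=> //.
rewrite -E2; move: E1; rewrite (@derive_val _ _ _ _ _ _ _ (dF s sd)) => <-.
by rewrite /F.
Qed.

(** Both mixed derivatives are the limit of one symmetric second difference. *)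
Lemma Ck2_schwarz f U z u v : open U -> Ck 2 U f -> U z ->
  'D_u (fun z => 'D_v f z) z = 'D_v (fun z => 'D_u f z) z.
Proof.
move=> oU cf Uz; apply/eqP; rewrite -subr_eq0 -normr_le0; apply/ler_addgt0Pr => e e0.
rewrite add0r.
have e20 : 0 < e / 2 by rewrite divr_gt0.
have c1 := Ck_cts (Ck_derive u (Ck_derive v cf)) Uz.
have c2 := Ck_cts (Ck_derive v (Ck_derive u cf)) Uz.
move/cvgrPdist_le : c1 => /(_ _ e20) c1.
move/cvgrPdist_le : c2 => /(_ _ e20) c2.
have [r r0 hr] := common_ball (open_nbhs_nbhs (conj oU Uz)) c1 c2.
pose d := r / (2 * (1 + `|u| + `|v|)).
have K0 : 0 < 1 + `|u| + `|v| by rewrite ltr_wpDr// ltr_wpDr.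
have d0 : 0 < d by rewrite divr_gt0// mulr_gt0.
have hd s t : 0 <= s <= d -> 0 <= t <= d -> ball z r (z + s *: u + t *: v).
  move=> /andP[s0 sd] /andP[t0 td]; rewrite -ball_normE /= -addrA opprD addNKr normrN.
  apply: (@le_lt_trans _ _ (d * (1 + `|u| + `|v|))).
    apply: le_trans (ler_normD _ _) _; rewrite !normrZ !ger0_norm//.
    rewrite -addrA mulrDr mulr1 mulrDr ler_wpDl//; first exact: ltW.
    by rewrite lerD// ler_wpM2r.
  rewrite /d invfM mulrA -mulrA mulVf ?gt_eqF// mulr1.
  by rewrite ltr_pdivrMr// mulr_natr mulr2n ltrDl.
have [s [t [sd td E1]]] := second_difference cf (ltW d0) (fun s t sd td => (let: And3 h _ _ := hr _ (hd s t sd td) in h)).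
have hd' s' t' : 0 <= s' <= d -> 0 <= t' <= d -> ball z r (z + s' *: v + t' *: u).
  by move=> h1 h2; rewrite addrAC; exact: hd.
have [s' [t' [sd' td' E2]]] := second_difference cf (ltW d0) (fun s t sd td => (let: And3 h _ _ := hr _ (hd' s t sd td) in h)).
have E : 'D_v (fun z => 'D_u f z) (z + s *: u + t *: v) = 'D_u (fun z => 'D_v f z) (z + s' *: v + t' *: u).
  apply: (mulIf (lt0r_neq0 d0)); apply: (mulIf (lt0r_neq0 d0)).
  have E3 : z + d *: v + d *: u = z + d *: u + d *: v by rewrite addrAC.
  rewrite E3 in E2; apply: etrans (esym E1) _; apply: etrans _ E2.
  by move: (f (z + d *: u + d *: v)) (f (z + d *: u)) (f (z + d *: v)) (f z) => a b c e'; lra.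
have [_ _ h1] := hr _ (hd s t sd td).
have [_ h2 _] := hr _ (hd' _ _ sd' td').
rewrite E in h1.
exact: dist_half h1 h2.
Qed.

End Calculus.

Section Composition.
Context (R : realType).
Local Notation T := 'rV[R]_4.
Implicit Types (U V : set T) (f g : T -> R).

Lemma derive_lin f z a u v : differentiable f z ->
  'D_(a *: u + v) f z = a * 'D_u f z + 'D_v f z.
Proof. by move=> df; rewrite !deriveE// linearP. Qed.

Lemma derive_sumv f z (I : Type) (r : seq I) (c : I -> R) (u : I -> T) : differentiable f z ->
  'D_(\sum_(i <- r) c i *: u i) f z = \sum_(i <- r) c i * 'D_(u i) f z.
Proof.
move=> df; rewrite deriveE// linear_sum; apply: eq_bigr => i _.
by rewrite linearZ -deriveE.
Qed.

Lemma rV_basis (u : T) : u = \sum_i u 0 i *: dvec i.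
Proof. exact: row_sum_delta. Qed.

Lemma diff_rV (t : T -> T) z : (forall i, differentiable (fun y => t y 0 i) z) ->
  differentiable t z.
Proof.
move=> dt; have -> : t = \sum_(i < 4) (fun y => t y 0 i *: dvec i).
  by apply/funext => y; rewrite fct_sumE {1}(rV_basis (t y)).
by apply: differentiable_sum => i; apply: differentiableZl.
Qed.

Lemma derive_rV (t : T -> T) z v i : differentiable t z ->
  ('D_v t z) 0 i = 'D_v (fun y => t y 0 i) z.
Proof. by move=> dt; rewrite derive_mx ?mxE//; exact: diff_derivable. Qed.

Lemma derive_comp (W : normedModType R) (f : T -> W) (t : T -> T) z v : differentiable t z ->
  differentiable f (t z) -> 'D_v (f \o t) z = 'D_('D_v t z) f (t z).
Proof.
move=> dt df; rewrite deriveE; last exact: differentiable_comp.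
by rewrite diff_comp//= !deriveE.
Qed.

Lemma Ck_comp k U V f (t : T -> T) : open U -> open V ->
  (forall i, Ck k.+1 U (fun z => t z 0 i)) -> (forall z, U z -> V (t z)) ->
  Ck k V f -> Ck k U (f \o t).
Proof.
move=> oU oV; elim: k f => [|k IH] f ct UV cf.
  move=> z Uz; apply: continuous_comp; last exact: (cf _ (UV _ Uz)).
  by apply: differentiable_continuous; apply: diff_rV => i; exact: Ck_diff (ct i) Uz.
have dt z : U z -> differentiable t z by move=> Uz; apply: diff_rV => i; exact: Ck_diff (ct i) Uz.
split=> [z Uz|v].
  by apply: differentiable_comp; [exact: dt | exact: Ck_diff cf (UV _ Uz)].
have h : Ck k U (fun z => \sum_i 'D_v (fun y => t y 0 i) z * ((fun z => 'D_(dvec i) f z) \o t) z).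
  apply: Ck_sum => // i _; apply: Ck_mul => //; first exact: Ck_lt (Ck_derive v (ct i)).
  by apply: IH => //; [move=> j; exact: Ck_lt | exact: Ck_derive].
apply: Ck_ext oU _ h => z Uz.
rewrite derive_comp; [|exact: dt|exact: Ck_diff cf (UV _ Uz)].
rewrite {1}(rV_basis ('D_v t z)).
rewrite derive_sumv; last exact: Ck_diff cf (UV _ Uz).
by apply: eq_bigr => i _; rewrite derive_rV//; exact: dt.
Qed.

End Composition.

Section Matrices.
Context (R : realType).
Local Notation T := 'rV[R]_4.

Definition Ck_mx k (U : set T) m n (A : T -> 'M[R]_(m, n)) :=
  forall i j, Ck k U (fun z => A z i j).

Lemma Ck_mulmx k U m n p (A : T -> 'M[R]_(m, n)) (B : T -> 'M[R]_(n, p)) : open U ->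
  Ck_mx k U A -> Ck_mx k U B -> Ck_mx k U (fun z => A z *m B z).
Proof.
move=> oU cA cB i j.
apply: (@Ck_ext _ _ _ (fun z => \sum_l A z i l * B z l j)) => //.
  by move=> z _; rewrite mxE.
by apply: Ck_sum => // l _; exact: Ck_mul.
Qed.

Lemma Ck_det k U n (A : T -> 'M[R]_n) : open U ->
  Ck_mx k U A -> Ck k U (fun z => \det (A z)).
Proof.
move=> oU cA; apply: Ck_sum => // s _; apply: Ck_scale => //.
by apply: Ck_prod => // i _; exact: cA.
Qed.

Lemma Ck_invmx k U n (A : T -> 'M[R]_n) : open U -> (forall z, U z -> A z \in unitmx) ->
  Ck_mx k U A -> Ck_mx k U (fun z => invmx (A z)).
Proof.
move=> oU uA cA i j.
apply: (@Ck_ext _ _ _ (fun z => (\det (A z))^-1 * ((-1) ^+ (j + i) * \det (row' j (col' i (A z)))))) => //.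
  by move=> z Uz; rewrite /invmx uA// !mxE.
apply: Ck_mul => //.
  by apply: Ck_inv => //; [move=> z /uA; rewrite unitmxE unitfE | exact: Ck_det].
apply: Ck_scale => //; apply: Ck_det => // a b.
apply: (@Ck_ext _ _ _ (fun z => A z (lift j a) (lift i b))) => //.
by move=> z _; rewrite !mxE.
Qed.

Definition posdef n (S : 'M[R]_n) :=
  S^T = S /\ forall v : 'rV[R]_n, v != 0 -> 0 < (v *m S *m v^T) 0 0.

Lemma posdef_unit n (S : 'M[R]_n) : posdef S -> S \in unitmx.
Proof.
move=> [_ pS]; rewrite -row_free_unit -kermx_eq0; apply/eqP/row_matrixP => i; rewrite row0.
apply: contrapT => /eqP ri; have := pS _ ri.
have /sub_kermxP -> : (row i (kermx S) <= kermx S)%MS by exact: row_sub.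
by rewrite mul0mx mxE ltxx.
Qed.

(** A positive definite matrix factors as t^T t; reducing it by its first
    variable keeps everything a smooth function of the matrix. *)
Lemma smooth_cholesky n (U : set T) (G : T -> 'M[R]_n) : open U ->
  (forall z, U z -> posdef (G z)) -> (forall k, Ck_mx k U G) ->
  exists t : T -> 'M[R]_n, [/\ forall k, Ck_mx k U t,
    forall z, U z -> (t z)^T *m t z = G z & forall z, U z -> 0 < \det (t z)].
Proof.
move=> oU; elim: n G => [|n IH] G pG cG.
  exists (fun=> 1%:M); split=> [k []//|z _|z _]; first by apply/matrixP => -[].
  by rewrite det_mx00.
move: G pG cG; rewrite -[n.+1]/(1 + n)%N => G pG cG.
pose a z := G z (lshift n ord0) (lshift n ord0).
pose b z : 'rV[R]_n := ursubmx (G z).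
pose D z : 'M[R]_n := drsubmx (G z).
have GE z : U z -> G z = block_mx (a z)%:M (b z) (b z)^T (D z).
  move=> Uz; have [sG _] := pG z Uz; rewrite -[LHS]submxK; congr block_mx.
    by rewrite [LHS]mx11_scalar !mxE.
  by rewrite -[in LHS]sG -trmx_ursub.
have a0 z : U z -> 0 < a z.
  move=> Uz; have [_ /(_ (row_mx 1%:M 0))] := pG z Uz.
  rewrite GE// tr_row_mx mul_row_block mul_row_col trmx0 mulmx0 addr0 !mul1mx trmx1.
  rewrite mul0mx addr0 mulmx1 mxE eqxx mulr1n; apply.
  apply/eqP => /(congr1 (fun m => lsubmx m)); rewrite row_mxKl linear0 => /matrixP /(_ 0 0).
  by rewrite !mxE eqxx => /eqP; rewrite oner_eq0.
(* The Schur complement of the first entry. *)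
pose G' z := D z - (a z)^-1 *: ((b z)^T *m b z).
have pG' z : U z -> posdef (G' z).
  move=> Uz; have [sG pp] := pG z Uz; split.
    rewrite /G' linearB linearZ /= trmx_mul trmxK; congr (_ - _).
    by rewrite /D -[in RHS]sG trmx_drsub.
  move=> v v0; have := pp (row_mx (- (a z)^-1 *: (v *m (b z)^T)) v).
  set w := row_mx _ _; have -> : w *m G z = row_mx 0 (v *m G' z).
    rewrite GE// mul_row_block; congr row_mx.
      rewrite mul_mx_scalar scalerA mulrN mulfV ?gt_eqF ?a0// scaleN1r addNr//.
    by rewrite /G' mulmxBr addrC -scalemxAl scaleNr -scalemxAr mulmxA.
  rewrite tr_row_mx mul_row_col mul0mx add0r; apply.
  apply: contra_neq v0 => /(congr1 (fun m => rsubmx m)); by rewrite row_mxKr linear0.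
have ca k : Ck k U a by exact: cG.
have cb k : Ck_mx k U b.
  by move=> i j; apply: Ck_ext oU _ (cG k (lshift n i) (rshift 1 j)) => z _; rewrite !mxE.
have cG' k : Ck_mx k U G'.
  move=> i j.
  apply: (@Ck_ext _ _ _ (fun z => G z (rshift 1 i) (rshift 1 j) - (a z)^-1 * (b z 0 i * b z 0 j))) => //.
    by move=> z _; rewrite !mxE big_ord1 !mxE.
  apply: Ck_sub2 => //; first exact: cG.
  apply: Ck_mul => //; first by apply: Ck_inv => // z /a0 /lt0r_neq0.
  by apply: Ck_mul => //; exact: cb.
have [t [ct tE t0]] := IH G' pG' cG'.
exists (fun z => block_mx (Num.sqrt (a z))%:M ((Num.sqrt (a z))^-1 *: b z) 0 (t z)).
have sa k : Ck k U (fun z => Num.sqrt (a z)) by apply: Ck_sqrt.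
have sa0 z : U z -> Num.sqrt (a z) != 0 by move=> Uz; rewrite gt_eqF// sqrtr_gt0 a0.
have ssa z : U z -> Num.sqrt (a z) * Num.sqrt (a z) = a z.
  by move=> Uz; rewrite -expr2 sqr_sqrtr// ltW// a0.
split.
- move=> k; have block A B C E : Ck_mx k U A -> Ck_mx k U B -> Ck_mx k U C -> Ck_mx k U E ->
    Ck_mx k U (fun z => block_mx (A z) (B z) (C z) (E z) : 'M[R]_(1 + n)).
    move=> cA cB cC cE i j; rewrite -(fintype.splitK i) -(fintype.splitK j).
    case: (fintype.split i) (fintype.split j) => [i'|i'] [j'|j'] /=.
    + by apply: Ck_ext oU _ (cA i' j') => z _; rewrite block_mxEul.
    + by apply: Ck_ext oU _ (cB i' j') => z _; rewrite block_mxEur.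
    + by apply: Ck_ext oU _ (cC i' j') => z _; rewrite block_mxEdl.
    + by apply: Ck_ext oU _ (cE i' j') => z _; rewrite block_mxEdr.
  apply: block => //.
  + by move=> i j; apply: Ck_ext oU _ (sa k) => z _; rewrite !ord1 mxE eqxx mulr1n.
  + move=> i j; apply: (@Ck_ext _ _ _ (fun z => (Num.sqrt (a z))^-1 * b z i j)) => //.
      by move=> z _; rewrite [RHS]mxE.
    apply: Ck_mul => //; last exact: cb.
    by apply: Ck_inv.
  + by move=> i j; apply: Ck_ext oU _ (Ck_cst k U 0) => z _; rewrite mxE.
- move=> z Uz; rewrite tr_block_mx mulmx_block GE//; congr block_mx.
  + by rewrite tr_scalar_mx trmx0 mul0mx addr0 -scalar_mxM ssa.
  + by rewrite tr_scalar_mx trmx0 mul0mx addr0 mul_scalar_mx scalerA mulfV ?scale1r// sa0.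
  + by rewrite mulmx0 addr0 linearZ /= mul_mx_scalar scalerA mulfV ?scale1r// sa0.
  + rewrite tE// /G' [(_ *: _)^T]linearZ /= -scalemxAl -scalemxAr scalerA -invfM ssa//.
    by rewrite addrC subrK.
- by move=> z Uz; rewrite det_ublock det_scalar1 mulr_gt0 ?t0// sqrtr_gt0 a0.
Qed.
End Matrices.

(** * Polar decomposition and square roots of matrices *)

Section Polar.
Context (R : realType).

Lemma addmxE m n (A B : 'M[R]_(m, n)) i j : (A + B) i j = A i j + B i j.
Proof. by rewrite mxE. Qed.

Lemma scalemxE m n a (A : 'M[R]_(m, n)) i j : (a *: A) i j = a * A i j.
Proof. by rewrite mxE. Qed.

Lemma mxtrace_mul_tr m n (A B : 'M[R]_(m, n)) : \tr (A^T *m B) = \sum_j \sum_i A i j * B i j.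
Proof. by apply: eq_bigr => j _; rewrite mxE; apply: eq_bigr => i _; rewrite mxE. Qed.

Lemma mxtrace_rows m n (D : 'M[R]_(m, n)) (B : 'M[R]_n) :
  \tr (D *m B *m D^T) = \sum_i (row i D *m B *m (row i D)^T) 0 0.
Proof.
apply: eq_bigr => i _; rewrite -row_mul !mxE; apply: eq_bigr => j _.
by rewrite !mxE.
Qed.

Lemma posdef_ge0 n (S : 'M[R]_n) (v : 'rV[R]_n) : posdef S -> 0 <= (v *m S *m v^T) 0 0.
Proof.
move=> [_ pS]; have [->|v0] := eqVneq v 0; last exact: ltW (pS v v0).
by rewrite !mul0mx mxE.
Qed.

Lemma sym_bil n (S : 'M[R]_n) (v w : 'rV[R]_n) : S^T = S ->
  (v *m S *m w^T) 0 0 = (w *m S *m v^T) 0 0.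
Proof.
move=> sS; rewrite -[in LHS](trmxK (v *m S *m w^T)) mxE.
by rewrite !trmx_mul trmxK sS mulmxA.
Qed.

Lemma posdef_tr_ge0 m n (D : 'M[R]_(m, n)) (B : 'M[R]_n) : posdef B -> 0 <= \tr (D *m B *m D^T).
Proof. by move=> pB; rewrite mxtrace_rows; apply: sumr_ge0 => i _; exact: posdef_ge0. Qed.

(** The pairing of D with A D + D B dominates that of D with D B. *)
Lemma sylvester_pairing n (A B D : 'M[R]_n) : posdef A -> posdef B ->
  0 <= \tr (D *m B *m D^T) <= \tr (D^T *m (A *m D + D *m B)).
Proof.
move=> pA pB; rewrite posdef_tr_ge0//= mulmxDr mxtraceD.
rewrite [\tr (D^T *m (D *m B))]mxtrace_mulC lerDr.
by rewrite mulmxA; have := posdef_tr_ge0 (D^T) pA; rewrite trmxK.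
Qed.

Lemma sylvester_inj n (A B D : 'M[R]_n) : posdef A -> posdef B ->
  A *m D + D *m B = 0 -> D = 0.
Proof.
move=> pA pB E; have := sylvester_pairing D pA pB; rewrite E mulmx0 mxtrace0.
move=> /andP[h1 h2]; have /eqP : \tr (D *m B *m D^T) = 0 by apply/eqP; rewrite eq_le h1 h2.
rewrite mxtrace_rows psumr_eq0; last by move=> i _; exact: posdef_ge0.
move=> /allP h; apply/row_matrixP => i; rewrite row0; apply: contrapT => /eqP ri.
have [_ /(_ _ ri)] := pB; rewrite (eqP (h i (mem_index_enum i))) ltxx //.
Qed.

(** The difference D of two square roots satisfies A D + D B = 0. *)
Lemma posdef_sqrt_inj n (A B : 'M[R]_n) : posdef A -> posdef B -> A *m A = B *m B -> A = B.
Proof.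
move=> pA pB E; apply/eqP; rewrite -subr_eq0; apply/eqP.
apply: (sylvester_inj pA pB); rewrite mulmxBr mulmxBl E.
by rewrite addrA subrK subrr.
Qed.

Lemma psd_unit_posdef n (H : 'M[R]_n) : H^T = H -> H \in unitmx ->
  (forall v : 'rV[R]_n, 0 <= (v *m H *m v^T) 0 0) -> posdef H.
Proof.
move=> sH uH pH; split=> // v v0; rewrite lt_neqAle pH andbT eq_sym.
apply: contra v0 => /eqP q0.
pose w := v *m H; pose N := (w *m w^T) 0 0; pose c := (w *m H *m w^T) 0 0.
have NE : N = \sum_j w 0 j ^+ 2 by rewrite /N mxE; apply: eq_bigr => j _; rewrite [w^T _ _]mxE expr2.
have N0 : 0 <= N by rewrite NE; apply: sumr_ge0 => j _; exact: sqr_ge0.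
have c0 : 0 <= c by exact: pH.
have c10 : 0 < c + 1 by rewrite ltr_wpDl.
have q t : 0 <= t * (2 * N + t * c).
  have -> : t * (2 * N + t * c) = ((v + t *: w) *m H *m (v + t *: w)^T) 0 0; last exact: pH.
  have wv : (w *m H *m v^T) 0 0 = N by rewrite sym_bil.
  rewrite mulmxDl -scalemxAl linearD linearZ /= mulmxDl !mulmxDr -!scalemxAl -!scalemxAr.
  rewrite !(addmxE, scalemxE) q0 wv -/w -/N -/c; ring.
have /eqP : N = 0.
  apply/eqP; rewrite eq_le N0 andbT leNgt; apply/negP => Np.
  have := q (- (N / (c + 1))).
  have -> : - (N / (c + 1)) * (2 * N + - (N / (c + 1)) * c) = - ((N / (c + 1)) ^+ 2 * (c + 2)).
    by field; rewrite gt_eqF.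
  rewrite oppr_ge0.
  rewrite leNgt mulr_gt0 ?ltr_wpDl// exprn_gt0// divr_gt0//.
rewrite NE psumr_eq0; last by move=> j _; exact: sqr_ge0.
move=> /allP w0; have {}w0 : w = 0.
  by apply/rowP => j; rewrite [RHS]mxE; apply/eqP; have := w0 j (mem_index_enum j); rewrite /= sqrf_eq0.
by rewrite -[v](mulmxK uH) -/w w0 mul0mx.
Qed.

Definition orthogonal n (Q : 'M[R]_n) := Q *m Q^T = 1%:M.

Lemma orthogonal_bound n (Q : 'M[R]_n) i j : orthogonal Q -> -1 <= Q i j <= 1.
Proof.
move=> oQ; rewrite -ler_norml -(ler_sqr (normr_nneg _)) ?nnegrE//.
rewrite expr1n -normrX ger0_norm ?sqr_ge0//.
have E : \sum_l Q i l * Q i l = 1.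
  have /matrixP/(_ i i) := oQ; rewrite !mxE eqxx => h; apply: etrans h.
  by apply: eq_bigr => l _; rewrite mxE.
rewrite -E (bigD1 j)//= expr2 lerDl; apply: sumr_ge0 => l _.
by rewrite -expr2 sqr_ge0.
Qed.

Lemma continuous_sumr (V : topologicalType) (I : Type) (r : seq I) (F : I -> V -> R) :
  (forall i, continuous (F i)) -> continuous (fun u => \sum_(i <- r) F i u).
Proof.
move=> h u; apply: cvg_big => [|i _]; first exact: add_continuous.
exact: h.
Qed.

(** The orthogonal group is compact. *)
Lemma orthogonal_max n (F : 'M[R]_n) : exists2 Q : 'M[R]_n, orthogonal Q &
  forall Q', orthogonal Q' -> \tr (F *m Q') <= \tr (F *m Q).
Proof.
pose A := [set u : 'rV[R]_(n * n) | orthogonal (vec_mx u)].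
pose box := [set u : 'rV[R]_(n * n) | forall i, `[-1, 1]%classic (u ord0 i)].
have cbox : compact box by apply: (@rV_compact R _ (fun=> `[(-1 : R), 1]%classic)) => i; exact: segment_compact.
have cA : compact A.
  apply: (subclosed_compact _ cbox); last first.
    move=> u oA i /=; rewrite in_itv /= -[u]vec_mxK; case/mxvec_indexP: i => i j.
    by rewrite mxvecE; exact: orthogonal_bound.
  have -> : A = \bigcap_(ij in [set: 'I_n * 'I_n])
     ((fun u => (vec_mx u *m (vec_mx u)^T) ij.1 ij.2) @^-1` [set (ij.1 == ij.2)%:R]).
    apply/seteqP; split=> [u oA ij _ /=|u h]; first by rewrite oA mxE.
    by apply/matrixP => i j; rewrite [RHS]mxE; exact: (h (i, j)).
  apply: closed_bigI => ij _; apply: preimage_closed; last exact: closed_eq.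
  have -> : (fun u : 'rV[R]_(n * n) => (vec_mx u *m (vec_mx u)^T) ij.1 ij.2)
    = (fun u => \sum_l u 0 (mxvec_index ij.1 l) * u 0 (mxvec_index ij.2 l)).
    by apply/funext => v; rewrite mxE; apply: eq_bigr => l _; rewrite !mxE.
  move=> u _; apply: continuous_sumr => l v.
  by apply: continuousM; exact: coord_continuous.
have [||u] := @EVT_max_rV R _ (fun u => \tr (F *m vec_mx u)) A _ cA.
- by exists (mxvec 1%:M); rewrite /A /= mxvecK /orthogonal trmx1 mulmx1.
- apply: continuous_subspaceT.
  have -> : (fun u : 'rV[R]_(n * n) => \tr (F *m vec_mx u))
    = (fun u => \sum_i \sum_l F i l * u 0 (mxvec_index l i)).
    by apply/funext => v; apply: eq_bigr => i _; rewrite mxE; apply: eq_bigr => l _; rewrite mxE.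
  apply: continuous_sumr => i; apply: continuous_sumr => l v.
  by apply: continuousM; [exact: cst_continuous | exact: coord_continuous].
rewrite inE => oA h; exists (vec_mx u) => // Q' oQ'; rewrite -[Q']mxvecK; apply: h.
by rewrite inE /A /= mxvecK.
Qed.

Lemma plane_rotation n (e k : 'M[R]_n) (c s : R) : e *m e = e -> e *m k = k ->
  k *m e = k -> k *m k = - e -> e^T = e -> k^T = - k -> c ^+ 2 + s ^+ 2 = 1 ->
  orthogonal (1%:M + ((c - 1) *: e + s *: k)).
Proof.
move=> ee ek ke kk te tk cs; rewrite /orthogonal.
have -> : (1%:M + ((c - 1) *: e + s *: k))^T = 1%:M + ((c - 1) *: e - s *: k).
  by rewrite !linearD /= !linearZ /= trmx1 te tk scalerN.
rewrite mulmxDl mul1mx mulmxDr mulmx1 mulmxDl !mulmxDr !mulmxN -!scalemxAl -!scalemxAr ee ek ke kk.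
rewrite -[RHS]addr0 -!addrA; congr (_ + _).
apply/matrixP => a b; rewrite !mxE; move: (e a b) (k a b) => x y.
have E : (c ^+ 2 + s ^+ 2 - 1) * x = 0 by rewrite cs subrr mul0r.
by rewrite -[RHS]E; ring.
Qed.

(** At a maximiser Q of tr (F Q) over the orthogonal group, comparing with
    reflections gives that F Q is positive, and with plane rotations that it is
    symmetric. *)
Lemma polar_decomposition n (F : 'M[R]_n) : F \in unitmx ->
  exists2 Q : 'M[R]_n, orthogonal Q & posdef (F *m Q).
Proof.
move=> uF; have [Q oQ mQ] := orthogonal_max F; exists Q => //.
set H := F *m Q.
have mH r : orthogonal r -> \tr (H *m r) <= \tr H.
  move=> or; rewrite -mulmxA; apply: mQ.
  by rewrite /orthogonal trmx_mul mulmxA -[Q *m r *m _]mulmxA or mulmx1.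
apply: psd_unit_posdef.
- apply/matrixP => i j; rewrite mxE; have [->//|ij] := eqVneq i j.
  pose e : 'M[R]_n := delta_mx i i + delta_mx j j.
  pose k : 'M[R]_n := delta_mx i j - delta_mx j i.
  have ji := ij; rewrite eq_sym in ji.
  have ee : e *m e = e by rewrite /e mulmxDl !mulmxDr !mul_delta_mx_cond !eqxx (negbTE ij) (negbTE ji) !mulr0n !mulr1n addr0 add0r.
  have ek : e *m k = k by rewrite /e /k mulmxDl !mulmxBr !mul_delta_mx_cond !eqxx (negbTE ij) (negbTE ji) !mulr0n !mulr1n subr0 sub0r.
  have ke : k *m e = k by rewrite /e /k mulmxBl !mulmxDr !mul_delta_mx_cond !eqxx (negbTE ij) (negbTE ji) !mulr0n !mulr1n addr0 add0r.
  have kk : k *m k = - e by rewrite /e /k mulmxBl !mulmxBr !mul_delta_mx_cond !eqxx (negbTE ij) (negbTE ji) !mulr0n !mulr1n subr0 sub0r opprD.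
  have te : e^T = e by rewrite /e linearD /= !trmx_delta.
  have tk : k^T = - k by rewrite /k linearB /= !trmx_delta opprB.
  pose p := H i i + H j j; pose q := H j i - H i j.
  have tH a b : \tr (H *m delta_mx a b) = H b a.
    rewrite -(mul_delta_mx (0 : 'I_1)) mulmxA mxtrace_mulC mulmxA -rowE -colE.
    by rewrite [X in \tr X]mx11_scalar mxtrace_scalar mulr1n !mxE.
  (* Maximality against the rotations of the plane of i and j. *)
  have rot c s : c ^+ 2 + s ^+ 2 = 1 -> (c - 1) * p + s * q <= 0.
    move=> cs; pose r := 1%:M + ((c - 1) *: e + s *: k).
    have or : orthogonal r by exact: plane_rotation.
    have := mH r or; rewrite /r mulmxDr mulmx1 mxtraceD gerDl mulmxDr -!scalemxAr mxtraceD !mxtraceZ.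
    by rewrite /e /k mulmxDr mulmxBr mxtraceD raddfB /= !tH.
  (* The rational parametrisation of the circle. With
     t = tau q and tau small it is incompatible with q <> 0. *)
  have half t : t * q <= t ^+ 2 * p.
    have t0 : 0 < 1 + t ^+ 2 by rewrite ltr_wpDr// sqr_ge0.
    have := rot ((1 - t ^+ 2) / (1 + t ^+ 2)) (2 * t / (1 + t ^+ 2)).
    have -> : ((1 - t ^+ 2) / (1 + t ^+ 2)) ^+ 2 + (2 * t / (1 + t ^+ 2)) ^+ 2 = 1.
      by field; rewrite gt_eqF.
    move=> /(_ erefl).
    have -> : ((1 - t ^+ 2) / (1 + t ^+ 2) - 1) * p + 2 * t / (1 + t ^+ 2) * q = 2 / (1 + t ^+ 2) * (t * q - t ^+ 2 * p).
      by field; rewrite gt_eqF.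
    by rewrite pmulr_rle0 ?subr_le0// divr_gt0.
  suff : q = 0 by move/eqP; rewrite subr_eq0 => /eqP.
  apply/eqP/negPn/negP => q0; pose tau := (`|p| + 1)^-1 / 2.
  have p1 : 0 < `|p| + 1 by rewrite ltr_wpDl.
  have tau0 : 0 < tau by rewrite divr_gt0 ?invr_gt0.
  have q2 : 0 < q ^+ 2 by rewrite lt_neqAle sqr_ge0 andbT eq_sym sqrf_eq0.
  have := half (tau * q); rewrite exprMn.
  have -> : tau * q * q = tau * q ^+ 2 * 1 by ring.
  have -> : tau ^+ 2 * q ^+ 2 * p = tau * q ^+ 2 * (tau * p) by ring.
  have tq0 : 0 < tau * q ^+ 2 by exact: mulr_gt0.
  rewrite ler_pM2l// => h; have : ~~ (tau * p < 1) by rewrite -leNgt.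
  move/negP; apply.
  apply: (@le_lt_trans _ _ (tau * (`|p| + 1))).
    by rewrite ler_pM2l// (le_trans (ler_norm _))// lerDl.
  by rewrite /tau mulrAC mulVf ?gt_eqF// mul1r invf_lt1// ltr1n.
- by rewrite unitmx_mul uF /=; have [] := mulmx1_unit oQ.
- move=> v; have [->|v0] := eqVneq v 0; first by rewrite !mul0mx mxE.
  pose N := (v *m v^T) 0 0.
  have NE : v *m v^T = N%:M by exact: mx11_scalar.
  have N0 : 0 < N.
    rewrite /N mxE; have N1 : 0 <= \sum_j v 0 j * v^T j 0.
      by apply: sumr_ge0 => j _; rewrite mxE -expr2 sqr_ge0.
    rewrite lt_neqAle N1 andbT eq_sym; apply: contra v0.
    rewrite psumr_eq0; last by move=> j _; rewrite mxE -expr2 sqr_ge0.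
    move=> /allP h; apply/eqP/rowP => j; have := h j (mem_index_enum j).
    by rewrite /= !mxE -expr2 sqrf_eq0 => /eqP.
  (* Maximality against the reflection in the hyperplane orthogonal to v. *)
  pose P := v^T *m v.
  have PP : P *m P = N *: P by rewrite /P mulmxA -[v^T *m v *m v^T]mulmxA NE mul_mx_scalar scalemxAl.
  have tP : P^T = P by rewrite /P trmx_mul trmxK.
  have tI : (1%:M - (2 / N) *: P)^T = 1%:M - (2 / N) *: P.
    by rewrite linearB /= linearZ /= trmx1 tP.
  have := mH (1%:M - (2 / N) *: P); rewrite /orthogonal tI.
  rewrite mulmxBl mul1mx mulmxBr mulmx1 -scalemxAl -scalemxAr PP !scalerA.
  have -> : 2 / N * (2 / N) * N = 2 / N + 2 / N by field; rewrite gt_eqF.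
  rewrite scalerDl opprB addrK subrK => /(_ erefl).
  rewrite mulmxBr mulmx1 raddfB /= gerDl oppr_le0 -scalemxAr mxtraceZ pmulr_rge0 ?divr_gt0//.
  by rewrite /P mulmxA mxtrace_mulC mulmxA [X in \tr X]mx11_scalar mxtrace_scalar mulr1n.
Qed.

End Polar.

Section SmoothSqrt.
Context (R : realType).
Local Notation T := 'rV[R]_4.

Definition sylvester n (A B : 'M[R]_n) := lin_mulmx A + lin_mulmxr B.

Lemma mul_sylvester n (A B D : 'M[R]_n) : mxvec D *m sylvester A B = mxvec (A *m D + D *m B).
Proof. by rewrite mulmxDr !mul_vec_lin /= linearD. Qed.

Lemma sylvester_unit n (A B : 'M[R]_n) : posdef A -> posdef B -> sylvester A B \in unitmx.
Proof.
move=> pA pB; rewrite -row_free_unit -kermx_eq0; apply/eqP/row_matrixP => i; rewrite row0.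
have := row_sub i (kermx (sylvester A B)).
move: (row i _) => u /sub_kermxP; rewrite -[u]vec_mxK mul_sylvester => h.
have := congr1 vec_mx h; rewrite mxvecK linear0 => /(sylvester_inj pA pB) ->.
by rewrite linear0.
Qed.

Lemma Ck_sylvester k U n (A B : T -> 'M[R]_n) : open U -> Ck_mx k U A -> Ck_mx k U B ->
  Ck_mx k U (fun z => sylvester (A z) (B z)).
Proof.
move=> oU cA cB p q; case/mxvec_indexP: q => i j.
pose E : 'M[R]_n := vec_mx (delta_mx 0 p).
have cE : Ck_mx k U (fun=> E) by move=> ? ?; exact: Ck_cst.
apply: (@Ck_ext _ _ _ (fun z => (A z *m E) i j + (E *m B z) i j)) => //.
  move=> z _; have -> : sylvester (A z) (B z) p (mxvec_index i j) = (delta_mx (0 : 'I_1) p *m sylvester (A z) (B z)) 0 (mxvec_index i j).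
    by rewrite -rowE [RHS]mxE.
  by rewrite -[delta_mx (0 : 'I_1) p]vec_mxK mul_sylvester mxvecE [RHS]mxE.
by apply: Ck_add => //; apply: Ck_mulmx.
Qed.

Lemma derive_sumr (I : Type) (r : seq I) (F : I -> T -> R) z v :
  (forall i, differentiable (F i) z) ->
  differentiable (fun y => \sum_(i <- r) F i y) z /\
  'D_v (fun y => \sum_(i <- r) F i y) z = \sum_(i <- r) 'D_v (F i) z.
Proof.
move=> dF; elim: r => [|i r [IH1 IH2]].
  have -> : (fun y => \sum_(i <- [::]) F i y) = cst 0 by apply/funext => y; rewrite big_nil.
  by rewrite big_nil; split; [exact: differentiable_cst | exact: derive_cst].
have -> : (fun y => \sum_(j <- i :: r) F j y) = F i + (fun y => \sum_(j <- r) F j y).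
  by apply/funext => y; rewrite big_cons.
split; first exact: differentiableD.
by rewrite big_cons deriveD ?IH2//; exact: diff_derivable.
Qed.

Lemma deriveMr2 (f g : T -> R) z v : differentiable f z -> differentiable g z ->
  'D_v (fun y => f y * g y) z = 'D_v f z * g z + f z * 'D_v g z.
Proof.
move=> df dg; rewrite -[X in 'D_v X z]/(f * g) deriveM; try exact: diff_derivable.
by rewrite /GRing.scale /= addrC [g z * _]mulrC.
Qed.

Lemma derive_mulmx m n p (A : T -> 'M[R]_(m, n)) (B : T -> 'M[R]_(n, p)) z v i j :
  (forall i j, differentiable (fun y => A y i j) z) ->
  (forall i j, differentiable (fun y => B y i j) z) ->
  'D_v (fun y => (A y *m B y) i j) z =
  (\matrix_(i, j) 'D_v (fun y => A y i j) z *m B z + A z *m \matrix_(i, j) 'D_v (fun y => B y i j) z) i j.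
Proof.
move=> dA dB.
have -> : (fun y => (A y *m B y) i j) = fun y => \sum_l A y i l * B y l j.
  by apply/funext => y; rewrite mxE.
have [|_ ->] := @derive_sumr _ (index_enum 'I_n) (fun l y => A y i l * B y l j) z v.
  by move=> l; apply: differentiableM.
rewrite !mxE -big_split /=; apply: eq_bigr => l _.
by rewrite deriveMr2// !mxE.
Qed.

Lemma continuous_at_dist (V : topologicalType) (f : V -> R) z :
  (forall e, 0 < e -> \forall y \near z, `|f z - f y| <= e) -> {for z, continuous f}.
Proof. by move=> h; apply/cvgrPdist_le. Qed.

Lemma caratheodory1 (K c : T -> R) z : {for z, continuous K} -> differentiable c z ->
  differentiable (fun y => K y * (c y - c z)) z.
Proof.
move=> cK dc.
have -> : (fun y => K y * (c y - c z)) = (fun y => K z * (c y - c z)) + (fun y => (K y - K z) * (c y - c z)).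
  by apply/funext => y; rewrite /= -[RHS]/(K z * (c y - c z) + (K y - K z) * (c y - c z)) -mulrDl subrKC.
apply: differentiableD.
  by apply: differentiableM; [exact: differentiable_cst | apply: differentiableB => //; exact: differentiable_cst].
have [k k0 lk] := linear_lipschitz (diff_continuous dc).
apply: (@diff_criterion _ _ _ (GRing.null_fun _) z _ _).1; first exact: cst_continuous.
move=> e e0; have k1 : 0 < k + 1 by rewrite ltr_wpDr.
have e1 : 0 < e / (k + 1) by rewrite divr_gt0.
have nK : \forall h \near (0 : T), `|K (h + z) - K z| <= e / (k + 1).
  move/cvgrPdist_le : cK => /(_ _ e1) h0; have : \forall t \near z, `|K z - K t| <= e / (k + 1) by exact: h0.
  rewrite (near_shift 0 z) subr0 => h1.
  by apply: filterS h1 => h; rewrite /= distrC.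
apply: filterS2 nK (diff_estimate dc ltr01) => h hK hc.
rewrite /GRing.null_fun subr0 !subrr mulr0 subr0 normrM.
have hc' : `|c (h + z) - c z| <= (k + 1) * `|h|.
  rewrite -[c (h + z) - c z](subrK ('d c z h)) (le_trans (ler_normD _ _))//.
  by rewrite mulrDl addrC lerD// lk.
apply: le_trans (ler_pM _ _ hK hc') _ => //.
by rewrite mulrA divfK// gt_eqF.
Qed.

(** Differentiability from a factorisation of the increment with continuous
    coefficients, as in Caratheodory's definition of the derivative. *)
Lemma caratheodory n (K c : 'I_n -> T -> R) (f : T -> R) z :
  (forall l, {for z, continuous (K l)}) -> (forall l, differentiable (c l) z) ->
  (\forall y \near z, f y = f z + \sum_l K l y * (c l y - c l z)) ->
  differentiable f z.
Proof.
move=> cK dc E; apply: (@near_eq_differentiable _ _ (fun y => f z + \sum_l K l y * (c l y - c l z))).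
  by apply: filterS E => y ->.
apply: differentiableD; first exact: differentiable_cst.
by have [] := @derive_sumr _ (index_enum 'I_n) _ z 0 (fun l => caratheodory1 (cK l) (dc l)).
Qed.

Section SqrtOnOpen.
Context (n : nat) (U : set T) (h C : T -> 'M[R]_n).
Hypotheses (oU : open U) (ph : forall z, U z -> posdef (h z))
  (hC : forall z, U z -> h z *m h z = C z) (cC : forall k, Ck_mx k U C).

Let sylv_diff z y : U z -> U y ->
  h y *m (h y - h z) + (h y - h z) *m h z = C y - C z.
Proof. by move=> Uz Uy; rewrite mulmxBr mulmxBl addrA subrK !hC. Qed.

(* Cauchy-Schwarz for the inner product B, against the vectors dual to the
   coordinates. *)
Let entry_bound (B : 'M[R]_n) : posdef B ->
  exists2 b : R, 0 <= b & forall (D : 'M[R]_n) i j, D i j ^+ 2 <= b * \tr (D *m B *m D^T).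
Proof.
move=> pB; have uB := posdef_unit pB; have [sB _] := pB.
pose w j : 'rV[R]_n := delta_mx 0 j *m invmx B.
pose b j := (w j *m B *m (w j)^T) 0 0.
have b0 j : 0 <= b j by exact: posdef_ge0.
exists (\sum_j b j) => [|D i j]; first exact: sumr_ge0.
have vw (v : 'rV[R]_n) : v 0 j ^+ 2 <= b j * (v *m B *m v^T) 0 0.
  have vj : (v *m B *m (w j)^T) 0 0 = v 0 j.
    rewrite /w trmx_mul trmx_inv sB mulmxA mulmxK// trmx_delta.
    by rewrite -colE mxE.
  pose q := (v *m B *m v^T) 0 0.
  have key t : 0 <= q + 2 * t * v 0 j + t ^+ 2 * b j.
    have := posdef_ge0 (v + t *: w j) pB.
    rewrite mulmxDl -scalemxAl linearD linearZ /= mulmxDl !mulmxDr -!scalemxAl -!scalemxAr.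
    rewrite !(addmxE, scalemxE) -/q -/(b j) (sym_bil (w j) v)// vj => k.
    by apply: le_trans k _; rewrite le_eqVlt; apply/orP; left; apply/eqP; ring.
  have [bj|bj] := eqVneq (b j) 0.
    have [->|vj0] := eqVneq (v 0 j) 0; first by rewrite expr0n mulr_ge0// posdef_ge0.
    have := key (- (q + 1) / (2 * v 0 j)); rewrite bj mulr0 addr0.
    have -> : q + 2 * (- (q + 1) / (2 * v 0 j)) * v 0 j = -1 by field.
    by rewrite oppr_ge0 ler10.
  have bj0 : 0 < b j by rewrite lt_neqAle eq_sym bj b0.
  have := key (- v 0 j / b j).
  have -> : q + 2 * (- v 0 j / b j) * v 0 j + (- v 0 j / b j) ^+ 2 * b j = (b j * q - v 0 j ^+ 2) / b j by field.
  by rewrite pmulr_lge0 ?invr_gt0// subr_ge0.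
have := vw (row i D); rewrite mxE => k; apply: le_trans k _.
apply: ler_pM => //; first exact: posdef_ge0.
  by rewrite (bigD1 j)//= lerDl sumr_ge0.
by rewrite mxtrace_rows (bigD1 i)//= lerDl sumr_ge0// => l _; exact: posdef_ge0.
Qed.

Let sqrt_cts : Ck_mx 0 U h.
Proof.
move=> i j z Uz; have [b b0 hb] := entry_bound (ph Uz).
pose m : R := (n * n)%N%:R.
pose G y := (m * b) ^+ 2 * \sum_j \sum_i (C y i j - C z i j) ^+ 2.
have bound y : U y -> (h y i j - h z i j) ^+ 2 <= G y.
  move=> Uy; pose D := h y - h z; pose S := C y - C z.
  have /andP[t0 t1] := sylvester_pairing D (ph Uy) (ph Uz).
  move: t1; rewrite sylv_diff// -/S mxtrace_mul_tr => t1.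
  pose N := \sum_j \sum_i D i j ^+ 2.
  have Dij : (h y i j - h z i j) ^+ 2 <= N.
    have -> : h y i j - h z i j = D i j by rewrite /D !mxE.
    rewrite /N (bigD1 j)//= (bigD1 i)//= -addrA lerDl addr_ge0//.
      by apply: sumr_ge0 => l _; exact: sqr_ge0.
    by apply: sumr_ge0 => l _; apply: sumr_ge0 => p _; exact: sqr_ge0.
  apply: le_trans Dij _.
  have N1 : N <= m * b * \sum_j \sum_i D i j * S i j.
    apply: (@le_trans _ _ (\sum_(j < n) \sum_(i < n) b * \sum_j \sum_i D i j * S i j)).
      apply: ler_sum => j' _; apply: ler_sum => i' _; apply: le_trans (hb _ _ _) _.
      exact: ler_wpM2l.
    by rewrite !sumr_const !card_ord -mulrnA -mulr_natl mulrA.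
  have N2 : m * b * (\sum_j \sum_i D i j * S i j) <= 2^-1 * N + 2^-1 * G y.
    rewrite /G /N !mulr_sumr -big_split /=; apply: ler_sum => j' _.
    rewrite !mulr_sumr -big_split /=; apply: ler_sum => i' _.
    have -> : C y i' j' - C z i' j' = S i' j' by rewrite /S !mxE.
    rewrite -subr_ge0.
    have -> : 2^-1 * D i' j' ^+ 2 + 2^-1 * ((m * b) ^+ 2 * S i' j' ^+ 2) - m * b * (D i' j' * S i' j') = 2^-1 * (D i' j' - m * b * S i' j') ^+ 2.
      by field.
    by rewrite mulr_ge0 ?invr_ge0// sqr_ge0.
  by have := le_trans N1 N2; move: (N) (G y) => x y'; lra.
have cG : Ck 0 U G.
  apply: Ck_scale => //; apply: Ck_sum => // j' _; apply: Ck_sum => // i' _.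
  have cS : Ck 0 U (fun y => C y i' j' - C z i' j').
    by apply: Ck_sub2 => //; [exact: cC | exact: Ck_cst].
  apply: Ck_ext oU _ (Ck_mul oU cS cS) => y _; by rewrite expr2.
have Gz : G z = 0.
  by rewrite /G big1 ?mulr0// => j' _; rewrite big1// => i' _; rewrite subrr expr0n.
apply: continuous_at_dist => e e0.
have e2 : 0 < e ^+ 2 by rewrite exprn_gt0.
have /cvgrPdist_le/(_ _ e2) nG := cG z Uz.
have nU : \forall y \near z, U y by exact: open_nbhs_nbhs.
apply: filterS2 nU nG => y Uy; rewrite Gz sub0r normrN => Gy.
rewrite distrC -(ler_pXn2r (_ : 0 < 2)%N) ?nnegrE ?(ltW e0)//.
rewrite -normrX ger0_norm ?sqr_ge0//.
by apply: le_trans (bound y Uy) _; apply: le_trans (ler_norm _) Gy.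
Qed.

Let sqrt_diff z i j : U z -> differentiable (fun y => h y i j) z.
Proof.
move=> Uz; pose K y := invmx (sylvester (h y) (h z)).
have cK : Ck_mx 0 U K.
  apply: Ck_invmx => //; first by move=> y Uy; apply: sylvester_unit; exact: ph.
  by apply: Ck_sylvester => // a b; exact: Ck_cst.
pose c l y := mxvec (C y) 0 l.
have cc l k : Ck k U (c l).
  by case/mxvec_indexP: l => a b; apply: Ck_ext oU _ (cC k a b) => y _; rewrite /c mxvecE.
apply: (@caratheodory _ (fun l y => K y l (mxvec_index i j)) c).
- by move=> l; exact: (cK l _ z Uz).
- by move=> l; apply: Ck_diff (cc l 1%N) Uz.
have nU : \forall y \near z, U y by exact: open_nbhs_nbhs.
apply: filterS nU => y Uy.
have E : mxvec (h y - h z) = mxvec (C y - C z) *m K y.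
  rewrite -sylv_diff// -mul_sylvester mulmxK//.
  by apply: sylvester_unit; exact: ph.
have := congr1 (fun v : 'rV_(n * n) => v 0 (mxvec_index i j)) E.
rewrite mxvecE !mxE => E'; rewrite -[LHS](subrK (h z i j)) addrC E'; congr (_ + _).
by apply: eq_bigr => l _; rewrite mulrC linearB /c /= !mxE.
Qed.

(** The square root of a smooth family of positive definite matrices is
    smooth: differences of square roots solve a Sylvester equation whose
    operator is invertible, which gives first differentiability and then a
    formula for the derivative with one degree of smoothness to spare. *)
Lemma smooth_sqrtm k : Ck_mx k U h.
Proof.
elim: k => [|k IH]; first exact: sqrt_cts.
move=> i j; split=> [z Uz|v]; first exact: sqrt_diff.
pose DC z : 'M[R]_n := \matrix_(i, j) 'D_v (fun y => C y i j) z.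
pose Dh z : 'M[R]_n := \matrix_(i, j) 'D_v (fun y => h y i j) z.
have cDC : Ck_mx k U (fun z => mxvec (DC z)).
  move=> a l; case/mxvec_indexP: l => p q.
  by apply: Ck_ext oU _ (Ck_derive v (cC k.+1 p q)) => z _; rewrite ord1 mxvecE mxE.
have cS : Ck_mx k U (fun z => invmx (sylvester (h z) (h z))).
  apply: Ck_invmx => //; last exact: Ck_sylvester.
  by move=> y Uy; apply: sylvester_unit; exact: ph.
apply: Ck_ext oU _ (Ck_mulmx oU cDC cS 0 (mxvec_index i j)) => z Uz.
have -> : DC z = h z *m Dh z + Dh z *m h z.
  apply/matrixP => p q; rewrite mxE addrC -derive_mulmx; try by move=> *; exact: sqrt_diff.
  by apply: near_eq_derive; apply: near_open oU Uz _ => y Uy; rewrite hC.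
by rewrite -mul_sylvester mulmxK ?mxvecE ?mxE//; apply: sylvester_unit; exact: ph.
Qed.

End SqrtOnOpen.
End SmoothSqrt.

(** * Smooth functions and coordinate derivatives on the manifold *)

Section ManifoldCalculus.
Context (R : realType) (M : topologicalType) (X : oriented_riemannian4 R M).
Local Notation T := 'rV[R]_4.
Local Notation ch := (chart_at X).
Local Notation dom p := (cdom (ch p)).
Local Notation sf := (smooth_fun X).
Local Notation sfn := (smooth_fun_near X).
Implicit Types (U V : set M) (f h : M -> R) (p q x y : M) (u v : T).

Lemma dom_self p : dom p p.
Proof. by have [] := chart_atP X p. Qed.
Hint Resolve dom_self : core.

Lemma dom_open p : open (dom p).
Proof. by have [[]] := chart_atP X p. Qed.
Hint Resolve dom_open : core.

Lemma cmapK p y : dom p y -> cinv (ch p) (cmap (ch p) y) = y.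
Proof. by have [[_ _ + _ _] _] := chart_atP X p; apply. Qed.

Lemma im_in p U y : dom p y -> U y -> chart_image (ch p) U (cmap (ch p) y).
Proof. by move=> dy Uy; exists y. Qed.

Lemma im_inv p U z : chart_image (ch p) U z ->
  [/\ dom p (cinv (ch p) z), U (cinv (ch p) z) & cmap (ch p) (cinv (ch p) z) = z].
Proof. by move=> [y [dy Uy] <-]; rewrite cmapK. Qed.

Lemma im_open p U : open U -> open (chart_image (ch p) U).
Proof.
move=> oU; have [[_ oI _ _ ci] _] := chart_atP X p.
rewrite openE => z iz; have [dz Uz zE] := im_inv iz.
have iT : chart_image (ch p) setT z by rewrite -zE; exact: im_in.
have n1 : nbhs z (chart_image (ch p) setT) by exact: open_nbhs_nbhs.
have n2 : nbhs z (cinv (ch p) @^-1` U) by apply: (ci z iT); exact: open_nbhs_nbhs.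
apply: filterS (filterI n1 n2) => w [iw Uw].
by have [dw _ wE] := im_inv iw; rewrite -wE; exact: im_in.
Qed.

Arguments im_open p [U] _.

Lemma im_sub p U V : U `<=` V -> chart_image (ch p) U `<=` chart_image (ch p) V.
Proof. by move=> UV z [y [dy Uy] <-]; exists y => //; split=> //; exact: UV. Qed.

Lemma sf_sub U V f : U `<=` V -> sf V f -> sf U f.
Proof. by move=> UV sV p k; apply: Ck_sub (sV p k); exact: im_sub. Qed.

Lemma sf_ext U f h : open U -> (forall y, U y -> f y = h y) -> sf U f -> sf U h.
Proof.
move=> oU fh sU p k; have := @Ck_ext _ k _ _ (h \o cinv (ch p)) (im_open p oU) _ (sU p k).
by apply => z /im_inv[_ Uz _]; exact: fh.
Qed.

Lemma sf_local U f : (forall y, U y -> exists V, V y /\ sf (U `&` V) f) -> sf U f.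
Proof.
move=> h p k; apply: Ck_points => z iz; have [dz Uz zE] := im_inv iz.
have [V [Vy sV]] := h _ Uz; exists (chart_image (ch p) (U `&` V)); last exact: sV.
by rewrite -zE; apply: im_in.
Qed.

Lemma sf_cst U (a : R) : sf U (fun=> a).
Proof. by move=> p k; exact: Ck_cst. Qed.

Lemma sf_add U f h : open U -> sf U f -> sf U h -> sf U (fun y => f y + h y).
Proof. by move=> oU sU1 sU2 p k; apply: (Ck_add (im_open p oU) (sU1 p k) (sU2 p k)). Qed.

Lemma sf_mul U f h : open U -> sf U f -> sf U h -> sf U (fun y => f y * h y).
Proof. by move=> oU sU1 sU2 p k; apply: (Ck_mul (im_open p oU) (sU1 p k) (sU2 p k)). Qed.

Lemma sf_opp U f : open U -> sf U f -> sf U (fun y => - f y).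
Proof. by move=> oU sU1 p k; apply: (Ck_opp (im_open p oU) (sU1 p k)). Qed.

Lemma sf_subr U f h : open U -> sf U f -> sf U h -> sf U (fun y => f y - h y).
Proof. by move=> oU s1 s2; apply: sf_add => //; exact: sf_opp. Qed.

Lemma sf_scale U (a : R) f : open U -> sf U f -> sf U (fun y => a * f y).
Proof. by move=> oU; apply: sf_mul => //; exact: sf_cst. Qed.

Lemma sf_sum U (I : Type) (r : seq I) (P : pred I) (F : I -> M -> R) : open U ->
  (forall i, P i -> sf U (F i)) -> sf U (fun y => \sum_(i <- r | P i) F i y).
Proof.
move=> oU h p k; apply: (@Ck_sum _ k _ _ r P (fun i => F i \o cinv (ch p)) (im_open p oU)).
by move=> i Pi; exact: h.
Qed.

Lemma sf_inv U f : open U -> (forall y, U y -> f y != 0) -> sf U f ->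
  sf U (fun y => (f y)^-1).
Proof.
move=> oU f0 sU p k; apply: (Ck_inv (im_open p oU) _ (sU p k)).
by move=> z /im_inv[_ Uz _]; exact: f0.
Qed.

(** Smoothness can be read in any one chart. *)
Lemma sf_chart p U f : open U -> U `<=` dom p ->
  smooth (chart_image (ch p) U) (f \o cinv (ch p)) -> sf U f.
Proof.
move=> oU Up sU q k; have oq := im_open q oU.
have E z : chart_image (ch q) U z ->
    ((f \o cinv (ch p)) \o (cmap (ch p) \o cinv (ch q))) z = (f \o cinv (ch q)) z.
  by move=> /im_inv[_ Uz _] /=; rewrite cmapK//; exact: Up.
apply: (Ck_ext oq E).
apply: (Ck_comp oq (im_open p oU)) (sU k).
  move=> i; have h := @chart_smooth R M X q p i k.+1.
  apply: Ck_sub h; exact: im_sub.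
by move=> z /im_inv[dz Uz _] /=; apply: im_in => //; exact: Up.
Qed.

Definition xcoord q (k : 'I_4) : M -> R := fun y => cmap (ch q) y 0 k.

Lemma sf_coord q k : sf (dom q) (xcoord q k).
Proof. by move=> p k'; exact: (@chart_smooth R M X p q k k'). Qed.

(** The derivative along the coordinate field of the chart at p with
    components u. *)
Definition pd p u f : M -> R := fun y => 'D_u (f \o cinv (ch p)) (cmap (ch p) y).

Lemma sf_pd p u U f : open U -> sf U f -> sf (U `&` dom p) (pd p u f).
Proof.
move=> oU sU; have oUp : open (U `&` dom p) by exact: openI.
apply: (@sf_chart p) => // k.
have cf : Ck k.+1 (chart_image (ch p) (U `&` dom p)) (f \o cinv (ch p)).
  by apply: Ck_sub (sU p k.+1); apply: im_sub => y [].
apply: Ck_ext (im_open p oUp) _ (Ck_derive u cf) => z /im_inv[_ _ zE].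
by rewrite /= /pd zE.
Qed.

Lemma sfn_pd p u x f : dom p x -> sfn x f -> sfn x (pd p u f).
Proof.
move=> dx [U [oU Ux sU]]; exists (U `&` dom p).
by split; [exact: openI | split | exact: sf_pd].
Qed.

Lemma sfn_Ck p x f k : dom p x -> sfn x f -> exists O : set T,
  [/\ open O, O (cmap (ch p) x) & Ck k O (f \o cinv (ch p))].
Proof.
move=> dx [U [oU Ux sU]]; exists (chart_image (ch p) U).
by split; [exact: im_open | exact: im_in | exact: sU].
Qed.

Arguments sfn_Ck [p x f] k _ _.

Lemma sfn_diff p x f : dom p x -> sfn x f -> differentiable (f \o cinv (ch p)) (cmap (ch p) x).
Proof. by move=> dx sx; have [W [oW Wx cW]] := sfn_Ck 1%N dx sx; exact: Ck_diff cW Wx. Qed.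

Lemma sfn2 x f h : sfn x f -> sfn x h ->
  exists U, [/\ open U, U x, sf U f & sf U h].
Proof.
move=> [U [oU Ux sU]] [V [oV Vx sV]]; exists (U `&` V); split=> //.
- exact: openI.
- by apply: sf_sub sU => y [].
- by apply: sf_sub sV => y [].
Qed.

Lemma sfn_cst x (a : R) : sfn x (fun=> a).
Proof. by exists setT; split=> //; [exact: openT | exact: sf_cst]. Qed.

Lemma sfn_add x f h : sfn x f -> sfn x h -> sfn x (fun y => f y + h y).
Proof.
by move=> sf1 sf2; have [U [oU Ux s1 s2]] := sfn2 sf1 sf2; exists U; split=> //; exact: sf_add.
Qed.

Lemma sfn_mul x f h : sfn x f -> sfn x h -> sfn x (fun y => f y * h y).
Proof.
by move=> sf1 sf2; have [U [oU Ux s1 s2]] := sfn2 sf1 sf2; exists U; split=> //; exact: sf_mul.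
Qed.

Lemma sfn_opp x f : sfn x f -> sfn x (fun y => - f y).
Proof. by move=> [U [oU Ux s1]]; exists U; split=> //; exact: sf_opp. Qed.

Lemma sfn_sum x (I : Type) (r : seq I) (F : I -> M -> R) :
  (forall i, sfn x (F i)) -> sfn x (fun y => \sum_(i <- r) F i y).
Proof.
move=> h; elim: r => [|i r IH].
  by have := sfn_cst x 0; congr sfn; apply/funext => y; rewrite big_nil.
by have := sfn_add (h i) IH; congr sfn; apply/funext => y; rewrite big_cons.
Qed.

Lemma near_chart p x (P : M -> Prop) U : dom p x -> open U -> U x ->
  (forall y, U y -> P y) -> \forall z \near cmap (ch p) x, P (cinv (ch p) z).
Proof.
move=> dx oU Ux UP; have h := @near_open R _ _ (fun z => P (cinv (ch p) z)) (im_open p oU) (im_in dx Ux).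
by apply: h => z /im_inv[_ + _]; exact: UP.
Qed.

Lemma pd_ext p u x U f h : dom p x -> open U -> U x -> (forall y, U y -> f y = h y) ->
  pd p u f x = pd p u h x.
Proof.
move=> dx oU Ux fh; apply: near_eq_derive.
exact: (@near_chart p x (fun y => f y = h y) U).
Qed.

Lemma pd_cst p u a x : pd p u (fun=> a) x = 0.
Proof. exact: derive_cst. Qed.

Lemma pd_add p u f h x : dom p x -> sfn x f -> sfn x h ->
  pd p u (fun y => f y + h y) x = pd p u f x + pd p u h x.
Proof.
move=> dx sf1 sf2; rewrite /pd -deriveD//; apply: diff_derivable; exact: sfn_diff.
Qed.

Lemma pd_mul p u f h x : dom p x -> sfn x f -> sfn x h ->
  pd p u (fun y => f y * h y) x = pd p u f x * h x + f x * pd p u h x.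
Proof.
move=> dx sf1 sf2.
rewrite /pd [LHS](@deriveMr2 _ (f \o cinv (ch p)) (h \o cinv (ch p))); try exact: sfn_diff.
by rewrite /= cmapK.
Qed.

Lemma pd_scale p u a f x : dom p x -> sfn x f -> pd p u (fun y => a * f y) x = a * pd p u f x.
Proof.
by move=> dx sf1; rewrite pd_mul ?pd_cst ?mul0r ?add0r//; exact: sfn_cst.
Qed.

Lemma pd_opp p u f x : dom p x -> sfn x f -> pd p u (fun y => - f y) x = - pd p u f x.
Proof.
move=> dx sf1; rewrite -mulN1r -pd_scale//; congr (pd p u _ x).
by apply/funext => y; rewrite mulN1r.
Qed.

Lemma pd_sum p u (I : Type) (r : seq I) (F : I -> M -> R) x : dom p x ->
  (forall i, sfn x (F i)) ->
  pd p u (fun y => \sum_(i <- r) F i y) x = \sum_(i <- r) pd p u (F i) x.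
Proof.
move=> dx sF.
by have [] := @derive_sumr _ _ r (fun i => F i \o cinv (ch p)) (cmap (ch p) x) u (fun i => sfn_diff dx (sF i)).
Qed.

Lemma pd_linv p (a : R) u v f x : dom p x -> sfn x f ->
  pd p (a *: u + v) f x = a * pd p u f x + pd p v f x.
Proof. by move=> dx sx; apply: derive_lin; exact: sfn_diff. Qed.

Lemma pd_sumv p (I : Type) (r : seq I) (c : I -> R) (u : I -> T) f x : dom p x -> sfn x f ->
  pd p (\sum_(i <- r) c i *: u i) f x = \sum_(i <- r) c i * pd p (u i) f x.
Proof. by move=> dx sx; apply: derive_sumv; exact: sfn_diff. Qed.

Lemma pd_schwarz p u v f x : dom p x -> sfn x f ->
  pd p u (pd p v f) x = pd p v (pd p u f) x.
Proof.
move=> dx sx; have [W [oW Wx cW]] := sfn_Ck 2%N dx sx.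
have E w w' : pd p w (pd p w' f) x = 'D_w (fun z => 'D_w' (f \o cinv (ch p)) z) (cmap (ch p) x).
  apply: near_eq_derive; have [[_ oI _ _ _] _] := chart_atP X p.
  apply: near_open oI _ _; first exact: im_in.
  by move=> z /im_inv[_ _ zE]; rewrite /= /pd zE.
by rewrite !E; exact: (Ck2_schwarz u v oW cW Wx).
Qed.

Lemma sfn_coord q k x : dom q x -> sfn x (xcoord q k).
Proof. by move=> dx; exists (dom q); split=> //; exact: sf_coord. Qed.

Lemma pd_chain p q u f x : dom p x -> dom q x -> sfn x f ->
  pd p u f x = \sum_k pd p u (xcoord q k) x * pd q (dvec k) f x.
Proof.
move=> px qx sx.
pose t := cmap (ch q) \o cinv (ch p).
have dt : differentiable t (cmap (ch p) x).
  by apply: diff_rV => i; exact: (sfn_diff px (sfn_coord i qx)).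
have tE : t (cmap (ch p) x) = cmap (ch q) x by rewrite /t /= cmapK.
rewrite /pd.
have -> : 'D_u (f \o cinv (ch p)) (cmap (ch p) x) = 'D_u ((f \o cinv (ch q)) \o t) (cmap (ch p) x).
  apply: near_eq_derive; apply: (@near_chart p x (fun y => f y = f (cinv (ch q) (cmap (ch q) y))) (dom q)) => //.
  by move=> y dy; rewrite cmapK.
have df : differentiable (f \o cinv (ch q)) (t (cmap (ch p) x)) by rewrite tE; exact: sfn_diff.
rewrite (derive_comp u dt df).
rewrite tE {1}(rV_basis ('D_u t (cmap (ch p) x))) derive_sumv; last exact: sfn_diff.
by apply: eq_bigr => k _; rewrite derive_rV.
Qed.

Lemma cfieldE p u y k : dom p y -> (cfield X p u y) 0 k = pd p u (xcoord y k) y.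
Proof.
move=> py; rewrite /cfield -deriveEjacobian.
  by rewrite derive_rV//; apply: diff_rV => i; exact: (sfn_diff py (sfn_coord i (dom_self y))).
by apply: diff_rV => i; exact: (sfn_diff py (sfn_coord i (dom_self y))).
Qed.

Lemma dfun_cfield p u f y : dom p y -> sfn y f -> dfun X f y (cfield X p u y) = pd p u f y.
Proof.
move=> py sy; rewrite (pd_chain u py (dom_self y) sy).
rewrite /dfun (rV_basis (cfield X p u y)) -/(pd y _ f y) pd_sumv//.
by apply: eq_bigr => k _; rewrite cfieldE.
Qed.

Lemma pd_coord q i j x : dom q x -> pd q (dvec i) (xcoord q j) x = (i == j)%:R.
Proof.
move=> qx; rewrite /pd.
have -> : 'D_(dvec i) (xcoord q j \o cinv (ch q)) (cmap (ch q) x) = 'D_(dvec i) (fun z : T => z 0 j) (cmap (ch q) x).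
  apply: near_eq_derive; have [[_ oI _ _ _] _] := chart_atP X q.
  apply: near_open oI _ _; first exact: im_in.
  by move=> z /im_inv[_ _ zE]; rewrite /= /xcoord zE.
have did : derivable (id : T -> T) (cmap (ch q) x) (dvec i) by exact: derivable_id.
have := derive_mx did.
by rewrite derive_id => /rowP/(_ j); rewrite !mxE eqxx /= eq_sym => <-.
Qed.

Lemma cfield_self x u : cfield X x u x = u.
Proof.
apply/rowP => k; rewrite cfieldE// {1}(rV_basis u) pd_sumv//; last exact: sfn_coord.
rewrite (bigD1 k)//= pd_coord// eqxx mulr1 big1 ?addr0// => i ik.
by rewrite pd_coord// (negbTE ik) mulr0.
Qed.

Lemma cfield_chain p q u y : dom p y -> dom q y ->
  cfield X p u y = \sum_k pd p u (xcoord q k) y *: cfield X q (dvec k) y.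
Proof.
move=> py qy; apply/rowP => j; rewrite summxE cfieldE// (pd_chain u py qy); last exact: sfn_coord.
by apply: eq_bigr => k _; rewrite scalemxE cfieldE.
Qed.

Lemma cfield_lin p (a : R) u v y : cfield X p (a *: u + v) y = a *: cfield X p u y + cfield X p v y.
Proof. by rewrite /cfield mulmxDl scalemxAl. Qed.

Lemma cfield_sum p (I : Type) (r : seq I) (c : I -> R) (u : I -> T) y :
  cfield X p (\sum_(i <- r) c i *: u i) y = \sum_(i <- r) c i *: cfield X p (u i) y.
Proof. by rewrite /cfield mulmx_suml; apply: eq_bigr => i _; rewrite scalemxAl. Qed.

Definition Jm p y : 'M[R]_4 := 'J (cmap (ch y) \o cinv (ch p)) (cmap (ch p) y).

Lemma cfieldJ p u y : cfield X p u y = u *m Jm p y. Proof. by []. Qed.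

Lemma Jm_det p y : dom p y -> 0 < \det (Jm p y).
Proof. by move=> py; apply: chart_oriented. Qed.

Lemma Jm_unit p y : dom p y -> Jm p y \in unitmx.
Proof. by move=> py; rewrite unitmxE unitfE gt_eqF// Jm_det. Qed.

(** The matrix of the metric in the chart at p. *)
Definition Gm p y : 'M[R]_4 := Jm p y *m gram X y *m (Jm p y)^T.

Lemma Gm_bil p y u v : bil (Gm p y) u v = inner X y (cfield X p u y) (cfield X p v y).
Proof. by rewrite /inner /bil !cfieldJ trmx_mul /Gm !mulmxA. Qed.

Lemma bil_dvec (S : 'M[R]_4) i j : bil S (dvec i) (dvec j) = S i j.
Proof. by rewrite /bil /dvec -rowE trmx_delta -colE !mxE. Qed.

Lemma sf_inner p u v : sf (dom p) (fun y => inner X y (cfield X p u y) (cfield X p v y)).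
Proof.
apply: (@sf_chart p) => // k; have [[_ oI _ _ _] _] := chart_atP X p.
have oD := im_open p (dom_open p).
have h : Ck k (chart_image (ch p) (dom p)) _ := Ck_sub (im_sub (fun _ _ => I)) (gram_smooth X p u v k).
by apply: Ck_ext oD _ h => z /im_inv[_ _ zE]; rewrite /= /inner /cfield zE.
Qed.

Lemma sf_Gm p i j : sf (dom p) (fun y => Gm p y i j).
Proof.
apply: sf_ext (dom_open p) _ (sf_inner p (dvec i) (dvec j)) => y py.
by rewrite -Gm_bil bil_dvec.
Qed.

Lemma gram_posdef y : posdef (gram X y).
Proof. by split; [exact: gram_sym | exact: gram_pos]. Qed.

Lemma Gm_posdef p y : dom p y -> posdef (Gm p y).
Proof.
move=> py; split; first by rewrite /Gm !trmx_mul trmxK gram_sym mulmxA.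
move=> v v0; rewrite -/(bil _ v v) Gm_bil; apply: gram_pos.
by apply: contra v0 => /eqP h; rewrite -[v](mulmxK (Jm_unit py)) -cfieldJ h mul0mx.
Qed.

Lemma Gm_unit p y : dom p y -> Gm p y \in unitmx.
Proof. by move=> py; apply: posdef_unit; exact: Gm_posdef. Qed.

Definition sfmx U m n (A : M -> 'M[R]_(m, n)) := forall i j, sf U (fun y => A y i j).

Lemma sfmx_Ck U m n (A : M -> 'M[R]_(m, n)) : sfmx U A <->
  forall p k, Ck_mx k (chart_image (ch p) U) (A \o cinv (ch p)).
Proof. by split=> h; [move=> p k i j; exact: (h i j p k) | move=> i j p k; exact: (h p k i j)]. Qed.

Lemma sf_mulmx U m n r (A : M -> 'M[R]_(m, n)) (B : M -> 'M[R]_(n, r)) : open U ->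
  sfmx U A -> sfmx U B -> sfmx U (fun y => A y *m B y).
Proof.
move=> oU /sfmx_Ck sA /sfmx_Ck sB; apply/sfmx_Ck => p k.
exact: Ck_mulmx (im_open p oU) (sA p k) (sB p k).
Qed.

Lemma sf_trmx U m n (A : M -> 'M[R]_(m, n)) : open U -> sfmx U A -> sfmx U (fun y => (A y)^T).
Proof. by move=> oU sA i j; apply: sf_ext oU _ (sA j i) => y _; rewrite mxE. Qed.

Lemma sf_det U n (A : M -> 'M[R]_n) : open U -> sfmx U A -> sf U (fun y => \det (A y)).
Proof. by move=> oU /sfmx_Ck sA p k; exact: Ck_det (im_open p oU) (sA p k). Qed.

Lemma sf_invmx U n (A : M -> 'M[R]_n) : open U -> (forall y, U y -> A y \in unitmx) ->
  sfmx U A -> sfmx U (fun y => invmx (A y)).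
Proof.
move=> oU uA /sfmx_Ck sA; apply/sfmx_Ck => p k.
apply: Ck_invmx (im_open p oU) _ (sA p k) => z /im_inv[_ Uz _]; exact: uA.
Qed.

End ManifoldCalculus.

(** * Oriented Euclidean bundles of rank three *)

Lemma I3P (P : 'I_3 -> Prop) : P 0 -> P 1 -> P 2%:R -> forall i, P i.
Proof.
move=> P0 P1 P2 [[|[|[|//]]] lt_i].
- by congr P: P0; apply: val_inj.
- by congr P: P1; apply: val_inj.
- by congr P: P2; apply: val_inj.
Qed.

Lemma sum3 (V : nmodType) (F : 'I_3 -> V) : \sum_i F i = F 0 + F 1 + F 2%:R.
Proof.
rewrite !big_ord_recl big_ord0 addr0 addrA; congr (F _ + F _ + F _); exact: val_inj.
Qed.

Lemma z3E : ((0 + 1 : 'I_3) = 1) * ((0 + 2%:R : 'I_3) = 2%:R) * ((1 + 1 : 'I_3) = 2%:R) *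
  ((1 + 2%:R : 'I_3) = 0) * ((2%:R + 1 : 'I_3) = 0) * ((2%:R + 2%:R : 'I_3) = 1).
Proof. by do !split; apply: val_inj. Qed.

Lemma z3eq : (((0 : 'I_3) == 1) = false) * (((0 : 'I_3) == 2%:R) = false) * (((1 : 'I_3) == 0) = false) *
 (((1 : 'I_3) == 2%:R) = false) * (((2%:R : 'I_3) == 0) = false) * (((2%:R : 'I_3) == 1) = false).
Proof. by []. Qed.

Lemma det3 (R : comPzRingType) (A : 'M[R]_3) : \det A =
  (A 0 1 * A 1 2%:R - A 0 2%:R * A 1 1) * A 2%:R 0 +
  (A 0 2%:R * A 1 0 - A 0 0 * A 1 2%:R) * A 2%:R 1 +
  (A 0 0 * A 1 1 - A 0 1 * A 1 0) * A 2%:R 2%:R.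
Proof.
rewrite (expand_det_row _ (2%:R : 'I_3)) sum3.
have d2 (B : 'M[R]_2) : \det B = B 0 0 * B 1 1 - B 0 1 * B 1 0.
  have sum2 (F : 'I_2 -> R) : \sum_i F i = F 0 + F 1.
    by rewrite !big_ord_recl big_ord0 addr0; congr (F _ + F _); exact: val_inj.
  rewrite (expand_det_row _ 0) sum2 /cofactor !det_mx11 !mxE /=.
  have e1 : lift (0 : 'I_2) (0 : 'I_1) = 1 :> 'I_2 by exact: val_inj.
  have e2 : lift (1 : 'I_2) (0 : 'I_1) = 0 :> 'I_2 by exact: val_inj.
  by rewrite e1 e2 !expr0 !expr1; ring.
rewrite /cofactor !d2 !mxE /=.
have l20 : lift (2%:R : 'I_3) (0 : 'I_2) = 0 :> 'I_3 by exact: val_inj.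
have l21 : lift (2%:R : 'I_3) (1 : 'I_2) = 1 :> 'I_3 by exact: val_inj.
have l10 : lift (1 : 'I_3) (0 : 'I_2) = 0 :> 'I_3 by exact: val_inj.
have l11 : lift (1 : 'I_3) (1 : 'I_2) = 2%:R :> 'I_3 by exact: val_inj.
have l00 : lift (0 : 'I_3) (0 : 'I_2) = 1 :> 'I_3 by exact: val_inj.
have l01 : lift (0 : 'I_3) (1 : 'I_2) = 2%:R :> 'I_3 by exact: val_inj.
rewrite l20 l21 l10 l11 l00 l01.
rewrite (_ : (-1) ^+ (2 + 0) = 1 :> R); last by rewrite !exprS expr0; ring.
rewrite (_ : (-1) ^+ (2 + 1) = -1 :> R); last by rewrite !exprS expr0; ring.
rewrite (_ : (-1) ^+ (2 + 2) = 1 :> R); last by rewrite !exprS expr0; ring.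
ring.
Qed.

Section Bundle.
Context (R : realType) (M : topologicalType) (X : oriented_riemannian4 R M).
Local Notation T := 'rV[R]_4.
Local Notation sf := (smooth_fun X).
Context (E : bundle3 R M) (hE : oriented_euclidean3 X E).
Local Notation ss := (@smooth_sec R M X E).
Local Notation ssn := (@smooth_sec_near R M X E).
Implicit Types (x y : M) (U V : set M).

Section Fibre.
Context (x : M).
Local Notation F := (fib E x).
Implicit Types (a : R) (u v w : F) (b : 'I_3 -> F).

Lemma ipDl u v w : ip (u + v) w = ip u w + ip v w.
Proof. by rewrite -[u]scale1r (ip_lin hE) mul1r scale1r. Qed.

Lemma ip0l w : ip 0 w = 0.
Proof. by apply: (addrI (ip 0 w)); rewrite -ipDl !addr0. Qed.

Lemma ipZl a u w : ip (a *: u) w = a * ip u w.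
Proof. by rewrite -[a *: u]addr0 (ip_lin hE) ip0l addr0. Qed.

Lemma ipNl u w : ip (- u) w = - ip u w.
Proof. by rewrite -scaleN1r ipZl mulN1r. Qed.

Lemma ipBl u v w : ip (u - v) w = ip u w - ip v w.
Proof. by rewrite ipDl ipNl. Qed.

Lemma ip_suml (I : Type) (r : seq I) (f : I -> F) w :
  ip (\sum_(i <- r) f i) w = \sum_(i <- r) ip (f i) w.
Proof.
elim: r => [|i r IH]; first by rewrite !big_nil ip0l.
by rewrite !big_cons ipDl IH.
Qed.

Lemma ipDr u v w : ip w (u + v) = ip w u + ip w v.
Proof. by rewrite !(ip_sym hE w) ipDl. Qed.

Lemma ipNr u w : ip w (- u) = - ip w u.
Proof. by rewrite !(ip_sym hE w) ipNl. Qed.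

Lemma ip_sumr (I : Type) (r : seq I) (f : I -> F) w :
  ip w (\sum_(i <- r) f i) = \sum_(i <- r) ip w (f i).
Proof. by rewrite (ip_sym hE) ip_suml; apply: eq_bigr => i _; rewrite (ip_sym hE). Qed.

Definition orthonormal b := forall i j, ip (b i) (b j) = (i == j)%:R.

Lemma frame_expansion b v : orthonormal b -> v = \sum_i ip v (b i) *: b i.
Proof.
move=> ob; pose t := [tuple b i | i < 3].
have tE (i : 'I_3) : t`_i = b i by exact: nth_mktuple.
have fr : free t.
  apply/freeP => k; rewrite (eq_bigr (fun i => k i *: b i)) => [|i _]; last by rewrite tE.
  move=> h i; have := congr1 (fun z => ip z (b i)) h.
  rewrite ip_suml ip0l (bigD1 i)//= big1 => [|j ji]; rewrite ipZl ob ?eqxx ?mulr1 ?addr0//.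
  by rewrite (negbTE ji) mulr0.
have bt : basis_of fullv t.
  by rewrite basisEfree fr subvf (fib_dim hE) size_tuple.
have := coord_basis bt (memvf v).
rewrite (eq_bigr (fun i => coord t i v *: b i)) => [E1|i _]; last by rewrite tE.
rewrite {1}E1; apply: eq_bigr => i _; congr (_ *: _).
rewrite [in RHS]E1 ip_suml (bigD1 i)//= big1 => [|j ji]; rewrite ipZl ob ?eqxx ?mulr1 ?addr0//.
by rewrite (negbTE ji) mulr0.
Qed.

Lemma frame_inj b u v : orthonormal b -> (forall i, ip u (b i) = ip v (b i)) -> u = v.
Proof.
move=> ob h; rewrite (frame_expansion u ob) (frame_expansion v ob).
by apply: eq_bigr => i _; rewrite h.
Qed.

Lemma parseval b u v : orthonormal b -> ip u v = \sum_i ip u (b i) * ip v (b i).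
Proof.
move=> ob; rewrite {1}(frame_expansion u ob) ip_suml; apply: eq_bigr => i _.
by rewrite ipZl (ip_sym hE v).
Qed.

Definition oframe b := orthonormal b /\ 0 < \det (\matrix_(i, j) ip (onb E x i) (b j)).

Lemma onb_frame : exists U (e : forall x, 'I_3 -> fib E x), [/\ lframe U e, U x & onb E x = e x].
Proof.
rewrite /onb; set A := [set b | _]; have : A (xget (fun=> 0) A).
  have [U [e [fe Ux]]] := lframe_cover hE x.
  by apply: (@xgetPex _ _ A); exists (e x), U, e.
by [].
Qed.

Lemma lframe_oframe U (e : forall x, 'I_3 -> fib E x) : lframe U e -> U x -> oframe (e x).
Proof.
move=> fe Ux; split=> [i j|]; first exact: (lframe_on hE fe).
by have [V [f [ff Vx ->]]] := onb_frame; exact: (lframe_oriented hE ff fe).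
Qed.

Lemma onb_on : orthonormal (onb E x).
Proof. by have [V [f [ff Vx ->]]] := onb_frame; apply: (lframe_on hE ff). Qed.

Lemma oframe_det b : oframe b -> \det (\matrix_(i, j) ip (onb E x i) (b j)) = 1.
Proof.
move=> [ob]; set P := \matrix_(i, j) _ => dP.
have PP : P *m P^T = 1%:M.
  apply/matrixP => i j; rewrite !mxE -onb_on (parseval _ _ ob).
  by apply: eq_bigr => k _; rewrite !mxE.
have := congr1 determinant PP; rewrite det_mulmx det_tr det1 => h.
move: (\det P) dP h => d d0 h.
have : (d - 1) * (d + 1) = 0 by rewrite mulrBl mulrDr h; ring.
by move/eqP; rewrite mulf_eq0 subr_eq0 => /orP[/eqP//|]; rewrite gt_eqF// ltr_wpDr.
Qed.

Lemma cross_onb u v i : ip (cross u v) (onb E x i) =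
  ip u (onb E x (i + 1)) * ip v (onb E x (i + 2%:R)) - ip u (onb E x (i + 2%:R)) * ip v (onb E x (i + 1)).
Proof.
rewrite /cross ip_suml (bigD1 i)//= big1 => [|j ji].
  by rewrite ipZl onb_on eqxx mulr1 addr0.
by rewrite ipZl onb_on (negbTE ji) mulr0.
Qed.

Let tri b (u v w : F) : 'M[R]_3 := \matrix_(k, j) ip (if k == 0 then u else if k == 1 then v else w) (b j).

Let tri_det b u v w : \det (tri b u v w) =
  \sum_i (ip u (b (i + 1)) * ip v (b (i + 2%:R)) - ip u (b (i + 2%:R)) * ip v (b (i + 1))) * ip w (b i).
Proof. by rewrite det3 !mxE sum3 !z3E. Qed.

(** The cross product is defined with one chosen basis of each fibre; it has the
    same expression in all oriented orthonormal frames, because in each of them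
    it is a determinant and frames differ by a rotation. This makes it smooth. *)
Lemma cross_frame b u v i : oframe b -> ip (cross u v) (b i) =
  ip u (b (i + 1)) * ip v (b (i + 2%:R)) - ip u (b (i + 2%:R)) * ip v (b (i + 1)).
Proof.
move=> hb; have [ob _] := hb.
have E1 w : ip (cross u v) w = \det (tri b u v w).
  rewrite (parseval _ _ onb_on) (eq_bigr _ (fun i _ => congr1 ( *%R^~ _) (cross_onb u v i))) -tri_det.
  rewrite -[LHS]mulr1 -(oframe_det hb) -det_mulmx; congr (\det _).
  apply/matrixP => k j; rewrite !mxE (parseval _ _ onb_on); apply: eq_bigr => l _.
  by rewrite !mxE [ip (b j) _](ip_sym hE).
rewrite E1 tri_det (bigD1 i)//= ob eqxx mulr1 big1 ?addr0// => j ji.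
by rewrite ob eq_sym (negbTE ji) mulr0.
Qed.

Definition ipE := (ipDl, ipZl, ipNl, ipBl, ip0l, cross_onb).

Lemma fib_inj u v : (forall i, ip u (onb E x i) = ip v (onb E x i)) -> u = v.
Proof. exact: frame_inj onb_on. Qed.

Lemma crossDl u v w : cross (u + v) w = cross u w + cross v w.
Proof. by apply: fib_inj => i; rewrite !ipE; ring. Qed.

Lemma crossZl a u w : cross (a *: u) w = a *: cross u w.
Proof. by apply: fib_inj => i; rewrite !ipE; ring. Qed.

Lemma crossC u v : cross u v = - cross v u.
Proof. by apply: fib_inj => i; rewrite !ipE; ring. Qed.

Lemma crossDr u v w : cross w (u + v) = cross w u + cross w v.
Proof. by apply: fib_inj => i; rewrite !ipE; ring. Qed.

Lemma crossZr a u w : cross w (a *: u) = a *: cross w u.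
Proof. by apply: fib_inj => i; rewrite !ipE; ring. Qed.

Lemma cross0l u : cross 0 u = 0.
Proof. by apply: fib_inj => i; rewrite !ipE; ring. Qed.

Lemma cross0r u : cross u 0 = 0.
Proof. by rewrite crossC cross0l oppr0. Qed.

Lemma crossNl u w : cross (- u) w = - cross u w.
Proof. by rewrite -scaleN1r crossZl scaleN1r. Qed.

Lemma crossNr u w : cross w (- u) = - cross w u.
Proof. by rewrite -scaleN1r crossZr scaleN1r. Qed.

Lemma cross_sumr (I : Type) (r : seq I) (f : I -> F) w :
  cross w (\sum_(i <- r) f i) = \sum_(i <- r) cross w (f i).
Proof.
elim: r => [|i r IH]; first by rewrite !big_nil cross0r.
by rewrite !big_cons crossDr IH.
Qed.

Lemma ip_cross_skew f u v : ip (cross f u) v = - ip u (cross f v).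
Proof.
rewrite (ip_sym hE u) !(parseval _ _ onb_on) !sum3 !cross_onb !z3E; ring.
Qed.

Lemma jacobi f u v : cross f (cross u v) = cross (cross f u) v + cross u (cross f v).
Proof.
apply: fib_inj; apply: I3P; rewrite !ipE ?z3E; ring.
Qed.

(** A vector is recovered from its brackets with a frame. This is how sections
    known only through their action by the bracket are seen to be smooth. *)
Lemma cross_recover b f : oframe b -> f = 2^-1 *: \sum_i cross (b i) (cross f (b i)).
Proof.
move=> hb; have [ob _] := hb; apply: (frame_inj ob) => j; rewrite ipZl ip_suml sum3.
move: j; apply: I3P; rewrite !(cross_frame _ _ _ hb) ?z3E !ob !z3eq ?eqxx /=; by field.
Qed.

Lemma cross_inj b f f' : oframe b -> (forall i, cross f (b i) = cross f' (b i)) -> f = f'.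
Proof.
move=> hb h; rewrite (cross_recover f hb) (cross_recover f' hb); congr (_ *: _).
by apply: eq_bigr => i _; rewrite h.
Qed.

(** The identification of so(E) with E, for an operator which is known only
    through its values on a frame. *)
Lemma skew_cross b (om : 'I_3 -> F) : oframe b ->
  (forall i j, ip (om i) (b j) + ip (b i) (om j) = 0) ->
  exists f, forall i, cross f (b i) = om i.
Proof.
move=> hb sk; have [ob _] := hb; exists (2^-1 *: \sum_i cross (b i) (om i)) => i.
set f := 2^-1 *: _; apply: (frame_inj ob) => j.
have sk' k l : ip (om k) (b l) = - ip (om l) (b k).
  by apply/eqP; rewrite -addr_eq0 [X in _ + X](ip_sym hE) sk.
have sk0 k : ip (om k) (b k) = 0.
  by have := sk k k; rewrite [ip (b k) _](ip_sym hE) => h; lra.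
have fE : (ip f (b 0) = ip (om 1) (b 2%:R)) * (ip f (b 1) = ip (om 2%:R) (b 0)) * (ip f (b 2%:R) = ip (om 0) (b 1)).
  by split; [split|]; rewrite /f ipZl ip_suml sum3 !(cross_frame _ _ _ hb) ?z3E !ob !z3eq ?eqxx /= ?sk0 ?(sk' 1 0) ?(sk' 2%:R 0) ?(sk' 2%:R 1); field.
move: i j; apply: I3P; apply: I3P; rewrite (cross_frame _ _ _ hb) ?z3E !fE !ob ?z3eq ?eqxx /= ?sk0 ?(sk' 1 0) ?(sk' 2%:R 0) ?(sk' 2%:R 1); ring.
Qed.

End Fibre.

End Bundle.

(** * Covariant derivatives and curvature *)

Lemma cancel_common (V : zmodType) (a b c d d' : V) :
  a + b + (c + d) - (a + c + (b + d')) = d - d'.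
Proof.
rewrite [a + b + _]addrACA; move: (a + c) => e.
by rewrite opprD [LHS]addrACA subrr add0r opprD [LHS]addrACA subrr add0r.
Qed.

Section Sections.
Context (R : realType) (M : topologicalType) (X : oriented_riemannian4 R M).
Local Notation T := 'rV[R]_4.
Local Notation dom p := (cdom (chart_at X p)).
Local Notation sf := (smooth_fun X).
Local Notation sfn := (smooth_fun_near X).
Context (E : bundle3 R M) (hE : oriented_euclidean3 X E).
Local Notation ss := (@smooth_sec R M X E).
Local Notation ssn := (@smooth_sec_near R M X E).
Local Notation sec := (forall y, fib E y).
Implicit Types (x y p q : M) (U V : set M) (s t : sec) (e : forall x, 'I_3 -> fib E x) (u v w : T).

Lemma frame_on V e y : lframe V e -> V y -> orthonormal (e y).
Proof. by move=> fe Vy i j; exact: (lframe_on hE fe). Qed.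

Lemma frame_open V e : lframe V e -> open V.
Proof. exact: (lframe_open hE). Qed.

Lemma ss_sub U V s : U `<=` V -> ss V s -> ss U s.
Proof.
move=> UV sV W e fe i; apply: sf_sub (sV W e fe i) => y [Uy Wy]; split=> //; exact: UV.
Qed.

Lemma ss_ext U s t : open U -> (forall y, U y -> s y = t y) -> ss U s -> ss U t.
Proof.
move=> oU st sU W e fe i; apply: sf_ext (sU W e fe i).
  exact: openI oU (frame_open fe).
by move=> y [Uy _]; rewrite st.
Qed.

Lemma ss_local U s : (forall y, U y -> exists V, V y /\ ss (U `&` V) s) -> ss U s.
Proof.
move=> h W e fe i; apply: sf_local => y [Uy Wy]; have [V [Vy sV]] := h y Uy.
exists V; split=> //; apply: sf_sub (sV W e fe i) => z [[? ?] ?]; by split.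
Qed.

Lemma ss_add U s t : open U -> ss U s -> ss U t -> ss U (fun y => s y + t y).
Proof.
move=> oU s1 s2 W e fe i; have oUW := openI oU (frame_open fe).
apply: sf_ext oUW _ (sf_add oUW (s1 W e fe i) (s2 W e fe i)) => y _.
by rewrite (ipDl hE).
Qed.

Lemma ss_scale U f s : open U -> sf U f -> ss U s -> ss U (fun y => f y *: s y).
Proof.
move=> oU s1 s2 W e fe i; have oUW := openI oU (frame_open fe).
have s1' : sf (U `&` W) f by apply: sf_sub s1 => y [].
by apply: sf_ext oUW _ (sf_mul oUW s1' (s2 W e fe i)) => y _; rewrite (ipZl hE).
Qed.

Lemma ss_0 U : ss U (fun=> 0).
Proof.
move=> W e fe i; have := sf_cst X (U `&` W) 0.
by congr (sf _ _); apply/funext => y; rewrite (ip0l hE).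
Qed.

Lemma ss_sum U (I : Type) (r : seq I) (F : I -> sec) : open U ->
  (forall i, ss U (F i)) -> ss U (fun y => \sum_(i <- r) F i y).
Proof.
move=> oU h; elim: r => [|i r IH].
  by apply: ss_ext oU _ (ss_0 U) => y _; rewrite big_nil.
by apply: ss_ext oU _ (ss_add oU (h i) IH) => y _; rewrite big_cons.
Qed.

Lemma ss_cross U s t : open U -> ss U s -> ss U t -> ss U (fun y => cross (s y) (t y)).
Proof.
move=> oU s1 s2 W e fe i; have oUW := openI oU (frame_open fe).
apply: (@sf_ext _ _ _ _ (fun y => ip (s y) (e y (i + 1)) * ip (t y) (e y (i + 2%:R)) - ip (s y) (e y (i + 2%:R)) * ip (t y) (e y (i + 1)))) => //.
  by move=> y [Uy Wy]; rewrite (cross_frame hE _ _ _ (lframe_oframe hE fe Wy)).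
by apply: sf_subr => //; apply: sf_mul => //; [exact: s1|exact: s2|exact: s1|exact: s2].
Qed.

Lemma sf_ip U s t : open U -> ss U s -> ss U t -> sf U (fun y => ip (s y) (t y)).
Proof.
move=> oU s1 s2; apply: sf_local => y Uy; have [W [e [fe Wy]]] := lframe_cover hE y.
exists W; split=> //; have oUW := openI oU (frame_open fe).
apply: (@sf_ext _ _ _ _ (fun y => \sum_j ip (s y) (e y j) * ip (t y) (e y j))) => //.
  by move=> z [Uz Wz]; rewrite (parseval hE _ _ (frame_on fe Wz)).
by apply: sf_sum => // j _; apply: sf_mul => //; [exact: s1 | exact: s2].
Qed.

Lemma frame_ss V e i : lframe V e -> ss V (fun y => e y i).
Proof. by move=> fe; exact: (lframe_smooth hE fe). Qed.

Lemma ssn2 x s t : ssn x s -> ssn x t -> exists U, [/\ open U, U x, ss U s & ss U t].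
Proof.
move=> [U [oU Ux sU]] [V [oV Vx sV]]; exists (U `&` V); split=> //.
- exact: openI.
- by apply: ss_sub sU => y [].
- by apply: ss_sub sV => y [].
Qed.

Lemma ssn_add x s t : ssn x s -> ssn x t -> ssn x (fun y => s y + t y).
Proof. by move=> h1 h2; have [U [oU Ux s1 s2]] := ssn2 h1 h2; exists U; split=> //; exact: ss_add. Qed.

Lemma ssn_scale x f s : sfn x f -> ssn x s -> ssn x (fun y => f y *: s y).
Proof.
move=> [U [oU Ux sU]] [V [oV Vx sV]]; exists (U `&` V); split; [exact: openI|by split|].
apply: ss_scale; first exact: openI.
- by apply: sf_sub sU => y [].
- by apply: ss_sub sV => y [].
Qed.

Lemma ssn_cross x s t : ssn x s -> ssn x t -> ssn x (fun y => cross (s y) (t y)).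
Proof. by move=> h1 h2; have [U [oU Ux s1 s2]] := ssn2 h1 h2; exists U; split=> //; exact: ss_cross. Qed.

Lemma sfn_ip x s t : ssn x s -> ssn x t -> sfn x (fun y => ip (s y) (t y)).
Proof. by move=> h1 h2; have [U [oU Ux s1 s2]] := ssn2 h1 h2; exists U; split=> //; exact: sf_ip. Qed.

Lemma ssn_0 x : ssn x (fun=> 0).
Proof. by exists setT; split=> //; [exact: openT | exact: ss_0]. Qed.

Lemma ssn_sum x (I : Type) (r : seq I) (F : I -> sec) :
  (forall i, ssn x (F i)) -> ssn x (fun y => \sum_(i <- r) F i y).
Proof.
move=> h; elim: r => [|i r IH].
  by have := ssn_0 x; congr (ssn _ _); apply: functional_extensionality_dep => y; rewrite big_nil.
by have := ssn_add (h i) IH; congr (ssn _ _); apply: functional_extensionality_dep => y; rewrite big_cons.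
Qed.

Lemma ssn_cscale x (a : R) s : ssn x s -> ssn x (fun y => a *: s y).
Proof. by apply: ssn_scale; exact: sfn_cst. Qed.

Lemma ssn_opp x s : ssn x s -> ssn x (fun y => - s y).
Proof.
move=> /(ssn_cscale (-1)); congr (ssn _ _); apply: functional_extensionality_dep => y.
by rewrite scaleN1r.
Qed.

Lemma ssn_frame V e x i : lframe V e -> V x -> ssn x (fun y => e y i).
Proof. by move=> fe Vx; exists V; split=> //; [exact: frame_open fe | exact: frame_ss]. Qed.

Section Connection.
Context (D : Conn E) (hD : so3_connection X D).

(** Connections are local, because the Leibniz rule applies to a function that
    vanishes near x and is 1 where the two sections differ. *)
Lemma conn_local U x v s t : open U -> U x -> (forall y, U y -> s y = t y) ->
  ssn x s -> D x v s = D x v t.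
Proof.
move=> oU Ux st ns; pose f y : R := if pselect (U y) then 0 else 1.
have fU y : U y -> f y = 0 by rewrite /f; case: pselect.
have fN y : ~ U y -> f y = 1 by rewrite /f; case: pselect.
have nf : sfn x f.
  by exists U; split=> //; apply: sf_ext oU _ (sf_cst X U 0) => y /fU.
pose r y := t y - s y.
have nt : ssn x t.
  have [V [oV Vx sV]] := ns; exists (U `&` V); split; [exact: openI | by split |].
  by apply: (@ss_ext (U `&` V) s); [exact: openI | move=> y [/st] | apply: ss_sub sV => y []].
have nr : ssn x r by apply: ssn_add => //; exact: ssn_opp.
have Er : (fun y => f y *: r y) = r.
  apply: functional_extensionality_dep => y; case: (pselect (U y)) => Uy; last by rewrite fN// scale1r.
  by rewrite /r st// subrr scaler0.
have E0 : D x v r = 0.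
  rewrite -Er (conn_leibniz hD) // /r st// subrr scaler0 fU// scale0r addr0 //.
have Et : t = (fun y => s y + r y) by apply: functional_extensionality_dep => y; rewrite /r subrKC.
by rewrite Et (conn_add hD)// E0 addr0.
Qed.

Lemma conn_0 x v : D x v (fun=> 0) = 0.
Proof.
have := conn_add hD v (ssn_0 x) (ssn_0 x).
have -> : (fun y => 0 + 0) = (fun=> 0) :> sec by apply: functional_extensionality_dep => y; rewrite addr0.
by rewrite -[LHS]addr0 => /addrI.
Qed.

Lemma conn_scale x v (a : R) s : ssn x s -> D x v (fun y => a *: s y) = a *: D x v s.
Proof.
move=> ns; rewrite (conn_leibniz hD v (sfn_cst X x a) ns).
by rewrite -[dfun X _ _ _]/(pd X x v (fun=> a) x) pd_cst scale0r add0r.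
Qed.

Lemma conn_opp x v s : ssn x s -> D x v (fun y => - s y) = - D x v s.
Proof.
move=> ns; rewrite -scaleN1r -conn_scale//; congr (D _ _ _).
by apply: functional_extensionality_dep => y; rewrite scaleN1r.
Qed.

Lemma conn_sub x v s t : ssn x s -> ssn x t -> D x v (fun y => s y - t y) = D x v s - D x v t.
Proof. by move=> ns nt; rewrite (conn_add hD)//; [rewrite conn_opp | exact: ssn_opp]. Qed.

Lemma conn_sum x v (I : Type) (r : seq I) (F : I -> sec) : (forall i, ssn x (F i)) ->
  D x v (fun y => \sum_(i <- r) F i y) = \sum_(i <- r) D x v (F i).
Proof.
move=> nF; elim: r => [|i r IH].
  rewrite big_nil -(conn_0 x v); congr (D _ _ _).
  by apply: functional_extensionality_dep => y; rewrite big_nil.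
rewrite big_cons -IH -(conn_add hD) //; last exact: ssn_sum.
by congr (D _ _ _); apply: functional_extensionality_dep => y; rewrite big_cons.
Qed.

Lemma conn_sumv x (I : Type) (r : seq I) (c : I -> R) (u : I -> T) s : ssn x s ->
  D x (\sum_(i <- r) c i *: u i) s = \sum_(i <- r) c i *: D x (u i) s.
Proof.
move=> ns; elim: r => [|i r IH]; last by rewrite !big_cons (conn_linv hD)// IH.
rewrite !big_nil; have := conn_linv hD (x := x) 1 0 0 ns.
by rewrite scaler0 addr0 scale1r => h; apply: (addrI (D x 0 s)); rewrite addr0 -h.
Qed.

Definition nabla p u s : sec := fun y => D y (cfield X p u y) s.

Lemma nablaE p u s y : nabla p u s y = D y (cfield X p u y) s.
Proof. by []. Qed.

Lemma nabla_ssn x p u s : dom p x -> ssn x s -> ssn x (nabla p u s).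
Proof.
move=> px [U [oU Ux sU]]; exists (U `&` dom p); split; last exact: (conn_smooth hD).
  by apply: openI oU _; exact: dom_open.
by split.
Qed.

Lemma nabla_leibniz p u f s y : dom p y -> sfn y f -> ssn y s ->
  nabla p u (fun y => f y *: s y) y = pd X p u f y *: s y + f y *: nabla p u s y.
Proof. by move=> py nf ns; rewrite /nabla (conn_leibniz hD)// dfun_cfield. Qed.

Lemma nabla_metric p u s t y : dom p y -> ssn y s -> ssn y t ->
  pd X p u (fun y => ip (s y) (t y)) y = ip (nabla p u s y) (t y) + ip (s y) (nabla p u t y).
Proof.
by move=> py ns nt; rewrite -dfun_cfield//; [rewrite (conn_metric hD) | exact: sfn_ip].
Qed.

Lemma nabla_chain p q u s y : dom p y -> dom q y -> ssn y s ->
  nabla p u s y = \sum_k pd X p u (xcoord X q k) y *: nabla q (dvec k) s y.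
Proof. by move=> py qy ns; rewrite /nabla (cfield_chain u py qy) conn_sumv. Qed.

Lemma nabla_local U p u s t y : open U -> U y -> (forall z, U z -> s z = t z) ->
  ssn y s -> nabla p u s y = nabla p u t y.
Proof. by move=> oU Uy st ns; exact: conn_local st ns. Qed.

(** In an orthonormal frame, a metric connection is the derivative of the
    components plus the bracket with a fixed vector. *)
Lemma nabla_rep p u y V e : dom p y -> lframe V e -> V y ->
  exists f : fib E y, forall s, ssn y s -> forall i,
    ip (nabla p u s y) (e y i) = pd X p u (fun z => ip (s z) (e z i)) y + ip (cross f (s y)) (e y i).
Proof.
move=> py fe Vy; have ob := frame_on fe Vy; have hb := lframe_oframe hE fe Vy.
have oV := frame_open fe.
have nfe i : ssn y (fun y => e y i) by exact: (ssn_frame i fe Vy).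
have [i j|f hf] := skew_cross hE (om := fun i => nabla p u (fun z => e z i) y) hb.
  rewrite -nabla_metric// (@pd_ext _ _ _ _ _ _ V _ (fun=> (i == j)%:R)) ?pd_cst//.
  by move=> z Vz; exact: (frame_on fe Vz).
exists f => s ns i.
have ni j : sfn y (fun z => ip (s z) (e z j)) by exact: sfn_ip.
have -> : nabla p u s y = nabla p u (fun z => \sum_j ip (s z) (e z j) *: e z j) y.
  by apply: (nabla_local p u oV) => // z Vz; exact: (frame_expansion hE _ (frame_on fe Vz)).
rewrite {1}/nabla conn_sum; last by move=> j; exact: ssn_scale.
rewrite (eq_bigr (fun j => pd X p u (fun z => ip (s z) (e z j)) y *: e y j + ip (s y) (e y j) *: cross f (e y j))); last first.
  by move=> j _; rewrite hf -nabla_leibniz.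
rewrite big_split /= (ipDl hE) (ip_suml hE) (bigD1 i)//= big1 => [|j ji]; last first.
  by rewrite (ipZl hE) ob (negbTE ji) mulr0.
rewrite (ipZl hE) ob eqxx mulr1 addr0; congr (_ + ip _ _).
rewrite [in RHS](frame_expansion hE (s y) ob) (cross_sumr hE); apply: eq_bigr => j _.
by rewrite (crossZr hE).
Qed.

Lemma nabla_cross p u s t y : dom p y -> ssn y s -> ssn y t ->
  nabla p u (fun z => cross (s z) (t z)) y = cross (nabla p u s y) (t y) + cross (s y) (nabla p u t y).
Proof.
move=> py ns nt; have [V [e [fe Vy]]] := lframe_cover hE y.
have ob := frame_on fe Vy; have hb := lframe_oframe hE fe Vy.
have [f hf] := nabla_rep u py fe Vy.
apply: (frame_inj hE ob) => i; rewrite hf; last exact: ssn_cross.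
have nfe k : ssn y (fun y => e y k) by exact: (ssn_frame k fe Vy).
have nsi j : sfn y (fun z => ip (s z) (e z j)) by exact: sfn_ip.
have nti j : sfn y (fun z => ip (t z) (e z j)) by exact: sfn_ip.
rewrite (@pd_ext _ _ _ _ _ _ V _ (fun z => ip (s z) (e z (i + 1)) * ip (t z) (e z (i + 2%:R)) +
    - (ip (s z) (e z (i + 2%:R)) * ip (t z) (e z (i + 1)))))//; last 2 first.
- exact: frame_open fe.
- by move=> z Vz; rewrite (cross_frame hE _ _ _ (lframe_oframe hE fe Vz)).
rewrite pd_add// ?pd_opp//; try by do ?apply: sfn_opp; exact: sfn_mul.
rewrite !pd_mul// (jacobi hE) !(ipDl hE).
by rewrite !(cross_frame hE _ _ _ hb) !hf// !(cross_frame hE _ _ _ hb); ring.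
Qed.

(** The commutator of the covariant derivatives along two coordinate fields of
    one chart; these fields commute, so that there is no Lie bracket term. *)
Definition K p u v s : sec := fun y => nabla p u (nabla p v s) y - nabla p v (nabla p u s) y.

Lemma K_scale p u v f s y : dom p y -> sfn y f -> ssn y s ->
  K p u v (fun z => f z *: s z) y = f y *: K p u v s y.
Proof.
move=> py nf ns; rewrite /K.
have step a b : nabla p a (nabla p b (fun z => f z *: s z)) y =
   pd X p a (pd X p b f) y *: s y + pd X p b f y *: nabla p a s y +
   (pd X p a f y *: nabla p b s y + f y *: nabla p a (nabla p b s) y).
  have [U [oU Uy sfU]] := nf; have [V [oV Vy sV]] := ns.
  have -> : nabla p a (nabla p b (fun z => f z *: s z)) y = nabla p a (fun z => pd X p b f z *: s z + f z *: nabla p b s z) y.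
    apply: (nabla_local p a (openI (openI oU oV) (dom_open X p))); first by split.
      by move=> z [[Uz Vz] pz]; rewrite nabla_leibniz//; [exists U | exists V].
    by apply: nabla_ssn => //; exact: ssn_scale.
  rewrite {1}/nabla (conn_add hD).
  - by rewrite -!nabla_leibniz//; [exact: nabla_ssn | exact: sfn_pd].
  - by apply: ssn_scale => //; exact: sfn_pd.
  - by apply: ssn_scale => //; exact: nabla_ssn.
rewrite !step (pd_schwarz v u py nf) scalerBr.
exact: cancel_common.
Qed.

Lemma K_add p u v s t y : dom p y -> ssn y s -> ssn y t ->
  K p u v (fun z => s z + t z) y = K p u v s y + K p u v t y.
Proof.
move=> py ns nt.
have step a b : nabla p a (nabla p b (fun z => s z + t z)) y =
   nabla p a (nabla p b s) y + nabla p a (nabla p b t) y.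
  have [U [oU Uy sU tU]] := ssn2 ns nt.
  rewrite -(conn_add hD); try exact: nabla_ssn.
  apply: (nabla_local p a (openI oU (dom_open X p))); first by split.
    by move=> z [Uz pz]; rewrite -(conn_add hD)//; exists U.
  by apply: nabla_ssn => //; exact: ssn_add.
by rewrite /K !step opprD addrACA.
Qed.

Lemma K_local U p u v s t y : open U -> U y -> dom p y -> (forall z, U z -> s z = t z) ->
  ssn y s -> K p u v s y = K p u v t y.
Proof.
move=> oU Uy py st ns; have [V [oV Vy sV]] := ns.
have step a b : nabla p a (nabla p b s) y = nabla p a (nabla p b t) y.
  apply: (nabla_local p a (openI (openI oU oV) (dom_open X p))); first by split.
    move=> z [[Uz Vz] pz]; apply: (nabla_local p b oU Uz) => //; by exists V.
  exact: nabla_ssn.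
by rewrite /K !step.
Qed.

Lemma K_sum p u v (I : Type) (r : seq I) (F : I -> sec) y : dom p y -> (forall i, ssn y (F i)) ->
  K p u v (fun z => \sum_(i <- r) F i z) y = \sum_(i <- r) K p u v (F i) y.
Proof.
move=> py nF; elim: r => [|i r IH].
  have := @K_scale p u v (fun=> 0) (fun=> 0) y py (sfn_cst X y 0) (ssn_0 y).
  rewrite scale0r big_nil => <-; congr (K p u v _ y).
  by apply: functional_extensionality_dep => z; rewrite big_nil scale0r.
rewrite big_cons -IH -K_add//; last exact: ssn_sum.
by congr (K p u v _ y); apply: functional_extensionality_dep => z; rewrite big_cons.
Qed.

Lemma K_skew p u v s t y : dom p y -> ssn y s -> ssn y t ->
  ip (K p u v s y) (t y) + ip (s y) (K p u v t y) = 0.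
Proof.
move=> py ns nt; have nst := sfn_ip ns nt.
have step a b : pd X p a (pd X p b (fun z => ip (s z) (t z))) y =
   ip (nabla p a (nabla p b s) y) (t y) + ip (nabla p b s y) (nabla p a t y) +
   (ip (nabla p a s y) (nabla p b t y) + ip (s y) (nabla p a (nabla p b t) y)).
  have [U [oU Uy sU tU]] := ssn2 ns nt.
  rewrite (@pd_ext _ _ _ _ _ _ (U `&` dom p) _ (fun z => ip (nabla p b s z) (t z) + ip (s z) (nabla p b t z)))//.
  - rewrite pd_add//; try by apply: sfn_ip => //; exact: nabla_ssn.
    by rewrite !nabla_metric//; exact: nabla_ssn.
  - exact: openI oU (dom_open X p).
  - by move=> z [Uz pz]; rewrite nabla_metric//; exists U.
have := pd_schwarz u v py nst; rewrite !step /K (ipBl hE) (ipDr hE) (ipNr hE).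
by move=> h; apply/eqP; rewrite -subr_eq0 subr0; apply/eqP; move: h; lra.
Qed.

(** The commutator is linear over functions and skew, hence a bracket at each
    point. *)
Lemma K_tensor p u v y : dom p y ->
  exists F : fib E y, forall s, ssn y s -> K p u v s y = cross F (s y).
Proof.
move=> py; have [V [e [fe Vy]]] := lframe_cover hE y.
have ob := frame_on fe Vy; have hb := lframe_oframe hE fe Vy.
have nfe k : ssn y (fun y => e y k) by exact: (ssn_frame k fe Vy).
have [i j|F hF] := skew_cross hE (om := fun i => K p u v (fun z => e z i) y) hb.
  exact: (K_skew u v py (nfe i) (nfe j)).
exists F => s ns.
rewrite (@K_local V p u v s (fun z => \sum_j ip (s z) (e z j) *: e z j))//; last 2 first.
- exact: frame_open fe.
- by move=> z Vz; exact: (frame_expansion hE _ (frame_on fe Vz)).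
have ni j : sfn y (fun z => ip (s z) (e z j)) by exact: sfn_ip.
rewrite K_sum//; last by move=> j; exact: ssn_scale.
rewrite [in RHS](frame_expansion hE (s y) ob) (cross_sumr hE); apply: eq_bigr => j _.
by rewrite (crossZr hE) hF K_scale.
Qed.

Lemma nabla_selfE x w s : nabla x w s x = D x w s.
Proof. by rewrite /nabla cfield_self. Qed.

(** The curvature is chosen among the vectors with this property, and K_tensor
    provides one. *)
Lemma curv_spec y (w : 'I_2 -> T) s : ssn y s ->
  cross (curv X D y w) (s y) = K y (w 0) (w 1) s y.
Proof.
move=> ns; have [F hF] := K_tensor (w 0) (w 1) (dom_self X y).
have opE t : curv_op X D y (w 0) (w 1) t = K y (w 0) (w 1) t y.
  by rewrite /curv_op /K !nabla_selfE.
rewrite /curv; set A := [set f | _]; have : A (xget 0 A).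
  by apply: (@xgetPex _ 0 A); exists F => t nt; rewrite opE hF.
by move=> /(_ s ns) <-; rewrite opE.
Qed.

Lemma nabla_lin_self y u s z : ssn z s ->
  nabla y u s z = \sum_k u 0 k *: nabla y (dvec k) s z.
Proof.
by move=> nz; rewrite {1}(rV_basis u) /nabla cfield_sum conn_sumv.
Qed.

(** The commutator of covariant derivatives does not depend on the chart,
    because second derivatives of transition functions are symmetric. *)
Lemma K_chart p u v s y : dom p y -> ssn y s ->
  K p u v s y = K y (cfield X p u y) (cfield X p v y) s y.
Proof.
move=> py ns; have yy := dom_self X y; have [U [oU Uy sU]] := ns.
pose W := U `&` (dom p `&` dom y).
have oW : open W by apply: openI oU _; apply: openI; exact: dom_open.
have Wy : W y by [].
have nW z : W z -> ssn z s by move=> [Uz _]; exists U.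
pose c b k := pd X p b (xcoord X y k).
have nc b k : sfn y (c b k) by apply: sfn_pd => //; exact: sfn_coord.
have nn k : ssn y (nabla y (dvec k) s) by exact: nabla_ssn.
have step a b : nabla p a (nabla p b s) y =
  \sum_k pd X p a (c b k) y *: nabla y (dvec k) s y + nabla y (cfield X p a y) (nabla y (cfield X p b y) s) y.
  have -> : nabla p a (nabla p b s) y = nabla p a (fun z => \sum_k c b k z *: nabla y (dvec k) s z) y.
    apply: (nabla_local p a oW Wy); last exact: nabla_ssn.
    by move=> z Wz; have [_ [pz yz]] := Wz; rewrite (nabla_chain b pz yz)//; exact: nW.
  rewrite {1}/nabla conn_sum; last by move=> k; exact: ssn_scale.
  rewrite (eq_bigr (fun k => pd X p a (c b k) y *: nabla y (dvec k) s y + c b k y *: D y (cfield X p a y) (nabla y (dvec k) s))); last first.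
    by move=> k _; rewrite -[LHS]/(nabla p a _ y) nabla_leibniz.
  rewrite big_split /=; congr (_ + _).
  rewrite nabla_selfE.
  have -> : D y (cfield X p a y) (nabla y (cfield X p b y) s) = D y (cfield X p a y) (fun z => \sum_k c b k y *: nabla y (dvec k) s z).
    apply: (conn_local _ oW Wy); last exact: nabla_ssn.
    move=> z Wz; have [_ [pz yz]] := Wz; rewrite nabla_lin_self//; last exact: nW.
    by apply: eq_bigr => k _; rewrite cfieldE.
  rewrite conn_sum; last by move=> k; exact: ssn_cscale.
  by apply: eq_bigr => k _; rewrite conn_scale.
have Esym : \sum_k pd X p u (c v k) y *: nabla y (dvec k) s y = \sum_k pd X p v (c u k) y *: nabla y (dvec k) s y.
  apply: eq_bigr => k _; suff -> : pd X p u (c v k) y = pd X p v (c u k) y by [].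
  by apply: pd_schwarz => //; exact: sfn_coord.
rewrite /K.
have h1 := step u v.
have h2 := step v u.
rewrite Esym in h1.
rewrite h1 h2.
rewrite opprD addrACA.
rewrite subrr.
by rewrite add0r.
Qed.

Lemma curv_cfield p (w : 'I_2 -> T) y s : dom p y -> ssn y s ->
  cross (curv X D y (fun i => cfield X p (w i) y)) (s y) = K p (w 0) (w 1) s y.
Proof. by move=> py ns; rewrite curv_spec; [rewrite (K_chart (w 0) (w 1) py ns) | exact: ns]. Qed.

Lemma curv_unique y (f f' : fib E y) : (forall s, ssn y s -> cross f (s y) = cross f' (s y)) -> f = f'.
Proof.
move=> h; have [V [e [fe Vy]]] := lframe_cover hE y.
apply: (cross_inj hE (lframe_oframe hE fe Vy)) => i.
by apply: (h (fun y => e y i)); exact: ssn_frame fe Vy.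
Qed.

Lemma K_linl y a u u' v s : ssn y s ->
  K y (a *: u + u') v s y = a *: K y u v s y + K y u' v s y.
Proof.
move=> ns; have yy := dom_self X y; have [U [oU Uy sU]] := ns.
have nn b : ssn y (nabla y b s) by exact: nabla_ssn.
rewrite /K; have -> : nabla y v (nabla y (a *: u + u') s) y = a *: nabla y v (nabla y u s) y + nabla y v (nabla y u' s) y.
  rewrite -(conn_scale _ _ (nn u)) -(conn_add hD)//; last exact: ssn_cscale.
  apply: (nabla_local y v (openI oU (dom_open X y))) => //.
  by move=> z [Uz yz]; rewrite /nabla cfield_lin (conn_linv hD)//; exists U.
rewrite {1}/nabla cfield_lin (conn_linv hD)// scalerBr opprD addrACA //.
Qed.

Lemma K_anti y u v s : K y u v s y = - K y v u s y.
Proof. by rewrite /K opprB. Qed.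

Lemma K_linr y a u u' v s : ssn y s ->
  K y v (a *: u + u') s y = a *: K y v u s y + K y v u' s y.
Proof. by move=> ns; rewrite K_anti K_linl// opprD -scalerN -!K_anti. Qed.

Lemma curv_form : is_form X (curv X D).
Proof.
split.
- move=> x w i a u u'; apply: curv_unique => s ns.
  rewrite curv_spec// (crossDl hE) (crossZl hE) !curv_spec// /upd.
  have i01 : i = 0 \/ i = 1.
    by case: i => [[|[|//]] lt_i]; [left|right]; exact: val_inj.
  by case: i01 => ->; rewrite /= ?eqxx /=; [exact: K_linl | exact: K_linr].
- move=> x w i j ij wij; apply: curv_unique => s ns; rewrite curv_spec// (cross0l hE).
  have -> : w 0 = w 1.
    move: ij wij; have i01 (k : 'I_2) : k = 0 \/ k = 1.
      by case: k => [[|[|//]] lt_i]; [left|right]; exact: val_inj.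
    by case: (i01 i) (i01 j) => -> [] ->; rewrite ?eqxx.
  by rewrite /K subrr.
- move=> p w; apply: ss_local => x px; have [V [e [fe Vx]]] := lframe_cover hE x.
  exists V; split=> //; have oV := frame_open fe; have oW := openI (dom_open X p) oV.
  apply: (@ss_ext _ (fun y => 2^-1 *: \sum_i cross (e y i) (K p (w 0) (w 1) (fun z => e z i) y))) => //.
    move=> y [py Vy]; rewrite [RHS](cross_recover hE _ (lframe_oframe hE fe Vy)); congr (_ *: _).
    apply: eq_bigr => i _; congr cross; rewrite -(@curv_cfield p w y (fun z => e z i))//.
    exact: (ssn_frame i fe Vy).
  apply: ss_scale => //; first exact: sf_cst.
  apply: ss_sum => // i; have sei : ss (dom p `&` V) (fun z => e z i).
    by apply: ss_sub (frame_ss i fe) => y [].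
  apply: ss_cross => //.
  have nb a t : ss (dom p `&` V) t -> ss (dom p `&` V) (nabla p a t).
    move=> st; have := conn_smooth hD oW st p a; apply: ss_sub => y [py Vy]; by split.
  apply: (@ss_ext _ (fun y => nabla p (w 0) (nabla p (w 1) (fun z => e z i)) y + (-1) *: nabla p (w 1) (nabla p (w 0) (fun z => e z i)) y)) => //.
    by move=> y _; rewrite scaleN1r.
  apply: ss_add => //; first exact: (nb _ _ (nb _ _ sei)).
  by apply: ss_scale => //; [exact: sf_cst | exact: (nb _ _ (nb _ _ sei))].
Qed.

End Connection.
End Sections.

(** * Exterior covariant derivatives of two-forms *)

Lemma lift3E :
  (lift (0 : 'I_3) (0 : 'I_2) = 1 :> 'I_3) * (lift (0 : 'I_3) (1 : 'I_2) = 2%:R :> 'I_3) *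
  (lift (1 : 'I_3) (0 : 'I_2) = 0 :> 'I_3) * (lift (1 : 'I_3) (1 : 'I_2) = 2%:R :> 'I_3) *
  (lift (2%:R : 'I_3) (0 : 'I_2) = 0 :> 'I_3) * (lift (2%:R : 'I_3) (1 : 'I_2) = 1 :> 'I_3).
Proof. by do !split; apply: val_inj. Qed.

Lemma I2P (P : 'I_2 -> Prop) : P 0 -> P 1 -> forall i, P i.
Proof. by move=> P0 P1 [[|[|//]] lt_i]; [congr P: P0 | congr P: P1]; exact: val_inj. Qed.

(* Sealed, so that unification never unfolds derivatives in charts. *)
Local Opaque pd cfield nabla xcoord.

Section TwoForms.
Context (R : realType) (M : topologicalType) (X : oriented_riemannian4 R M).
Local Notation T := 'rV[R]_4.
Local Notation dom p := (cdom (chart_at X p)).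
Local Notation sf := (smooth_fun X).
Local Notation sfn := (smooth_fun_near X).
Context (E : bundle3 R M) (hE : oriented_euclidean3 X E).
Local Notation ss := (@smooth_sec R M X E).
Local Notation ssn := (@smooth_sec_near R M X E).
Local Notation sec := (forall y, fib E y).
Implicit Types (x y p q : M) (U V : set M) (s t : sec) (a b c u v : T).

Lemma fam2E (A : Type) (f : ('I_2 -> T) -> A) (v : 'I_2 -> T) : f v = f (fam 2 [:: v 0; v 1]).
Proof. by congr f; apply/funext; apply: I2P. Qed.

(** The derivative along u of the components, in the chart at y, of the
    coordinate field with components v of the chart at p. *)
Definition hess p y u v : T := \sum_k pd X p u (pd X p v (xcoord X y k)) y *: dvec k.

Lemma hess_sym p y u v : dom p y -> hess p y u v = hess p y v u.
Proof.
move=> py; apply: eq_bigr => k _.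
suff -> : pd X p u (pd X p v (xcoord X y k)) y = pd X p v (pd X p u (xcoord X y k)) y by [].
by apply: pd_schwarz => //; apply: sfn_coord; exact: dom_self.
Qed.

Section Form2.
Context (w : Form E 2) (hw : is_form X w).

Definition val2 y a b : fib E y := w y (fam 2 [:: a; b]).

Lemma val2E y (v : 'I_2 -> T) : w y v = val2 y (v 0) (v 1).
Proof. exact: fam2E. Qed.

Lemma val2_linl y r a a' b : val2 y (r *: a + a') b = r *: val2 y a b + val2 y a' b.
Proof.
have [h _ _] := hw; have := h y (fam 2 [:: a; b]) 0 r a a'.
by rewrite !val2E /upd /= /fam.
Qed.

Lemma val2_alt y a : val2 y a a = 0.
Proof. by have [_ h _] := hw; apply: (h y _ 0 1). Qed.

Lemma val2_linr y r a a' b : val2 y b (r *: a + a') = r *: val2 y b a + val2 y b a'.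
Proof.
have [h _ _] := hw; have := h y (fam 2 [:: b; a]) 1 r a a'.
by rewrite !val2E /upd /= /fam.
Qed.

Lemma val2_anti y a b : val2 y a b = - val2 y b a.
Proof.
have := val2_alt y (1 *: a + b); rewrite val2_linl !val2_linr !val2_alt !scale1r addr0 add0r.
by move/eqP; rewrite addr_eq0 => /eqP.
Qed.

Lemma val2_0l y b : val2 y 0 b = 0.
Proof.
have := val2_linl y 1 0 0 b; rewrite scale1r addr0 scale1r => h.
by apply: (addrI (val2 y 0 b)); rewrite addr0 -h.
Qed.

Lemma val2_suml y (I : Type) (r : seq I) (k : I -> R) (a : I -> T) b :
  val2 y (\sum_(i <- r) k i *: a i) b = \sum_(i <- r) k i *: val2 y (a i) b.
Proof.
elim: r => [|i r IH]; first by rewrite !big_nil val2_0l.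
by rewrite !big_cons val2_linl IH.
Qed.

Lemma val2_sumr y (I : Type) (r : seq I) (k : I -> R) (a : I -> T) b :
  val2 y b (\sum_(i <- r) k i *: a i) = \sum_(i <- r) k i *: val2 y b (a i).
Proof.
rewrite val2_anti val2_suml -sumrN; apply: eq_bigr => i _.
by rewrite -scalerN -val2_anti.
Qed.

(** The values of the form on coordinate fields. *)
Definition W p a b : sec := fun z => val2 z (cfield X p a z) (cfield X p b z).

Lemma W_ss p a b : ss (dom p) (W p a b).
Proof.
have [_ _ h] := hw; have := h p (fam 2 [:: a; b]); congr (ss _ _).
by apply: functional_extensionality_dep => z; rewrite val2E.
Qed.

Lemma W_ssn x p a b : dom p x -> ssn x (W p a b).
Proof. by move=> px; exists (dom p); split=> //; [exact: dom_open | exact: W_ss]. Qed.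

Lemma W_anti p a b z : W p a b z = - W p b a z.
Proof. exact: val2_anti. Qed.

Lemma val2_bilin y (k l : 'I_4 -> R) (a b : 'I_4 -> T) :
  val2 y (\sum_i k i *: a i) (\sum_j l j *: b j) = \sum_i \sum_j (k i * l j) *: val2 y (a i) (b j).
Proof.
rewrite val2_suml; apply: eq_bigr => i _; rewrite val2_sumr scaler_sumr.
by apply: eq_bigr => j _; rewrite scalerA.
Qed.

Lemma W_linl p r a a' b z : W p (r *: a + a') b z = r *: W p a b z + W p a' b z.
Proof. by rewrite /W cfield_lin val2_linl. Qed.

Section Derivative.
Context (D : Conn E) (hD : so3_connection X D).
Local Notation nabla := (nabla X D).

Definition dcov3 p a b c : sec := fun y =>
  nabla p a (W p b c) y - nabla p b (W p a c) y + nabla p c (W p a b) y.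

Lemma dcovE x (v : 'I_3 -> T) : dcov X D w x v = dcov3 x (v 0) (v 1) (v 2%:R) x.
Proof.
rewrite /dcov sum3 /dcov3 !nabla_selfE.
have s0 : (-1) ^+ (0%R : 'I_3) = 1 :> R by [].
have s1 : (-1) ^+ (1%R : 'I_3) = -1 :> R by exact: expr1.
have s2 : (-1) ^+ (2%:R%R : 'I_3) = 1 :> R by rewrite sqrrN expr1n.
rewrite s0 s1 s2.
rewrite !scale1r scaleN1r.
have e (j : 'I_3) : (fun y => w y (fun i : 'I_2 => cfield X x (v (lift j i)) y)) = W x (v (lift j (0 : 'I_2))) (v (lift j (1 : 'I_2))).
  by apply: functional_extensionality_dep => y; rewrite val2E.
by rewrite !e !lift3E.
Qed.

(** The coordinate fields of two charts differ by non-constant coefficients,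
    whose derivatives contribute the Hessian terms. *)
Lemma nabla_W_chart p a b c y : dom p y ->
  nabla p c (W p a b) y =
    val2 y (hess p y c a) (cfield X p b y)
  + val2 y (cfield X p a y) (hess p y c b)
  + nabla y (cfield X p c y) (W y (cfield X p a y) (cfield X p b y)) y.
Proof.
move=> py; have yy := dom_self X y.
pose f b k := pd X p b (xcoord X y k).
have nf d k : sfn y (f d k) by apply: sfn_pd => //; exact: sfn_coord.
have oW : open (dom p `&` dom y) by apply: openI; exact: dom_open.
have nW k l : ssn y (W y (dvec k) (dvec l)) by exact: W_ssn.
have fE d k : f d k y = cfield X p d y 0 k by rewrite cfieldE.
have WE z : dom p z -> dom y z -> W p a b z = \sum_k \sum_l (f a k z * f b l z) *: W y (dvec k) (dvec l) z.
  move=> pz yz; rewrite /W (cfield_chain a pz yz) val2_suml; apply: eq_bigr => k _.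
  rewrite (cfield_chain b pz yz) val2_sumr scaler_sumr; apply: eq_bigr => l _.
  by rewrite scalerA.
have -> : nabla p c (W p a b) y = nabla p c (fun z => \sum_k \sum_l (f a k z * f b l z) *: W y (dvec k) (dvec l) z) y.
  apply: (nabla_local hE hD p c oW); [by split | by move=> z [pz yz]; exact: WE | exact: W_ssn].
have WyE z : dom y z -> W y (cfield X p a y) (cfield X p b y) z = \sum_k \sum_l (f a k y * f b l y) *: W y (dvec k) (dvec l) z.
  move=> yz; rewrite /W {1}(rV_basis (cfield X p a y)) cfield_sum val2_suml; apply: eq_bigr => k _.
  rewrite {1}(rV_basis (cfield X p b y)) cfield_sum val2_sumr scaler_sumr; apply: eq_bigr => l _.
  by rewrite scalerA !fE.
have -> : nabla y (cfield X p c y) (W y (cfield X p a y) (cfield X p b y)) y =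
   \sum_k \sum_l (f a k y * f b l y) *: nabla p c (W y (dvec k) (dvec l)) y.
  rewrite nabla_selfE -nablaE.
  have -> : nabla p c (W y (cfield X p a y) (cfield X p b y)) y = nabla p c (fun z => \sum_k \sum_l (f a k y * f b l y) *: W y (dvec k) (dvec l) z) y.
    by apply: (nabla_local hE hD p c (dom_open X y)); first [exact: W_ssn | exact: yy | move=> z; exact: WyE].
  rewrite {1}nablaE (conn_sum hE hD); last by move=> k; apply: ssn_sum => // l; exact: ssn_cscale.
  apply: eq_bigr => k _; rewrite (conn_sum hE hD); last by move=> l; exact: ssn_cscale.
  by apply: eq_bigr => l _; rewrite (conn_scale hD).
rewrite {1}nablaE (conn_sum hE hD); last first.
  by move=> k; apply: (ssn_sum hE) => l; exact: (ssn_scale hE (sfn_mul (nf a k) (nf b l)) (nW k l)).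
have mW k l : ssn y (fun z => (f a k z * f b l z) *: W y (dvec k) (dvec l) z).
  by exact: (ssn_scale hE (sfn_mul (nf a k) (nf b l)) (nW k l)).
have Wkl k l : W y (dvec k) (dvec l) y = val2 y (dvec k) (dvec l) by rewrite /W !cfield_self.
have cE d : cfield X p d y = \sum_k f d k y *: dvec k.
  by rewrite {1}(rV_basis (cfield X p d y)); apply: eq_bigr => k _; rewrite fE.
rewrite (cE a) (cE b) [X in X + _ + _]val2_bilin [X in _ + X + _]val2_bilin.
rewrite -!big_split /=; apply: eq_bigr => k _.
rewrite (conn_sum hE hD _ _ (mW k)) -!big_split /=; apply: eq_bigr => l _.
have L := nabla_leibniz hD c py (sfn_mul (nf a k) (nf b l)) (nW k l).
by rewrite -nablaE L (pd_mul c py (nf a k) (nf b l)) Wkl scalerDl.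
Qed.

(** The Hessian terms cancel in the alternating sum, since the Hessian is
    symmetric and the form is not. Thus dcov, which is computed at each point in
    its own chart, can be computed near a point in a single chart. *)
Lemma dcov3_chart p a b c y : dom p y ->
  dcov3 p a b c y = dcov3 y (cfield X p a y) (cfield X p b y) (cfield X p c y) y.
Proof.
move=> py; rewrite /dcov3 (nabla_W_chart b c a py) (nabla_W_chart a c b py) (nabla_W_chart a b c py).
rewrite (hess_sym b a py) (hess_sym c a py) (hess_sym c b py).
move: (hess p y a b) (hess p y a c) (hess p y b c) => H1 H2 H3.
move: (cfield X p a y) (cfield X p b y) (cfield X p c y) => a' b' c'.
rewrite (val2_anti y H2 b').
move: (val2 y H1 c') (val2 y b' H2) (val2 y a' H3) => a1 a2 a3.
move: (nabla y a' _ y) (nabla y b' _ y) (nabla y c' _ y) => b1 b2 b3.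
by apply: (fib_inj hE) => i; rewrite !(ipE hE y); ring.
Qed.

Lemma dcov3_swap12 x a b c : dcov3 x a b c x = - dcov3 x b a c x.
Proof.
rewrite /dcov3.
have -> : nabla x c (W x a b) x = - nabla x c (W x b a) x.
  rewrite !nablaE -(conn_opp hD _ (W_ssn _ _ (dom_self X x))).
  by congr (D _ _ _); apply: functional_extensionality_dep => z; exact: W_anti.
by apply: (fib_inj hE) => i; rewrite !(ipE hE x); ring.
Qed.

Lemma dcov3_swap23 x a b c : dcov3 x a b c x = - dcov3 x a c b x.
Proof.
rewrite /dcov3.
have -> : nabla x a (W x b c) x = - nabla x a (W x c b) x.
  rewrite !nablaE -(conn_opp hD _ (W_ssn _ _ (dom_self X x))).
  by congr (D _ _ _); apply: functional_extensionality_dep => z; exact: W_anti.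
by apply: (fib_inj hE) => i; rewrite !(ipE hE x); ring.
Qed.

Lemma dcov3_lin x r a a' b c : dcov3 x (r *: a + a') b c x = r *: dcov3 x a b c x + dcov3 x a' b c x.
Proof.
have nW u v : ssn x (W x u v) by exact: (W_ssn _ _ (dom_self X x)).
have h u v : nabla x u (W x (r *: a + a') v) x = r *: nabla x u (W x a v) x + nabla x u (W x a' v) x.
  rewrite !nablaE -(conn_scale hD _ _ (nW _ _)) -(conn_add hD _ (ssn_cscale hE _ (nW _ _)) (nW _ _)).
  by congr (D _ _ _); apply: functional_extensionality_dep => z; exact: W_linl.
rewrite /dcov3 !h !nablaE cfield_lin (conn_linv hD _ _ _ (nW _ _)).
by apply: (fib_inj hE) => i; rewrite !(ipE hE x); ring.
Qed.

Lemma dcov3_eq12 x a c : dcov3 x a a c x = 0.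
Proof.
apply: (fib_inj hE) => i; have := congr1 (fun z => ip z (onb E x i)) (dcov3_swap12 x a a c).
by rewrite !(ipE hE x) => h; lra.
Qed.

Lemma dcov3_cycle x a b c : dcov3 x a b c x = dcov3 x c a b x.
Proof. by rewrite dcov3_swap23 dcov3_swap12 opprK. Qed.

Lemma dcov_form : is_form X (dcov X D w).
Proof.
split.
- move=> x v i r u u'; rewrite !dcovE; move: i; apply: I3P; rewrite /upd ?eqxx ?z3eq.
  + exact: dcov3_lin.
  + rewrite (dcov3_swap12 x (v 0)) dcov3_lin opprD -scalerN; congr (_ *: _ + _); exact/esym/dcov3_swap12.
  + rewrite dcov3_cycle dcov3_lin; congr (_ *: _ + _); exact/esym/dcov3_cycle.
- move=> x v; apply: I3P; apply: I3P => // _ E1; rewrite dcovE.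
  + by rewrite E1 dcov3_eq12.
  + by rewrite E1 dcov3_swap23 dcov3_eq12 oppr0.
  + by rewrite E1 dcov3_eq12.
  + by rewrite E1 dcov3_swap12 dcov3_swap23 dcov3_eq12 !oppr0.
  + by rewrite E1 dcov3_swap23 dcov3_eq12 oppr0.
  + by rewrite E1 dcov3_swap12 dcov3_swap23 dcov3_eq12 !oppr0.
- move=> p u; have op := dom_open X p.
  apply: (@ss_ext _ _ _ _ hE _ (dcov3 p (u 0) (u 1) (u 2%:R))) => //.
    by move=> y py; rewrite dcovE dcov3_chart.
  have nb a b c : ss (dom p) (nabla p a (W p b c)).
    have := conn_smooth hD op (W_ss p b c) p a; apply: ss_sub => y py; by split.
  apply: (ss_add hE op) => //; apply: (@ss_ext _ _ _ _ hE _ (fun y => nabla p (u 0) (W p (u 1) (u 2%:R)) y + (-1) *: nabla p (u 1) (W p (u 0) (u 2%:R)) y)) => //.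
    by move=> y _; rewrite scaleN1r.
  by apply: (ss_add hE op) => //; apply: (ss_scale hE op) => //; exact: sf_cst.
Qed.

End Derivative.
End Form2.

Section Bianchi.
Context (D : Conn E) (hD : so3_connection X D).

(** The second Bianchi identity is the Jacobi identity for the commutators of
    the operators nabla. *)
Lemma bianchi x (v : 'I_3 -> T) : dcov X D (curv X D) x v = 0.
Proof.
have hF := curv_form hE hD; have xx := dom_self X x.
rewrite dcovE; apply: (curv_unique hE (X := X)) => s ns; rewrite (cross0l hE).
move: (v 0) (v 1) (v 2%:R) => a b c.
pose N a b c := nabla X D x a (nabla X D x b (nabla X D x c s)) x.
have key u b' c' : cross (nabla X D x u (W (curv X D) x b' c') x) (s x) =
    N u b' c' - N u c' b' - (N b' c' u - N c' b' u).
  have nW : ssn x (W (curv X D) x b' c') by exact: (W_ssn hF _ _ xx).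
  have [U [oU Ux sU]] := ns.
  have WE z t : dom x z -> ssn z t -> cross (W (curv X D) x b' c' z) (t z) = K X D x b' c' t z.
    move=> xz nt; have -> : W (curv X D) x b' c' z = curv X D z (fun i => cfield X x (fam 2 [:: b'; c'] i) z).
      by rewrite [RHS]val2E.
    exact: (curv_cfield hE hD (fam 2 [:: b'; c']) xz nt).
  have -> : cross (nabla X D x u (W (curv X D) x b' c') x) (s x) =
    nabla X D x u (fun z => cross (W (curv X D) x b' c' z) (s z)) x - cross (W (curv X D) x b' c' x) (nabla X D x u s x).
    by rewrite (nabla_cross hE hD)// addrK.
  rewrite WE//; last exact: nabla_ssn.
  congr (_ - _).
  have -> : nabla X D x u (fun z => cross (W (curv X D) x b' c' z) (s z)) x = nabla X D x u (K X D x b' c' s) x.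
    apply: (nabla_local hE hD x u (openI oU (dom_open X x))); first by split.
      by move=> z [Uz xz]; apply: WE => //; exists U.
    exact: ssn_cross.
  rewrite {1}nablaE /K (conn_sub hE hD)//; by do 2!apply: nabla_ssn => //.
rewrite /dcov3 (crossDl hE) (crossDl hE) (crossNl hE) !key.
by apply: (fib_inj hE) => i; rewrite !(ipE hE x); ring.
Qed.
End Bianchi.

End TwoForms.

(** * Change of connection and transport by isometries *)

Lemma sum_lift_perm (V : nmodType) n (i j : 'I_n.+1) (G : 'S_n.+1 -> V) :
  \sum_(s : 'S_n.+1 | s i == j) G s = \sum_(s : 'S_n) G (lift_perm i j s).
Proof.
rewrite (reindex (lift_perm i j)); last first.
  pose ulsf i (s : 'S_n.+1) k := odflt k (unlift (s i) (s (lift i k))).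
  have ulsfK i' (s : 'S_n.+1) k : lift (s i') (ulsf i' s k) = s (lift i' k).
    rewrite /ulsf; have := neq_lift i' k.
    by rewrite -(can_eq (permK s)) => /unlift_some[] ? ? ->.
  have inj_ulsf : injective (ulsf i _).
    move=> s; apply: can_inj (ulsf (s i) s^-1%g) _ => k'.
    by rewrite {1}/ulsf ulsfK !permK liftK.
  exists (fun s => perm (inj_ulsf s)) => [s _ | s].
    by apply/permP => k'; rewrite permE /ulsf lift_perm_lift lift_perm_id liftK.
  move/(s _ =P _) => si0; apply/permP => k.
  case: (unliftP i k) => [k'|] ->; rewrite ?lift_perm_id //.
  by rewrite lift_perm_lift -si0 permE ulsfK.
by apply: eq_bigl => s; rewrite lift_perm_id eqxx.
Qed.

Lemma sum_S3 (R : pzRingType) (V : lmodType R) (G : 'I_3 -> 'I_3 -> 'I_3 -> V) :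
  \sum_(s : 'S_3) ((-1) ^+ s : R) *: G (s 0) (s 1) (s 2%:R) =
  \sum_(j < 3) ((-1) ^+ j : R) *: (G j (lift j 0) (lift j 1) - G j (lift j 1) (lift j 0)).
Proof.
rewrite (partition_big (fun s : 'S_3 => s 0) predT)//=; apply: eq_bigr => j _.
rewrite sum_lift_perm (partition_big (fun s : 'S_2 => s 0) predT)//=.
have sum2 (F : 'I_2 -> V) : \sum_i F i = F 0 + F 1.
  by rewrite !big_ord_recl big_ord0 addr0; congr (F _ + F _); exact: val_inj.
have one k (F : 'S_2 -> V) : \sum_(s : 'S_2 | s 0 == k) F s = F (lift_perm 0 k 1%g).
  rewrite sum_lift_perm (big_pred1 1%g) => // s /=; apply/esym/eqP/permP => i.
  by rewrite !ord1.
have e1 (k : 'I_3) (s : 'S_2) : lift_perm 0 k s 1 = lift k (s 0).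
  by rewrite (_ : 1 = lift 0 (0 : 'I_2)) ?lift_perm_lift//; exact: val_inj.
have e2 (k : 'I_3) (s : 'S_2) : lift_perm 0 k s 2%:R = lift k (s 1).
  by rewrite (_ : 2%:R = lift 0 (1 : 'I_2)) ?lift_perm_lift//; exact: val_inj.
have e3 (k : 'I_2) : lift_perm 0 k (1%g : 'S_1) 1 = lift k 0.
  by rewrite (_ : 1 = lift 0 (0 : 'I_1)) ?lift_perm_lift ?perm1//; exact: val_inj.
rewrite sum2 !one !odd_lift_perm !lift_perm_id !e1 !e2 !lift_perm_id !e3 !odd_perm1 /=.
rewrite (_ : lift (0 : 'I_2) (0 : 'I_1) = 1); last exact: val_inj.
rewrite (_ : lift (1 : 'I_2) (0 : 'I_1) = 0); last exact: val_inj.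
rewrite scalerBr addbF /= -[in RHS]signr_odd -scaleNr.
by case: (odd j); rewrite /= ?expr0 ?expr1 ?opprK.
Qed.

Section Forms.
Context (R : realType) (M : topologicalType) (X : oriented_riemannian4 R M).
Local Notation T := 'rV[R]_4.
Local Notation dom p := (cdom (chart_at X p)).
Local Notation sf := (smooth_fun X).
Local Notation sfn := (smooth_fun_near X).
Context (E : bundle3 R M) (hE : oriented_euclidean3 X E).
Local Notation ss := (@smooth_sec R M X E).
Local Notation ssn := (@smooth_sec_near R M X E).
Local Notation sec := (forall y, fib E y).
Implicit Types (x y p q : M) (U V : set M) (s t : sec) (u : T).

Definition val1 (a : Form E 1) x u : fib E x := a x (fun=> u).

Lemma val1E (a : Form E 1) x v : a x v = val1 a x (v 0).
Proof. by congr (a x _); apply/funext => i; rewrite ord1. Qed.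

Lemma val1_lin (a : Form E 1) x r u u' : is_form X a ->
  val1 a x (r *: u + u') = r *: val1 a x u + val1 a x u'.
Proof.
by move=> [h _ _]; have := h x (fun=> 0) 0 r u u'; rewrite !val1E /upd eqxx.
Qed.

(** The six permutations are grouped by the argument given to a; the two in
    each group contribute equally, which cancels the factor 1! 2!. *)
Lemma wedge_bracket12 (a : Form E 1) (w : Form E 2) x (v : 'I_3 -> T) : is_form X w ->
  wedge_bracket a w x v = \sum_(j < 3) ((-1) ^+ j : R) *:
    cross (val1 a x (v j)) (val2 w x (v (lift j 0)) (v (lift j 1))).
Proof.
move=> hw; rewrite /wedge_bracket.
pose G (i j k : 'I_3) := cross (val1 a x (v i)) (val2 w x (v j) (v k)).
rewrite (eq_bigr (fun s : 'S_3 => ((-1) ^+ s : R) *: G (s 0) (s 1) (s 2%:R))); last first.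
  move=> s _; rewrite /G val1E val2E; congr (_ *: cross (val1 a x (v (s _))) (val2 w x (v (s _)) (v (s _)))); exact: val_inj.
rewrite sum_S3 scaler_sumr; apply: eq_bigr => j _.
rewrite /G (val2_anti hw x (v (lift j 1))) (crossNr hE) opprK scalerA mulrC -scalerA; congr (_ *: _).
rewrite -[X in X + _]scale1r -[X in _ + X]scale1r -scalerDl scalerA.
have k2 : ((1`! * 2`!)%N%:R : R)^-1 * (1 + 1) = 1 by rewrite (_ : (1`! * 2`!)%N = 2%N)//; field.
by rewrite k2 scale1r.
Qed.

Lemma dcov_plus (D : Conn E) (a : Form E 1) (w : Form E 2) x v : is_form X w ->
  dcov X (conn_plus D a) w x v = dcov X D w x v + wedge_bracket a w x v.
Proof.
move=> hw; rewrite wedge_bracket12// /dcov -big_split /=; apply: eq_bigr => j _.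
rewrite -scalerDr; congr (_ *: (_ + cross _ _)).
by rewrite val2E !cfield_self.
Qed.

Lemma conn_plus_so3 (D : Conn E) (a : Form E 1) : so3_connection X D -> is_form X a ->
  so3_connection X (conn_plus D a).
Proof.
move=> hD ha; split.
- move=> x r u v s ns; rewrite /conn_plus (conn_linv hD)// -/(val1 a x _) val1_lin//.
  by rewrite (crossDl hE) (crossZl hE) scalerDr addrACA.
- by move=> x v s t ns nt; rewrite /conn_plus (conn_add hD)// (crossDr hE) addrACA.
- move=> x v f s nf ns; rewrite /conn_plus (conn_leibniz hD)// (crossZr hE) scalerDr.
  by rewrite addrA.
- move=> U s oU sU p u; have oW := openI oU (dom_open X p).
  apply: (ss_add hE oW); first exact: (conn_smooth hD).
  apply: (ss_cross hE oW); last by apply: ss_sub sU => y [].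
  by have [_ _ /(_ p (fun=> u))] := ha; apply: ss_sub => y [].
- move=> x v s t ns nt; rewrite (conn_metric hD)// /conn_plus (ipDl hE) (ipDr hE).
  by rewrite (ip_cross_skew hE) addrACA addNr addr0.
Qed.

(** In a frame, both connections are the derivative of the components plus a
    bracket, so that their difference is a bracket; cross_recover shows that it
    depends smoothly on the point. *)
Lemma conn_difference (D D' : Conn E) : so3_connection X D -> so3_connection X D' ->
  exists2 a, is_form X a & same_conn X D' (conn_plus D a).
Proof.
move=> hD hD'.
have ex x u : exists f : fib E x, forall s, ssn x s -> D' x u s - D x u s = cross f (s x).
  have xx := dom_self X x; have [V [e [fe Vx]]] := lframe_cover hE x.
  have [f hf] := nabla_rep hE hD u xx fe Vx; have [f' hf'] := nabla_rep hE hD' u xx fe Vx.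
  exists (f' - f) => s ns; apply: (frame_inj hE (frame_on hE fe Vx)) => i.
  have := hf s ns i; have := hf' s ns i; rewrite !nabla_selfE => h' h.
  by rewrite (ipBl hE) h h' (crossDl hE) (crossNl hE) (ipBl hE); ring.
pose c x u := proj1_sig (cid (ex x u)).
have cP x u s : ssn x s -> D' x u s - D x u s = cross (c x u) (s x).
  by move=> ns; rewrite /c; case: cid => f /= ->.
exists (fun x v => c x (v 0)).
  split.
  - move=> x v i r u u'; rewrite /upd !ord1 !eqxx; apply: (curv_unique hE (X := X)) => s ns.
    rewrite (crossDl hE) (crossZl hE) -!cP// (conn_linv hD)// (conn_linv hD')//.
    by rewrite scalerBr opprD addrACA.
  - by move=> x v i j; rewrite !ord1 eqxx.
  - move=> p u; apply: ss_local => x px; have [V [e [fe Vx]]] := lframe_cover hE x.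
    exists V; split=> //; have oV := frame_open hE fe; have oW := openI (dom_open X p) oV.
    have sei i : ss (dom p `&` V) (fun z => e z i).
      by apply: ss_sub (frame_ss hE i fe) => y [].
    apply: (@ss_ext _ _ _ _ hE _ (fun y => 2^-1 *: \sum_i cross (e y i) (D' y (cfield X p (u 0) y) (fun z => e z i) + (-1) *: D y (cfield X p (u 0) y) (fun z => e z i)))) => //.
      move=> y [py Vy]; rewrite [RHS](cross_recover hE _ (lframe_oframe hE fe Vy)); congr (_ *: _).
      apply: eq_bigr => i _; rewrite -(cP y _ (fun z => e z i)) ?scaleN1r//.
      exact: (ssn_frame hE i fe Vy).
    apply: (ss_scale hE oW); first exact: sf_cst.
    apply: ss_sum => // i; apply: (ss_cross hE oW) => //; apply: (ss_add hE oW).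
      by have := conn_smooth hD' oW (sei i) p (u 0); apply: ss_sub => y [py Vy]; split.
    apply: (ss_scale hE oW); first exact: sf_cst.
    by have := conn_smooth hD oW (sei i) p (u 0); apply: ss_sub => y [py Vy]; split.
by move=> x v s ns; rewrite /conn_plus -cP// addrC subrK.
Qed.

Lemma same_conn_curv (D D' : Conn E) : so3_connection X D -> so3_connection X D' ->
  same_conn X D D' -> curv X D = curv X D'.
Proof.
move=> hD hD' DD; apply: functional_extensionality_dep => x; apply/funext => v.
apply: (curv_unique hE (X := X)) => s ns; rewrite !curv_spec// /K.
have xx := dom_self X x; have [U [oU Ux sU]] := ns.
have step a b : nabla X D x a (nabla X D x b s) x = nabla X D' x a (nabla X D' x b s) x.
  rewrite !nabla_selfE DD; last exact: nabla_ssn.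
  apply: (conn_local hE hD' _ (openI oU (dom_open X x))); first by split.
    by move=> z [Uz xz]; rewrite !nablaE DD//; exists U.
  exact: nabla_ssn.
by rewrite !step.
Qed.

Lemma same_conn_dcov (D D' : Conn E) (w : Form E 2) : is_form X w -> 
  same_conn X D D' -> dcov X D w = dcov X D' w.
Proof.
move=> hw DD; apply: functional_extensionality_dep => x; apply/funext => v.
apply: eq_bigr => j _; congr (_ *: _); apply: DD.
have [_ _ /(_ x (fun i => v (lift j i)))] := hw => sw.
by exists (dom x); split=> //; [exact: dom_open | exact: dom_self].
Qed.

Lemma dcov_lin (D : Conn E) (w w' : Form E 2) (r r' : R) x v : so3_connection X D ->
  is_form X w -> is_form X w' ->
  dcov X D (fun x v => r *: w x v + r' *: w' x v) x v = r *: dcov X D w x v + r' *: dcov X D w' x v.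
Proof.
move=> hD hw hw'; rewrite /dcov !scaler_sumr -big_split /=; apply: eq_bigr => j _.
have nn (z : Form E 2) : is_form X z -> ssn x (fun y => z y (fun i => cfield X x (v (lift j i)) y)).
  move=> [_ _ /(_ x (fun i => v (lift j i)))] sw.
  by exists (dom x); split=> //; [exact: dom_open | exact: dom_self].
rewrite (conn_add hD); try by apply: ssn_cscale => //; exact: nn.
rewrite (conn_scale hD _ _ (nn w hw)) (conn_scale hD _ _ (nn w' hw')).
by rewrite scalerDr !scalerA ![_ * (-1) ^+ _]mulrC.
Qed.

End Forms.

Section Hom.
Context (R : realType) (M : topologicalType) (X : oriented_riemannian4 R M).
Context (E F : bundle3 R M) (hE : oriented_euclidean3 X E) (hF : oriented_euclidean3 X F).
Context (f : forall x, 'Hom(fib E x, fib F x)) (hf : smooth_hom X f).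

Lemma hom_ss (U : set M) (s : forall y, fib E y) : open U -> smooth_sec X U s -> smooth_sec X U (fun y => f y (s y)).
Proof.
move=> oU sU V' e' fe' j; apply: sf_local => x [Ux V'x].
have [V [e [fe Vx]]] := lframe_cover hE x; exists V; split=> //.
have oW := openI (openI oU (frame_open hF fe')) (frame_open hE fe).
apply: (@sf_ext _ _ _ _ (fun y => \sum_i ip (s y) (e y i) * ip (f y (e y i)) (e' y j))) => //.
  move=> y [[Uy V'y] Vy]; rewrite [in RHS](frame_expansion hE (s y) (frame_on hE fe Vy)).
  by rewrite linear_sum (ip_suml hF); apply: eq_bigr => i _; rewrite linearZ (ipZl hF).
apply: sf_sum => // i _; apply: sf_mul => //.
  by apply: sf_sub (sU V e fe i) => y [[? ?] ?].
by apply: sf_sub (hf fe fe' i j) => y [[? ?] ?].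
Qed.

End Hom.

Section Push.
Context (R : realType) (M : topologicalType) (X : oriented_riemannian4 R M).
Local Notation T := 'rV[R]_4.
Local Notation dom p := (cdom (chart_at X p)).
Context (E F : bundle3 R M) (hE : oriented_euclidean3 X E) (hF : oriented_euclidean3 X F).
Context (f : forall x, 'Hom(fib E x, fib F x)) (hf : orientation_preserving_isometry X f).
Implicit Types (x y p q : M) (U V : set M).

Lemma iso_ip x (u v : fib E x) : ip (f x u) (f x v) = ip u v.
Proof. by have [_ h _] := hf. Qed.

Lemma bij_lfunK x (h : 'Hom(fib E x, fib F x)) : bijective h -> cancel h (h^-1)%VF.
Proof.
move=> bh; apply: lker0_lfunK; apply/lker0P; exact: bij_inj.
Qed.

Lemma bij_lfunVK x (h : 'Hom(fib E x, fib F x)) : bijective h -> cancel (h^-1)%VF h.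
Proof.
move=> bh v; have [g hg gh] := bh; apply: limg_lfunVK.
by rewrite -[v]gh memv_img// memvf.
Qed.

Lemma isoK x : cancel (f x) ((f x)^-1)%VF.
Proof. by have [_ _ /(_ x)[bf _]] := hf; exact: bij_lfunK. Qed.

Lemma isoVK x : cancel ((f x)^-1)%VF (f x).
Proof. by have [_ _ /(_ x)[bf _]] := hf; exact: bij_lfunVK. Qed.

Lemma iso_oframe x : oframe (fun i => f x (onb E x i)).
Proof.
split=> [i j|]; first by rewrite iso_ip (onb_on hE).
have [_ _ /(_ x)[_ dp]] := hf; rewrite -det_tr.
by rewrite (_ : _^T = \matrix_(i, j) ip (f x (onb E x i)) (onb F x j))//; apply/matrixP => i j; rewrite !mxE (ip_sym hF).
Qed.

(** An isometry which preserves the orientation preserves the cross product, and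
    with it everything which is defined from sections and brackets. *)
Lemma iso_cross x (u v : fib E x) : f x (cross u v) = cross (f x u) (f x v).
Proof.
have hb := iso_oframe x; have [ob _] := hb; apply: (frame_inj hF ob) => i.
by rewrite (cross_frame hF _ _ _ hb) !iso_ip (cross_onb hE).
Qed.

Lemma iso_ss U (s : forall y, fib E y) : open U -> smooth_sec X U s -> smooth_sec X U (fun y => f y (s y)).
Proof. by have [h _ _] := hf; exact: (hom_ss hE hF h). Qed.

Lemma isoV_ss U (s : forall y, fib F y) : open U -> smooth_sec X U s ->
  smooth_sec X U (fun y => (f y)^-1%VF (s y)).
Proof.
move=> oU sU V e fe i; have oUV := openI oU (frame_open hE fe).
have h : smooth_sec X V (fun y => f y (e y i)).
  by apply: iso_ss; [exact: (frame_open hE fe) | exact: (frame_ss hE i fe)].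
apply: (@sf_ext _ _ _ _ (fun y => ip (s y) (f y (e y i)))) => //.
  by move=> y _; rewrite -[s y]isoVK iso_ip isoK.
apply: (sf_ip hF oUV); first by apply: ss_sub sU => y [].
by apply: ss_sub h => y [].
Qed.

Lemma isoV_ssn x (s : forall y, fib F y) : smooth_sec_near X x s ->
  smooth_sec_near X x (fun y => (f y)^-1%VF (s y)).
Proof. by move=> [U [oU Ux sU]]; exists U; split=> //; exact: isoV_ss. Qed.

Context (D : Conn E) (hD : so3_connection X D).

Lemma push_so3 : so3_connection X (push_conn f D).
Proof.
have add (s t : forall y, fib F y) : (fun y => (f y)^-1%VF (s y + t y)) = (fun y => (f y)^-1%VF (s y) + (f y)^-1%VF (t y)).
  by apply: functional_extensionality_dep => y; rewrite linearD.
split.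
- by move=> x r u v s ns; rewrite /push_conn (conn_linv hD) ?linearP//; exact: isoV_ssn.
- move=> x v s t ns nt; rewrite /push_conn add (conn_add hD) ?linearD//; exact: isoV_ssn.
- move=> x v h s nh ns; rewrite /push_conn.
  have -> : (fun y => (f y)^-1%VF (h y *: s y)) = (fun y => h y *: (f y)^-1%VF (s y)).
    by apply: functional_extensionality_dep => y; rewrite linearZ.
  rewrite (conn_leibniz hD)//; last exact: isoV_ssn.
  by rewrite linearD !linearZ /= isoVK.
- move=> U s oU sU p u; have oW := openI oU (dom_open X p).
  by apply: iso_ss => //; apply: (conn_smooth hD) => //; exact: isoV_ss.
- move=> x v s t ns nt; rewrite /push_conn.
  have ipV y a b : ip (f y a) b = ip a ((f y)^-1%VF b) by rewrite -iso_ip isoVK.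
  have ipV' y a b : ip b (f y a) = ip ((f y)^-1%VF b) a by rewrite -iso_ip isoVK.
  rewrite ipV ipV' -(conn_metric hD); try exact: isoV_ssn.
  by congr (dfun X _ x v); apply/funext => y; rewrite -iso_ip !isoVK.
Qed.

Lemma push_curv x v : curv X (push_conn f D) x v = f x (curv X D x v).
Proof.
apply: (curv_unique hF (X := X)) => s ns.
rewrite (curv_spec hF push_so3)// -[s x in RHS](isoVK (s x)) -iso_cross.
have h : cross (curv X D x v) ((f x)^-1%VF (s x)) = _ := curv_spec hE hD v (isoV_ssn ns).
rewrite h.
have step a b : nabla X (push_conn f D) x a (nabla X (push_conn f D) x b s) x =
   f x (nabla X D x a (nabla X D x b (fun y => (f y)^-1%VF (s y))) x).
  rewrite !nabla_selfE /push_conn; congr (f x (D _ _ _)).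
  by apply: functional_extensionality_dep => y; rewrite !nablaE /push_conn isoK.
by rewrite /K !step linearB.
Qed.

Lemma push_dcov (w : Form E 2) x v :
  dcov X (push_conn f D) (fun x v => f x (w x v)) x v = f x (dcov X D w x v).
Proof.
rewrite /dcov linear_sum; apply: eq_bigr => j _; rewrite linearZ /=; congr (_ *: _).
rewrite /push_conn; congr (f x (D _ _ _)).
by apply: functional_extensionality_dep => y; rewrite isoK.
Qed.

Lemma push_hodge (w : Form E 2) : hodge X (fun x v => f x (w x v)) = (fun x v => f x (hodge X w x v)).
Proof.
apply: functional_extensionality_dep => x; apply/funext => v; rewrite /hodge linear_sum.
apply: eq_bigr => i _; rewrite linear_sum; apply: eq_bigr => j _; by rewrite linearZ.
Qed.

Lemma push_yang_mills : yang_mills X D -> yang_mills X (push_conn f D).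
Proof.
move=> [_ ym]; split; first exact: push_so3.
have -> : curv X (push_conn f D) = (fun x v => f x (curv X D x v)).
  by apply: functional_extensionality_dep => x; apply/funext => v; exact: push_curv.
by move=> x v; rewrite push_hodge push_dcov ym linear0.
Qed.

End Push.

(** * The bundle of self-dual two-forms *)

Lemma I4P (P : 'I_4 -> Prop) : P 0 -> P 1 -> P 2%:R -> P 3%:R -> forall i, P i.
Proof.
move=> P0 P1 P2 P3 [[|[|[|[|//]]]] lt_i];
  [congr P: P0 | congr P: P1 | congr P: P2 | congr P: P3]; exact: val_inj.
Qed.

Lemma sum4 (V : nmodType) (F : 'I_4 -> V) : \sum_i F i = F 0 + F 1 + F 2%:R + F 3%:R.
Proof.
rewrite !big_ord_recl big_ord0 addr0 !addrA; congr (F _ + F _ + F _ + F _); exact: val_inj.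
Qed.

Section Hat.
Context (R : realType).
Local Notation T := 'rV[R]_4.

Definition table (r : seq (seq R)) : 'M[R]_4 := \matrix_(i, j) (nth [::] r i)`_j.

Lemma tableE r :
  (table r 0 0 = (nth [::] r 0)`_0) * (table r 0 1 = (nth [::] r 0)`_1) * (table r 0 2%:R = (nth [::] r 0)`_2) * (table r 0 3%:R = (nth [::] r 0)`_3) *
  (table r 1 0 = (nth [::] r 1)`_0) * (table r 1 1 = (nth [::] r 1)`_1) * (table r 1 2%:R = (nth [::] r 1)`_2) * (table r 1 3%:R = (nth [::] r 1)`_3) *
  (table r 2%:R 0 = (nth [::] r 2)`_0) * (table r 2%:R 1 = (nth [::] r 2)`_1) * (table r 2%:R 2%:R = (nth [::] r 2)`_2) * (table r 2%:R 3%:R = (nth [::] r 2)`_3) *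
  (table r 3%:R 0 = (nth [::] r 3)`_0) * (table r 3%:R 1 = (nth [::] r 3)`_1) * (table r 3%:R 2%:R = (nth [::] r 3)`_2) * (table r 3%:R 3%:R = (nth [::] r 3)`_3).
Proof. by rewrite /table; do !split; rewrite mxE. Qed.

(** The self-dual two-forms of R^4, which act as imaginary quaternions. *)
Definition Qm (c : 'I_3 -> R) : 'M[R]_4 := table
  [:: [:: 0; - c 0; - c 1; - c 2%:R]; [:: c 0; 0; - c 2%:R; c 1];
      [:: c 1; c 2%:R; 0; - c 0]; [:: c 2%:R; - c 1; c 0; 0]].

(** The Hodge star of the Euclidean space R^4. *)
Definition star0 (A : 'M[R]_4) : 'M[R]_4 := table
  [:: [:: 0; A 2%:R 3%:R; - A 1 3%:R; A 1 2%:R]; [:: - A 2%:R 3%:R; 0; A 0 3%:R; - A 0 2%:R];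
      [:: A 1 3%:R; - A 0 3%:R; 0; A 0 1]; [:: - A 1 2%:R; A 0 2%:R; - A 0 1; 0]].

Lemma QmE c :
  (Qm c 0 0 = 0) * (Qm c 0 1 = - c 0) * (Qm c 0 2%:R = - c 1) * (Qm c 0 3%:R = - c 2%:R) *
  (Qm c 1 0 = c 0) * (Qm c 1 1 = 0) * (Qm c 1 2%:R = - c 2%:R) * (Qm c 1 3%:R = c 1) *
  (Qm c 2%:R 0 = c 1) * (Qm c 2%:R 1 = c 2%:R) * (Qm c 2%:R 2%:R = 0) * (Qm c 2%:R 3%:R = - c 0) *
  (Qm c 3%:R 0 = c 2%:R) * (Qm c 3%:R 1 = - c 1) * (Qm c 3%:R 2%:R = c 0) * (Qm c 3%:R 3%:R = 0).
Proof. by rewrite /Qm; do !split; rewrite tableE. Qed.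

Lemma star0E A :
  (star0 A 0 0 = 0) * (star0 A 0 1 = A 2%:R 3%:R) * (star0 A 0 2%:R = - A 1 3%:R) * (star0 A 0 3%:R = A 1 2%:R) *
  (star0 A 1 0 = - A 2%:R 3%:R) * (star0 A 1 1 = 0) * (star0 A 1 2%:R = A 0 3%:R) * (star0 A 1 3%:R = - A 0 2%:R) *
  (star0 A 2%:R 0 = A 1 3%:R) * (star0 A 2%:R 1 = - A 0 3%:R) * (star0 A 2%:R 2%:R = 0) * (star0 A 2%:R 3%:R = A 0 1) *
  (star0 A 3%:R 0 = - A 1 2%:R) * (star0 A 3%:R 1 = A 0 2%:R) * (star0 A 3%:R 2%:R = - A 0 1) * (star0 A 3%:R 3%:R = 0).
Proof. by rewrite /star0; do !split; rewrite tableE. Qed.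

Local Opaque Qm star0 table.

Lemma mx4P (A B : 'M[R]_4) :
  [/\ A 0 0 = B 0 0, A 0 1 = B 0 1, A 0 2%:R = B 0 2%:R & A 0 3%:R = B 0 3%:R] ->
  [/\ A 1 0 = B 1 0, A 1 1 = B 1 1, A 1 2%:R = B 1 2%:R & A 1 3%:R = B 1 3%:R] ->
  [/\ A 2%:R 0 = B 2%:R 0, A 2%:R 1 = B 2%:R 1, A 2%:R 2%:R = B 2%:R 2%:R & A 2%:R 3%:R = B 2%:R 3%:R] ->
  [/\ A 3%:R 0 = B 3%:R 0, A 3%:R 1 = B 3%:R 1, A 3%:R 2%:R = B 3%:R 2%:R & A 3%:R 3%:R = B 3%:R 3%:R] ->
  A = B.
Proof.
by move=> [? ? ? ?] [? ? ? ?] [? ? ? ?] [? ? ? ?]; apply/matrixP; apply: I4P; apply: I4P.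
Qed.

Lemma antisym_entries (A : 'M[R]_4) : A^T = - A ->
  (A 0 0 = 0) * (A 1 1 = 0) * (A 2%:R 2%:R = 0) * (A 3%:R 3%:R = 0) *
  (A 1 0 = - A 0 1) * (A 2%:R 0 = - A 0 2%:R) * (A 3%:R 0 = - A 0 3%:R) *
  (A 2%:R 1 = - A 1 2%:R) * (A 3%:R 1 = - A 1 3%:R) * (A 3%:R 2%:R = - A 2%:R 3%:R).
Proof.
move=> h; have e i j : A j i = - A i j by have /matrixP/(_ i j) := h; rewrite !mxE.
have d i : A i i = 0 by have := e i i; lra.
by do !split.
Qed.

Lemma Qm_anti c : (Qm c)^T = - Qm c.
Proof. by apply: mx4P; split; rewrite [LHS]mxE [RHS]mxE !QmE ?opprK ?oppr0. Qed.

Lemma star0_Qm c : star0 (Qm c) = Qm c.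
Proof. by apply: mx4P; rewrite !star0E !QmE; split; rewrite ?opprK. Qed.

Lemma star0_anti A : (star0 A)^T = - star0 A.
Proof. by apply: mx4P; split; rewrite [LHS]mxE [RHS]mxE !star0E ?opprK ?oppr0. Qed.

Lemma star0K A : A^T = - A -> star0 (star0 A) = A.
Proof.
move=> h; apply: mx4P; rewrite !star0E;
  by split; rewrite ?(antisym_entries h) ?opprK.
Qed.

Lemma star0_fixed A : A^T = - A -> star0 A = A ->
  A = Qm (fun i => if i == 0 then - A 0 1 else if i == 1 then - A 0 2%:R else - A 0 3%:R).
Proof.
move=> h sA; have := (fun i j => congr1 (fun m : 'M[R]_4 => m i j) sA) => {}sA.
have := sA 0 1; have := sA 0 2%:R; have := sA 0 3%:R; rewrite !star0E => e3 e2 e1.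
apply: mx4P; rewrite !QmE !z3eq ?eqxx /=; split; rewrite ?(antisym_entries h) ?opprK //; lra.
Qed.

Lemma mulmx4E (A B : 'M[R]_4) i j :
  (A *m B) i j = A i 0 * B 0 j + A i 1 * B 1 j + A i 2%:R * B 2%:R j + A i 3%:R * B 3%:R j.
Proof. by rewrite mxE sum4. Qed.

Lemma tr4E (A : 'M[R]_4) : \tr A = A 0 0 + A 1 1 + A 2%:R 2%:R + A 3%:R 3%:R.
Proof. exact: sum4. Qed.

Lemma Qm_ip c d : \tr (Qm c *m (Qm d)^T) = 4 * \sum_i c i * d i.
Proof. by rewrite tr4E !mulmx4E ![(_^T) _ _]mxE !QmE sum3; ring. Qed.

Lemma star0_ip A c : A^T = - A -> \tr (star0 A *m (Qm c)^T) = \tr (A *m (Qm c)^T).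
Proof.
by move=> h; rewrite !tr4E !mulmx4E ![(_^T) _ _]mxE !QmE !star0E !(antisym_entries h); ring.
Qed.

Lemma Qm_triple a b c : \tr (Qm a *m Qm b *m Qm c) =
  - 4 * \det (\matrix_(i, j) (if i == 0 then a j else if i == 1 then b j else c j) : 'M[R]_3).
Proof.
rewrite det3 ![(\matrix_(_, _) _) _ _]mxE !z3eq ?eqxx /= tr4E !mulmx4E !QmE; ring.
Qed.

Definition det4 (v1 v2 v3 v4 : T) : R := \det (\matrix_i fam 4 [:: v1; v2; v3; v4] i).

Lemma det4_mul (v1 v2 v3 v4 : T) (A : 'M[R]_4) :
  det4 (v1 *m A) (v2 *m A) (v3 *m A) (v4 *m A) = det4 v1 v2 v3 v4 * \det A.
Proof.
rewrite /det4 -det_mulmx; congr (\det _); apply/row_matrixP => i.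
rewrite row_mul !rowK; move: i; exact: I4P.
Qed.

Lemma det4E (v1 v2 v3 v4 : T) : det4 v1 v2 v3 v4 =
  let d a b c := (v2 0 a * v3 0 b - v2 0 b * v3 0 a) * v4 0 c
     + (v2 0 b * v3 0 c - v2 0 c * v3 0 b) * v4 0 a + (v2 0 c * v3 0 a - v2 0 a * v3 0 c) * v4 0 b in
  v1 0 0 * d 1 2%:R 3%:R - v1 0 1 * d 0 2%:R 3%:R + v1 0 2%:R * d 0 1 3%:R - v1 0 3%:R * d 0 1 2%:R.
Proof.
rewrite /det4 (expand_det_row _ (0 : 'I_4)) sum4 /cofactor !det3 !mxE.
have L (i : 'I_4) (j : 'I_3) k : bump i j = k :> nat -> lift i j = k%:R :> 'I_4.
  by move=> h; apply: val_inj => /=; rewrite h; move: k h; case: i j => [[|[|[|[|//]]]] ?] [[|[|[|//]]] ?] /= k <-.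
rewrite !(L 0 0 1%N)// !(L 0 1 2%N)// !(L 0 2%:R 3%N)// !(L 1 0 0%N)// !(L 1 1 2%N)// !(L 1 2%:R 3%N)//.
rewrite !(L 2%:R 0 0%N)// !(L 2%:R 1 1%N)// !(L 2%:R 2%:R 3%N)// !(L 3%:R 0 0%N)// !(L 3%:R 1 1%N)// !(L 3%:R 2%:R 2%N)//.
rewrite /fam /=.
rewrite (_ : (-1) ^+ (0 + 0) = 1 :> R)// (_ : (-1) ^+ (0 + 1) = -1 :> R); last by rewrite !exprS expr0; ring.
rewrite (_ : (-1) ^+ (0 + 2) = 1 :> R); last by rewrite !exprS expr0; ring.
rewrite (_ : (-1) ^+ (0 + 3) = -1 :> R); last by rewrite !exprS expr0; ring.
ring.
Qed.

Lemma dvecE i j : (dvec i : T) 0 j = (i == j)%:R.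
Proof. by rewrite mxE eqxx eq_sym. Qed.

Lemma z4eq : ((0 : 'I_4) == 1 = false) * ((0 : 'I_4) == 2%:R = false) * ((0 : 'I_4) == 3%:R = false) *
  ((1 : 'I_4) == 0 = false) * ((1 : 'I_4) == 2%:R = false) * ((1 : 'I_4) == 3%:R = false) *
  ((2%:R : 'I_4) == 0 = false) * ((2%:R : 'I_4) == 1 = false) * ((2%:R : 'I_4) == 3%:R = false) *
  ((3%:R : 'I_4) == 0 = false) * ((3%:R : 'I_4) == 1 = false) * ((3%:R : 'I_4) == 2%:R = false).
Proof. by []. Qed.

Lemma bilE (S : 'M[R]_4) v w : bil S v w = \sum_i \sum_j v 0 i * S i j * w 0 j.
Proof.
rewrite /bil mxE exchange_big /=; apply: eq_bigr => j _.
by rewrite !mxE mulr_suml.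
Qed.

(** Contracting a two-form with the determinant is the standard Hodge star. *)
Lemma det4_contract (A : 'M[R]_4) v w : A^T = - A ->
  2^-1 * \sum_i \sum_j A i j * det4 (dvec i) (dvec j) v w = bil (star0 A) v w.
Proof.
move=> h; rewrite bilE !sum4 !star0E !(antisym_entries h) !det4E /= !dvecE !z4eq ?eqxx /=; by field.
Qed.

End Hat.

Local Opaque Qm star0 table.

Section Hat2.
Context (R : realType).
Local Notation T := 'rV[R]_4.

Lemma det4_lin1 r (u u' v w z : T) : det4 (r *: u + u') v w z = r * det4 u v w z + det4 u' v w z.
Proof. by rewrite !det4E /= !(addmxE, scalemxE); ring. Qed.

Lemma det4_lin2 r (u u' v w z : T) : det4 v (r *: u + u') w z = r * det4 v u w z + det4 v u' w z.
Proof. by rewrite !det4E /= !(addmxE, scalemxE); ring. Qed.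

Lemma lin_sum (V : lmodType R) (f : V -> R) (I : Type) (r : seq I) (k : I -> R) (u : I -> V) :
  (forall a u v, f (a *: u + v) = a * f u + f v) ->
  f (\sum_(i <- r) k i *: u i) = \sum_(i <- r) k i * f (u i).
Proof.
move=> h; have f0 : f 0 = 0.
  by have := h 1 0 0; rewrite scaler0 addr0 mul1r; move: (f 0) => z; lra.
elim: r => [|i r IH]; first by rewrite !big_nil.
by rewrite !big_cons h IH.
Qed.

Lemma det4_expand (N : 'M[R]_4) a b (w z : T) :
  det4 (dvec a *m N) (dvec b *m N) w z = \sum_k \sum_l N a k * N b l * det4 (dvec k) (dvec l) w z.
Proof.
rewrite {1}(rV_basis (dvec a *m N)) (@lin_sum _ (fun u => det4 u _ _ _)); last by move=> *; exact: det4_lin1.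
apply: eq_bigr => k _; rewrite {1}(rV_basis (dvec b *m N)) (@lin_sum _ (fun u => det4 _ u _ _)); last first.
  by move=> *; exact: det4_lin2.
rewrite mulr_sumr; apply: eq_bigr => l _; rewrite mulrA; congr (_ * _ * _).
  by rewrite -rowE mxE.
by rewrite -rowE mxE.
Qed.

Lemma quad_sum (A B S S' : 'M[R]_4) :
  \sum_i \sum_j \sum_k \sum_l A i k * B j l * S i j * S' k l = \tr (A^T *m S *m B *m S'^T).
Proof.
transitivity (\sum_k \sum_l \sum_i \sum_j A i k * B j l * S i j * S' k l).
  rewrite (eq_bigr (fun i => \sum_k \sum_l \sum_j A i k * B j l * S i j * S' k l)) => [|i _].
    by rewrite exchange_big; apply: eq_bigr => k _; exact: exchange_big.
  by rewrite exchange_big; apply: eq_bigr => k _; exact: exchange_big.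
apply: eq_bigr => k _; rewrite mxE; apply: eq_bigr => l _; rewrite !mxE mulr_suml exchange_big /=.
apply: eq_bigr => j _; rewrite mxE mulr_suml mulr_suml; apply: eq_bigr => i _.
by rewrite mxE; ring.
Qed.

Definition kap : R := (Num.sqrt 2)^-1.

Lemma kap2 : kap * kap = 2^-1.
Proof. by rewrite /kap -invfM -expr2 sqr_sqrtr. Qed.

Definition unit3 (i : 'I_3) : 'I_3 -> R := fun j => (i == j)%:R.

Lemma wedge1_mul (t t' : T) (A : 'M[R]_4) : wedge1 (t *m A) (t' *m A) = A^T *m wedge1 t t' *m A.
Proof. by rewrite /wedge1 mulmxBr mulmxBl !trmx_mul !mulmxA. Qed.

Lemma Sigma_mul (t : 'I_4 -> T) (A : 'M[R]_4) i :
  Sigma (fun a => t a *m A) i = A^T *m Sigma t i *m A.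
Proof. by rewrite /Sigma !wedge1_mul -scalemxAr -scalemxAl [in RHS]mulmxDr [in RHS]mulmxDl. Qed.

Lemma Sigma_std i : Sigma dvec i = kap *: Qm (unit3 i) :> 'M[R]_4.
Proof.
have l0 : lift ord0 (0 : 'I_3) = 1 :> 'I_4 by exact: val_inj.
have l1 : lift ord0 (1 : 'I_3) = 2%:R :> 'I_4 by exact: val_inj.
have l2 : lift ord0 (2%:R : 'I_3) = 3%:R :> 'I_4 by exact: val_inj.
have w1E (a b c d : 'I_4) : wedge1 (dvec a) (dvec b) c d = (a == c)%:R * (b == d)%:R - (b == c)%:R * (a == d)%:R :> R.
  by rewrite /wedge1 [LHS]mxE [X in _ + X]mxE ![((_^T) *m _) _ _]mxE !big_ord1 ![(_^T) _ _]mxE !dvecE.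
have SE (a b c d e f : 'I_4) : (- (Num.sqrt 2)^-1 *: (wedge1 (dvec a) (dvec b) + wedge1 (dvec c) (dvec d))) e f =
   - kap * ((a == e)%:R * (b == f)%:R - (b == e)%:R * (a == f)%:R + ((c == e)%:R * (d == f)%:R - (d == e)%:R * (c == f)%:R)) :> R.
  by rewrite scalemxE addmxE !w1E.
move: i; apply: I3P; rewrite /Sigma !z3E ?l0 ?l1 ?l2; apply: mx4P; rewrite !SE !scalemxE !QmE /unit3 !z3eq ?eqxx !z4eq /=; split; ring.
Qed.

End Hat2.

Lemma linfunE (R : realType) (U V : vectType R) (f : U -> V) : linear f -> forall u, linfun f u = f u.
Proof.
move=> lf u; pose m := GRing.isLinear.Build _ _ _ _ f lf.
pose F : {linear U -> V} := HB.pack f m; exact: (lfunE F u).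
Qed.

Section Pointwise.
Context (R : realType) (M : topologicalType) (X : oriented_riemannian4 R M).
Local Notation T := 'rV[R]_4.
Local Notation dom p := (cdom (chart_at X p)).
Local Notation sf := (smooth_fun X).
Local Notation kap := (@kap R).
Implicit Types (x y p q : M) (U V : set M).

Lemma hodge_lin x : linear (fun S : 'M[R]_4 => (hodge_mx X x S - S)%R).
Proof.
move=> a S S'; apply/matrixP => i j; rewrite !mxE.
rewrite (eq_bigr (fun k => a * (\sum_l starc X x k l (dvec i) (dvec j) * S k l) + \sum_l starc X x k l (dvec i) (dvec j) * S' k l)).
  by rewrite big_split /= -mulr_sumr; ring.
move=> k _; rewrite mulr_sumr -big_split /=; apply: eq_bigr => l _; rewrite !mxE; ring.
Qed.

Lemma trD_lin : linear (fun S : 'M[R]_4 => (S^T + S)%R).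
Proof. by move=> a S S'; apply/matrixP => i j; rewrite !mxE; ring. Qed.

Lemma selfdualP x S : S \in selfdual X x <-> S^T = - S /\ hodge_mx X x S = S.
Proof.
rewrite memv_cap !memv_ker (linfunE trD_lin) (linfunE (hodge_lin x)) addr_eq0 subr_eq0.
by split=> [/andP[/eqP ? /eqP ?]|[-> ->]]; rewrite ?eqxx.
Qed.

Section Coframe.
Context (x : M) (th : 'M[R]_4).
Hypothesis (on : th *m invmx (gram X x) *m th^T = 1%:M) (dpos : 0 < \det th).
Local Notation G := (gram X x).

Lemma th_unit : th \in unitmx.
Proof. by rewrite unitmxE unitfE gt_eqF. Qed.

Lemma G_unit : G \in unitmx.
Proof. exact: posdef_unit (gram_posdef X x). Qed.

Lemma thN : th *m invmx th = 1%:M.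
Proof. exact: mulmxV th_unit. Qed.

Lemma Nth : invmx th *m th = 1%:M.
Proof. exact: mulVmx th_unit. Qed.

Lemma NthT : (invmx th)^T *m th^T = 1%:M.
Proof. by rewrite -trmx_mul thN trmx1. Qed.

Lemma thNT : th^T *m (invmx th)^T = 1%:M.
Proof. by rewrite -trmx_mul Nth trmx1. Qed.

Lemma ginv_th : invmx G = invmx th *m (invmx th)^T.
Proof.
have -> : invmx G = invmx th *m (th *m invmx G *m th^T) *m (invmx th)^T.
  by rewrite !mulmxA Nth mul1mx -mulmxA thNT mulmx1.
by rewrite on mulmx1.
Qed.

Lemma G_th : G = th^T *m th.
Proof.
rewrite -[RHS]mulmx1 -(mulVmx G_unit) ginv_th !mulmxA mulmxK ?th_unit//.
by rewrite thNT mul1mx.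
Qed.

Lemma sqrt_det_th : Num.sqrt (\det G) = \det th.
Proof. by rewrite G_th det_mulmx det_tr -expr2 sqrtr_sqr ger0_norm// ltW. Qed.

Lemma ip2E S S' : ip2 X x S S' = 2^-1 * \tr ((invmx G)^T *m S *m invmx G *m S'^T).
Proof. by rewrite -quad_sum. Qed.

Lemma ip2_hat A B : ip2 X x (th^T *m A *m th) (th^T *m B *m th) = 2^-1 * \tr (A *m B^T).
Proof.
rewrite ip2E ginv_th !trmx_mul !trmxK; congr (_ * _).
rewrite -!mulmxA (mulmxA (invmx th)^T) NthT mul1mx (mulmxA th) thN mul1mx.
rewrite (mulmxA (invmx th)^T) NthT mul1mx mxtrace_mulC -!mulmxA thN mulmx1 //.
Qed.

(** In an orthonormal coframe the volume form is the determinant, and the star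
    becomes the standard one. *)
Lemma hodge_hat A : A^T = - A -> hodge_mx X x (th^T *m A *m th) = th^T *m star0 A *m th.
Proof.
move=> hA; set S := th^T *m A *m th; apply/matrixP => c d; rewrite [LHS]mxE.
pose V : 'M[R]_4 := \matrix_(k, l) vol X x (fam 4 [:: dvec k; dvec l; dvec c; dvec d]).
have -> : \sum_i \sum_j starc X x i j (dvec c) (dvec d) * S i j = 2^-1 * \tr ((invmx G)^T *m S *m invmx G *m V^T).
  rewrite -quad_sum mulr_sumr; apply: eq_bigr => i _; rewrite mulr_sumr; apply: eq_bigr => j _.
  rewrite /starc -mulrA; congr (_ * _); rewrite mulr_suml; apply: eq_bigr => k _.
  rewrite mulr_suml; apply: eq_bigr => l _; rewrite [V k l]mxE /ginv; ring.
have VE a b : ((invmx th)^T *m V *m invmx th) a b = det4 (dvec a) (dvec b) (dvec c *m th^T) (dvec d *m th^T).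
  have -> : det4 (dvec a) (dvec b) (dvec c *m th^T) (dvec d *m th^T) = det4 (dvec a *m (invmx th)^T) (dvec b *m (invmx th)^T) (dvec c) (dvec d) * \det th.
    by rewrite -(det_tr th) -det4_mul -!mulmxA NthT !mulmx1.
  transitivity (\sum_k \sum_l (invmx th)^T a k * V k l * invmx th l b).
    rewrite exchange_big mxE; apply: eq_bigr => l _; by rewrite [(_ *m V) a l]mxE mulr_suml.
  rewrite det4_expand mulr_suml; apply: eq_bigr => k _; rewrite mulr_suml; apply: eq_bigr => l _.
  by rewrite [V k l]mxE /vol sqrt_det_th -/(det4 _ _ _ _) [(invmx th)^T b l]mxE; ring.
have -> : \tr ((invmx G)^T *m S *m invmx G *m V^T) = \sum_a \sum_b A a b * det4 (dvec a) (dvec b) (dvec c *m th^T) (dvec d *m th^T).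
  rewrite /S ginv_th !trmx_mul !trmxK -!mulmxA (mulmxA (invmx th)^T) NthT mul1mx (mulmxA th) thN mul1mx.
  rewrite mxtrace_mulC -!mulmxA.
  have -> : (invmx th)^T *m (V^T *m invmx th) = ((invmx th)^T *m V *m invmx th)^T.
    by rewrite !trmx_mul trmxK mulmxA.
  apply: eq_bigr => a _; rewrite mxE; apply: eq_bigr => b _; rewrite [X in _ * X]mxE VE //.
by rewrite det4_contract// -[RHS]bil_dvec /bil trmx_mul trmxK !mulmxA.
Qed.

Lemma star0Z (k : R) A : star0 (k *: A) = k *: star0 A.
Proof. by apply: mx4P; rewrite !scalemxE !star0E !scalemxE ?mulr0 ?mulrN. Qed.

(** The self-dual two-form with components c in the frame Sigma built from the
    coframe given by the rows of th (see Sigma_hat and selfdual_hat). *)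
Definition hatQ (c : 'I_3 -> R) : 'M[R]_4 := kap *: (th^T *m Qm c *m th).

Lemma hatQE c : hatQ c = th^T *m (kap *: Qm c) *m th.
Proof. by rewrite /hatQ -scalemxAr -scalemxAl. Qed.

Lemma kap_neq0 : kap != 0.
Proof. by rewrite invr_neq0// gt_eqF// sqrtr_gt0. Qed.

Lemma selfdual_hat S : S \in selfdual X x <-> exists c, S = hatQ c.
Proof.
split.
  move=> /selfdualP[aS hS]; pose A := kap^-1 *: ((invmx th)^T *m S *m invmx th).
  have aA : A^T = - A by rewrite /A linearZ /= !trmx_mul trmxK aS mulNmx mulmxN mulmxA scalerN.
  have SA : S = th^T *m (kap *: A) *m th.
    rewrite /A scalerA mulfV ?kap_neq0// scale1r !mulmxA thNT mul1mx -mulmxA Nth mulmx1 //.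
  have akA : (kap *: A)^T = - (kap *: A) by rewrite linearZ /= aA scalerN.
  have sA : star0 A = A.
    have h : th^T *m (kap *: star0 A) *m th = th^T *m (kap *: A) *m th.
      by rewrite -star0Z -hodge_hat// -SA hS.
    have h2 : kap *: star0 A = kap *: A.
      have := congr1 (fun m : 'M[R]_4 => (invmx th)^T *m m *m invmx th) h.
      by rewrite !mulmxA NthT !mul1mx -!mulmxA thN !mulmx1.
    exact: (scalerI kap_neq0 h2).
  by exists (fun i => if i == 0 then - A 0 1 else if i == 1 then - A 0 2%:R else - A 0 3%:R); rewrite hatQE -star0_fixed.
move=> [c ->]; apply/selfdualP; rewrite hatQE.
have aQ : (kap *: Qm c)^T = - (kap *: Qm c) by rewrite linearZ /= Qm_anti scalerN.
split; first by rewrite !trmx_mul trmxK aQ mulNmx mulmxN mulmxA.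
by rewrite hodge_hat// star0Z star0_Qm.
Qed.

Lemma ip2_hatQ c d : ip2 X x (hatQ c) (hatQ d) = \sum_i c i * d i.
Proof.
rewrite !hatQE ip2_hat linearZ /= -scalemxAl -scalemxAr !mxtraceZ Qm_ip !mulrA -[2^-1 * _ * _]mulrA kap2.
by rewrite -[RHS]mul1r; congr (_ * _); field.
Qed.

(** Self-duality enters the metric through the fact that the star is
    self-adjoint. *)
Lemma ip2_hodge S c : S^T = - S -> ip2 X x (hodge_mx X x S) (hatQ c) = ip2 X x S (hatQ c).
Proof.
move=> aS; pose A := (invmx th)^T *m S *m invmx th.
have aA : A^T = - A by rewrite /A !trmx_mul trmxK aS mulNmx mulmxN mulmxA.
have SA : S = th^T *m A *m th by rewrite /A !mulmxA thNT mul1mx -mulmxA Nth mulmx1.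
rewrite SA hodge_hat// !hatQE !ip2_hat linearZ /= -!scalemxAr !mxtraceZ.
by rewrite star0_ip.
Qed.

Lemma hodgeK S : S^T = - S -> hodge_mx X x (hodge_mx X x S) = S.
Proof.
move=> aS; pose A := (invmx th)^T *m S *m invmx th.
have aA : A^T = - A by rewrite /A !trmx_mul trmxK aS mulNmx mulmxN mulmxA.
have SA : S = th^T *m A *m th by rewrite /A !mulmxA thNT mul1mx -mulmxA Nth mulmx1.
by rewrite SA !hodge_hat ?star0K// star0_anti.
Qed.

Lemma hodge_anti S : S^T = - S -> (hodge_mx X x S)^T = - hodge_mx X x S.
Proof.
move=> aS; pose A := (invmx th)^T *m S *m invmx th.
have aA : A^T = - A by rewrite /A !trmx_mul trmxK aS mulNmx mulmxN mulmxA.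
have SA : S = th^T *m A *m th by rewrite /A !mulmxA thNT mul1mx -mulmxA Nth mulmx1.
by rewrite SA hodge_hat// !trmx_mul trmxK star0_anti mulNmx mulmxN mulmxA.
Qed.

(** The cubic form tr (S G^-1 S' G^-1 S'' G^-1) is a volume form on the
    self-dual two-forms which does not refer to a coframe. *)
Lemma triple_hatQ a b c :
  \tr (hatQ a *m invmx G *m hatQ b *m invmx G *m hatQ c *m invmx G) =
  - 4 * kap ^+ 3 * \det (\matrix_(i, j) (if i == 0 then a j else if i == 1 then b j else c j) : 'M[R]_3).
Proof.
have -> : - 4 * kap ^+ 3 * \det (\matrix_(i, j) (if i == 0 then a j else if i == 1 then b j else c j) : 'M[R]_3)
   = kap ^+ 3 * \tr (Qm a *m Qm b *m Qm c) by rewrite Qm_triple; ring.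
rewrite !hatQE ginv_th.
rewrite -!mulmxA (mulmxA th (invmx th)) thN mul1mx (mulmxA (invmx th)^T th^T) NthT mul1mx.
rewrite (mulmxA th (invmx th)) thN mul1mx (mulmxA (invmx th)^T th^T) NthT mul1mx (mulmxA th (invmx th)) thN mul1mx.
rewrite mxtrace_mulC -!mulmxA NthT mulmx1 -!scalemxAl -!scalemxAr !mxtraceZ mulmxA !exprS expr0; ring.
Qed.

End Coframe.
End Pointwise.

Section SelfDualBundle.
Context (R : realType) (M : topologicalType) (X : oriented_riemannian4 R M).
Local Notation T := 'rV[R]_4.
Local Notation dom p := (cdom (chart_at X p)).
Local Notation sf := (smooth_fun X).
Local Notation kap := (@kap R).
Local Notation LP := (LambdaP X).
Local Notation J := (Jm X).
Implicit Types (x y p q : M) (U V : set M) (t : M -> 'I_4 -> T).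

Definition cofm (t : 'I_4 -> T) : 'M[R]_4 := \matrix_a t a.

Lemma bil_rows (S th : 'M[R]_4) a b : bil S (row a th) (row b th) = (th *m S *m th^T) a b.
Proof. by rewrite -[RHS]bil_dvec /bil !mulmxA -rowE -[in RHS]mulmxA -trmx_mul -rowE. Qed.

Lemma coframe_th U t x : oriented_coframe X U t -> U x ->
  cofm (t x) *m invmx (gram X x) *m (cofm (t x))^T = 1%:M /\ 0 < \det (cofm (t x)).
Proof.
move=> ct Ux; split; last exact: (coframe_pos ct).
apply/matrixP => a b; rewrite [RHS]mxE -(coframe_on ct Ux) -bil_rows.
by rewrite !rowK.
Qed.

Lemma Sigma_hat (t : 'I_4 -> T) i : Sigma t i = hatQ (cofm t) (unit3 R i).
Proof.
have -> : t = (fun a => dvec a *m cofm t) by apply/funext => a; rewrite -rowE rowK.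
rewrite Sigma_mul Sigma_std hatQE; congr (_^T *m _ *m _); apply/row_matrixP => a; by rewrite !rowK -rowE rowK.
Qed.

(** The components, in the chart at p, of a field of bilinear forms. *)
Definition chm p (S : M -> 'M[R]_4) y : 'M[R]_4 := J p y *m S y *m (J p y)^T.

Lemma chm_bil p S y (a b : T) : bil (chm p S y) a b = bil (S y) (cfield X p a y) (cfield X p b y).
Proof. by rewrite /bil !cfieldJ trmx_mul /chm !mulmxA. Qed.

Definition tpm p t y : 'M[R]_4 := cofm (t y) *m (J p y)^T.

Lemma tpmE p t y a k : tpm p t y a k = (cfield X p (dvec k) y *m (t y a)^T) 0 0.
Proof.
rewrite cfieldJ /tpm -bil_dvec /bil mulmxA -rowE rowK.
have tr11 (A : 'M[R]_1) : A 0 0 = A^T 0 0 by rewrite mxE.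
by rewrite [LHS]tr11 !trmx_mul !trmxK mulmxA.
Qed.

Lemma tpm_smooth U t p : oriented_coframe X U t -> sfmx X (U `&` dom p) (tpm p t).
Proof.
move=> ct a k; have oW : open (U `&` dom p) by apply: openI; [exact: (coframe_open ct) | exact: dom_open].
by apply: sf_ext oW _ (coframe_smooth ct a p (dvec k)) => y _; rewrite tpmE.
Qed.

Lemma chm_hatQ p t c y : chm p (fun y => hatQ (cofm (t y)) c) y = kap *: ((tpm p t y)^T *m Qm c *m tpm p t y).
Proof.
by rewrite /chm /hatQ /tpm -scalemxAr -scalemxAl trmx_mul trmxK !mulmxA.
Qed.

Lemma sf_hatQ U t p c : oriented_coframe X U t ->
  sfmx X (U `&` dom p) (chm p (fun y => hatQ (cofm (t y)) c)).
Proof.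
move=> ct i j; have oW : open (U `&` dom p) by apply: openI; [exact: (coframe_open ct) | exact: dom_open].
have h : sfmx X (U `&` dom p) (fun y => (tpm p t y)^T *m Qm c *m tpm p t y).
  apply: (sf_mulmx oW); last exact: tpm_smooth.
  apply: (sf_mulmx oW); first by apply: (sf_trmx oW); exact: tpm_smooth.
  by move=> a b; exact: sf_cst.
by apply: sf_ext oW _ (sf_scale kap oW (h i j)) => y _; rewrite chm_hatQ scalemxE.
Qed.

Lemma ginv_chart p y : dom p y -> invmx (gram X y) = (J p y)^T *m invmx (Gm X p y) *m J p y.
Proof.
move=> py; have uJ := Jm_unit py; have uG := Gm_unit py.
have uJT : (J p y)^T \in unitmx by rewrite unitmx_tr.
have ug := posdef_unit (gram_posdef X y).
have gE : gram X y = invmx (J p y) *m Gm X p y *m invmx (J p y)^T.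
  by rewrite /Gm !mulmxA mulVmx// mul1mx mulmxK.
have E : gram X y *m ((J p y)^T *m invmx (Gm X p y) *m J p y) = 1%:M.
  rewrite gE; move: (Gm X p y) uG => K uK.
  by rewrite !mulmxA mulmxKV// mulmxK// mulVmx.
by rewrite -[LHS]mulmx1 -E mulKmx.
Qed.

Lemma ip2_chart p y S S' : dom p y -> ip2 X y S S' =
  2^-1 * \tr ((invmx (Gm X p y))^T *m chm p (fun=> S) y *m invmx (Gm X p y) *m (chm p (fun=> S') y)^T).
Proof.
move=> py; rewrite ip2E (ginv_chart py) /chm; congr (_ * _).
rewrite !trmx_mul !trmxK -!mulmxA mxtrace_mulC -!mulmxA; congr (\tr _).
Qed.

Lemma sf_ip2 U (S S' : M -> 'M[R]_4) : open U ->
  (forall p, sfmx X (U `&` dom p) (chm p S)) -> (forall p, sfmx X (U `&` dom p) (chm p S')) ->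
  sf U (fun y => ip2 X y (S y) (S' y)).
Proof.
move=> oU sS sS'; apply: sf_local => p Up; exists (dom p); split; first exact: dom_self.
have oW := openI oU (dom_open X p).
have sG : sfmx X (U `&` dom p) (fun y => invmx (Gm X p y)).
  apply: (sf_invmx oW); first by move=> y [_ py]; exact: Gm_unit.
  by move=> i j; apply: sf_sub (sf_Gm X p i j) => y [].
apply: (sf_ext oW _ (sf_scale 2^-1 oW _)) => [y [_ py]|]; first by rewrite [RHS](ip2_chart _ _ py).
have h : sfmx X (U `&` dom p) (fun y => (invmx (Gm X p y))^T *m chm p S y *m invmx (Gm X p y) *m (chm p S' y)^T).
  apply: (sf_mulmx oW); last exact: (sf_trmx oW).
  apply: (sf_mulmx oW) => //; apply: (sf_mulmx oW) => //; exact: (sf_trmx oW).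
by apply: (sf_sum (index_enum 'I_4) oW) => i _; exact: h.
Qed.

(** Orthonormal coframes exist near every point, by Cholesky factorisation of
    the metric. *)
Lemma coframe_exists p : exists t, oriented_coframe X (dom p) t.
Proof.
have od := dom_open X p; have oI := @im_open _ _ X p _ od.
have inU z : chart_image (chart_at X p) (dom p) z -> dom p (cinv (chart_at X p) z) by move=> /im_inv[].
have [||tz [ct tE t0]] := @smooth_cholesky R 4 _ (Gm X p \o cinv (chart_at X p)) oI.
- by move=> z /inU; exact: Gm_posdef.
- by move=> k i j; exact: (sf_Gm X p i j).
pose s y := tz (cmap (chart_at X p) y).
have sE y : dom p y -> (s y)^T *m s y = Gm X p y.
  by move=> py; rewrite /s tE /= ?cmapK//; exact: im_in.
have s0 y : dom p y -> 0 < \det (s y) by move=> py; apply: t0; exact: im_in.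
have ss : sfmx X (dom p) s.
  move=> i j; apply: (@sf_chart _ _ _ p) => // k.
  by apply: Ck_ext oI _ (ct k i j) => z /im_inv[_ _ zE]; rewrite /= /s zE.
pose th y := s y *m invmx (J p y)^T.
have thJ y : dom p y -> th y *m (J p y)^T = s y.
  by move=> py; rewrite /th mulmxKV// unitmx_tr Jm_unit.
exists (fun y a => row a (th y)); have cE y : cofm (fun a => row a (th y)) = th y.
  by apply/row_matrixP => a; rewrite rowK.
split=> //.
- move=> y py a b; rewrite (ginv_chart py) /bil.
  have us : s y \in unitmx by rewrite unitmxE unitfE gt_eqF// s0.
  have usT : (s y)^T \in unitmx by rewrite unitmx_tr.
  have e : s y *m invmx (Gm X p y) *m (s y)^T = 1%:M.
    have Gi : invmx (Gm X p y) = invmx (s y) *m invmx (s y)^T.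
      have ug := Gm_unit py; rewrite -[RHS](mulmxK ug) -(sE y py) !mulmxA mulmxKV// mulVmx// mul1mx //.
    by rewrite Gi !mulmxA mulmxV// mul1mx mulVmx.
  rewrite -/(bil _ _ _) bil_rows.
  have -> : th y *m ((J p y)^T *m invmx (Gm X p y) *m J p y) *m (th y)^T = (th y *m (J p y)^T) *m invmx (Gm X p y) *m (th y *m (J p y)^T)^T.
    by rewrite [(th y *m (J p y)^T)^T]trmx_mul trmxK !mulmxA.
  by rewrite thJ// e mxE.
- move=> y py; rewrite -[\matrix_a _]/(cofm (fun a => row a (th y))) cE /th det_mulmx det_inv.
  by rewrite det_tr mulr_gt0 ?s0// invr_gt0 Jm_det.
- move=> a q u; have oW := openI od (dom_open X q).
  apply: (@sf_ext _ _ _ _ (fun y => \sum_k pd X q u (xcoord X p k) y * s y a k)) => //.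
    move=> y [py qy]; rewrite (cfield_chain u qy py) mulmx_suml summxE; apply: eq_bigr => k _.
    rewrite -scalemxAl scalemxE; congr (_ * _).
    have := tpmE p (fun y (a : 'I_4) => row a (th y) : T) y a k.
    by rewrite /tpm cE thJ// => ->.
  apply: sf_sum => // k _; apply: sf_mul => //.
    by have := sf_pd q u (dom_open X p) (sf_coord X p k).
  by apply: sf_sub (ss a k) => y [].
Qed.

Lemma ip2_lin x (a : R) S S' W : ip2 X x (a *: S + S') W = a * ip2 X x S W + ip2 X x S' W.
Proof.
rewrite !ip2E mulmxDr !mulmxDl -scalemxAr -!scalemxAl mxtraceD mxtraceZ; ring.
Qed.

Lemma coframe_frame U t : oriented_coframe X U t ->
  exists e : forall y, 'I_3 -> fib LP y, @lframe R M LP U e.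
Proof.
move=> ct; exists (fun y i => vsproj (selfdual X y) (Sigma (t y) i)); exists t => // x Ux i.
have [on dp] := coframe_th ct Ux.
by rewrite vsprojK// Sigma_hat; apply/(selfdual_hat on dp); exists (unit3 R i).
Qed.

Lemma lframe_hat U (e : forall y, 'I_3 -> fib LP y) : @lframe R M LP U e ->
  exists2 t, oriented_coframe X U t &
    forall x, U x -> forall i, vsval (e x i) = hatQ (cofm (t x)) (unit3 R i).
Proof. by move=> [t ct te]; exists t => // x Ux i; rewrite te// Sigma_hat. Qed.

Lemma hatQ_sum th c : hatQ th c = \sum_i c i *: hatQ th (unit3 R i) :> 'M[R]_4.
Proof.
rewrite /hatQ (eq_bigr (fun i => kap *: (th^T *m (c i *: Qm (unit3 R i)) *m th))) => [|i _]; last first.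
  by rewrite scalerA mulrC -scalerA -scalemxAr -scalemxAl.
rewrite -scaler_sumr -mulmx_suml -mulmx_sumr; congr (_ *: (_ *m _ *m _)).
by rewrite sum3; apply: mx4P; rewrite !addmxE !scalemxE !QmE /unit3 !z3eq ?eqxx /=; split; ring.
Qed.

Lemma selfdual_dim x : \dim {: fib LP x} = 3%N.
Proof.
have [t ct] := coframe_exists x; have [e fe] := coframe_frame ct.
have [on dp] := coframe_th ct (dom_self X x).
have [t' ct' te] := lframe_hat fe; have {}te := te x (dom_self X x).
have [on' dp'] := coframe_th ct' (dom_self X x).
pose b := [tuple e x i | i < 3].
have bE (i : 'I_3) : b`_i = e x i by exact: nth_mktuple.
have fr : free b.
  apply/freeP => k; rewrite (eq_bigr (fun i => k i *: e x i)) => [|i _]; last by rewrite bE.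
  move=> h i; have /(congr1 vsval) := h; rewrite linear_sum linear0.
  rewrite (eq_bigr (fun i => k i *: hatQ (cofm (t' x)) (unit3 R i))) => [|j _]; last by rewrite linearZ /= te.
  rewrite -hatQ_sum => h0; have := ip2_hatQ on' dp' k (unit3 R i).
  rewrite h0 (bigD1 i)//= big1 => [|j ji]; last by rewrite /unit3 eq_sym (negbTE ji) mulr0.
  rewrite /unit3 eqxx mulr1 addr0 => <-.
  by have := ip2_lin x 1 0 0 (hatQ (cofm (t' x)) (unit3 R i)); rewrite scaler0 addr0 mul1r; move: (ip2 _ _ _ _) => z; lra.
have sp : (fullv <= <<b>>)%VS.
  apply/subvP => v _; have /(selfdual_hat on' dp')[c vc] := subvsP v.
  have -> : v = \sum_i c i *: e x i.
    apply: val_inj; rewrite -[LHS]/(vsval v) -[RHS]/(vsval (\sum_i c i *: e x i)) vc hatQ_sum.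
    rewrite [RHS]linear_sum; apply: eq_bigr => i _; by rewrite [RHS]linearZ /= te.
  apply: rpred_sum => i _; apply: rpredZ; rewrite -bE; apply: memv_span; rewrite mem_nth// size_tuple.
  exact: ltn_ord.
have bb : basis_of fullv b by rewrite /basis_of fr eqEsubv subvf sp.
by rewrite -(size_basis bb).
Qed.

Lemma frame_on_hat U (e : forall y, 'I_3 -> fib LP y) x : @lframe R M LP U e -> U x ->
  forall i j, ip (e x i) (e x j) = (i == j)%:R.
Proof.
move=> /lframe_hat[t ct te] Ux i j; have [on dp] := coframe_th ct Ux.
rewrite /ip /= !te// (ip2_hatQ on dp) (bigD1 i)//= big1 => [|k ki]; last by rewrite /unit3 eq_sym (negbTE ki) mul0r.
by rewrite /unit3 eqxx mul1r addr0 eq_sym.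
Qed.

(** Any two of the frames Sigma have the same orientation, because the cubic
    form of triple_hatQ depends on the metric alone. *)
Theorem LambdaP_oriented_euclidean : oriented_euclidean3 X LP.
Proof.
split.
- exact: selfdual_dim.
- move=> x u v; have [t ct] := coframe_exists x; have [on dp] := coframe_th ct (dom_self X x).
  have /(selfdual_hat on dp)[c uc] := subvsP u; have /(selfdual_hat on dp)[d vd] := subvsP v.
  by rewrite /ip /= uc vd !(ip2_hatQ on dp); apply: eq_bigr => i _; rewrite mulrC.
- move=> x a u v w; rewrite -[LHS]/(ip2 X x (vsval (a *: u + v)) (vsval w)) linearP; exact: ip2_lin.
- move=> x u u0; have [t ct] := coframe_exists x; have [on dp] := coframe_th ct (dom_self X x).
  have /(selfdual_hat on dp)[c uc] := subvsP u; rewrite /ip /= uc (ip2_hatQ on dp).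
  rewrite lt_neqAle; apply/andP; split; last by apply: sumr_ge0 => i _; rewrite -expr2 sqr_ge0.
  rewrite eq_sym psumr_eq0; last by move=> i _; rewrite -expr2 sqr_ge0.
  apply: contra u0 => /allP h; apply/eqP; apply: val_inj.
  rewrite -[LHS]/(vsval u) -[RHS]/(vsval 0) linear0 uc hatQ_sum big1// => i _.
  by have := h i (mem_index_enum i); rewrite /= -expr2 sqrf_eq0 => /eqP ->; rewrite scale0r.
- by move=> U e /lframe_hat[t ct _]; exact: (coframe_open ct).
- by move=> U e fe x Ux; exact: frame_on_hat fe Ux.
- move=> x; have [t ct] := coframe_exists x; have [e fe] := coframe_frame ct.
  by exists (dom x), e; split=> //; exact: dom_self.
- move=> U e /lframe_hat[t ct te] i V f /lframe_hat[s cs fs] j.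
  have oU := coframe_open ct; have oV := coframe_open cs.
  have oW := openI oU oV.
  apply: (@sf_ext _ _ _ _ (fun y => ip2 X y (hatQ (cofm (t y)) (unit3 R i)) (hatQ (cofm (s y)) (unit3 R j)))) => //.
    by move=> y [Uy Vy]; rewrite /ip /= te// fs.
  apply: sf_ip2 => // p a b.
    by apply: sf_sub (sf_hatQ p (unit3 R i) ct a b) => y [[? ?] ?].
  by apply: sf_sub (sf_hatQ p (unit3 R j) cs a b) => y [[? ?] ?].
- move=> U V e f /lframe_hat[t ct te] /lframe_hat[s cs fs] x Ux Vx.
  have [on dp] := coframe_th ct Ux; have [on' dp'] := coframe_th cs Vx.
  pose P : 'M[R]_3 := \matrix_(i, j) ip (e x i) (f x j).
  have fP j : hatQ (cofm (s x)) (unit3 R j) = hatQ (cofm (t x)) (fun i => P i j).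
    have /(selfdual_hat on dp)[c fc] := subvsP (f x j).
    rewrite -fs// fc; congr hatQ; apply/funext => i.
    rewrite /P mxE /ip /= te// fc (ip2_hatQ on dp) (bigD1 i)//= big1 => [|k ki]; last by rewrite /unit3 eq_sym (negbTE ki) mul0r.
    by rewrite /unit3 eqxx mul1r addr0.
  have := triple_hatQ on dp (fun i => P i 0) (fun i => P i 1) (fun i => P i 2%:R).
  rewrite -!fP (triple_hatQ on' dp').
  have -> : \matrix_(i, j) (if i == 0 then unit3 R 0 j else if i == 1 then unit3 R 1 j else unit3 R 2%:R j) = 1%:M :> 'M[R]_3.
    by apply/matrixP => i j; rewrite !mxE /unit3; move: i; apply: I3P; rewrite ?z3eq ?eqxx.
  have -> : \matrix_(i, j) (if i == 0 then P j 0 else if i == 1 then P j 1 else P j 2%:R) = P^T :> 'M[R]_3.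
    by apply/matrixP => i j; rewrite !mxE; move: i; apply: I3P; rewrite ?z3eq ?eqxx.
  rewrite det1 det_tr mulr1 => h.
  have k0 : - 4 * kap ^+ 3 != 0 by rewrite mulf_neq0 ?oppr_eq0 ?pnatr_eq0// expf_neq0// kap_neq0.
  by have : \det P = 1 by [apply: (mulfI k0); rewrite mulr1]; rewrite /P => ->; exact: ltr01.
Qed.

End SelfDualBundle.

(** * The Levi-Civita connection on self-dual two-forms *)

Section MatrixCalculus.
Context (R : realType) (M : topologicalType) (X : oriented_riemannian4 R M).
Local Notation T := 'rV[R]_4.
Local Notation dom p := (cdom (chart_at X p)).
Local Notation sf := (smooth_fun X).
Local Notation sfn := (smooth_fun_near X).
Implicit Types (x y p q : M) (U V : set M) (u v a b c : T).

Definition mpd p u m n (A : M -> 'M[R]_(m, n)) y : 'M[R]_(m, n) :=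
  \matrix_(i, j) pd X p u (fun z => A z i j) y.

Lemma mpdE p u m n (A : M -> 'M[R]_(m, n)) y i j : mpd p u A y i j = pd X p u (fun z => A z i j) y.
Proof. by rewrite mxE. Qed.

Definition sfmxn x m n (A : M -> 'M[R]_(m, n)) := forall i j, sfn x (fun z => A z i j).

Lemma sfmx_near x U m n (A : M -> 'M[R]_(m, n)) : open U -> U x -> sfmx X U A -> sfmxn x A.
Proof. by move=> oU Ux sA i j; exists U. Qed.

Lemma sfmxn_mul x m n r (A : M -> 'M[R]_(m, n)) (B : M -> 'M[R]_(n, r)) :
  sfmxn x A -> sfmxn x B -> sfmxn x (fun z => A z *m B z).
Proof.
move=> sA sB i j; have := sfn_sum (index_enum 'I_n) (fun k => sfn_mul (sA i k) (sB k j)).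
by congr sfn; apply/funext => z; rewrite mxE.
Qed.

Lemma sfmxn_tr x m n (A : M -> 'M[R]_(m, n)) : sfmxn x A -> sfmxn x (fun z => (A z)^T).
Proof.
by move=> sA i j; have := sA j i; congr sfn; apply/funext => z; rewrite mxE.
Qed.

Lemma mpd_mul p u m n r (A : M -> 'M[R]_(m, n)) (B : M -> 'M[R]_(n, r)) x : dom p x ->
  sfmxn x A -> sfmxn x B ->
  mpd p u (fun z => A z *m B z) x = mpd p u A x *m B x + A x *m mpd p u B x.
Proof.
move=> px sA sB; apply/matrixP => i j; rewrite addmxE [LHS]mxE [X in X + _]mxE [X in _ + X]mxE -big_split /=.
have -> : (fun z => (A z *m B z) i j) = (fun z => \sum_k A z i k * B z k j) by apply/funext => z; rewrite mxE.
rewrite pd_sum => [|//|k]; last exact: sfn_mul.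
by apply: eq_bigr => k _; rewrite pd_mul// ![mpd _ _ _ _ _ _]mxE.
Qed.

Lemma mpd_tr p u m n (A : M -> 'M[R]_(m, n)) x : mpd p u (fun z => (A z)^T) x = (mpd p u A x)^T.
Proof.
apply/matrixP => i j; rewrite [LHS]mxE [RHS]mxE [RHS]mxE; congr (pd _ _ _ _ _).
by apply/funext => z; rewrite mxE.
Qed.

Lemma mpd_tr_trace p u n (A : M -> 'M[R]_n) x : dom p x -> sfmxn x A ->
  pd X p u (fun z => \tr (A z)) x = \tr (mpd p u A x).
Proof. by move=> px sA; rewrite pd_sum//; apply: eq_bigr => i _; rewrite [RHS]mxE. Qed.

Lemma mpd_ext p u m n (A B : M -> 'M[R]_(m, n)) x U : dom p x -> open U -> U x ->
  (forall z, U z -> A z = B z) -> mpd p u A x = mpd p u B x.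
Proof.
move=> px oU Ux AB; apply/matrixP => i j; rewrite [LHS]mxE [RHS]mxE.
by apply: (pd_ext u px oU Ux) => z Uz; rewrite AB.
Qed.

Lemma mpd_cst p u m n (A : 'M[R]_(m, n)) x : mpd p u (fun=> A) x = 0.
Proof. by apply/matrixP => i j; rewrite [LHS]mxE pd_cst [RHS]mxE. Qed.

Lemma mpd_linv p r u v m n (A : M -> 'M[R]_(m, n)) x : dom p x -> sfmxn x A ->
  mpd p (r *: u + v) A x = r *: mpd p u A x + mpd p v A x.
Proof.
move=> px sA; apply/matrixP => i j; rewrite addmxE scalemxE [LHS]mxE [X in _ = r * X + _]mxE [X in _ = _ + X]mxE.
exact: pd_linv.
Qed.

Lemma mpd_inv p u n (A : M -> 'M[R]_n) x U : dom p x -> open U -> U x ->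
  (forall z, U z -> A z \in unitmx) -> sfmx X U A ->
  mpd p u (fun z => invmx (A z)) x = - (invmx (A x) *m mpd p u A x *m invmx (A x)).
Proof.
move=> px oU Ux uA sA; have sI := sf_invmx oU uA sA.
have := mpd_mul u px (sfmx_near oU Ux sA) (sfmx_near oU Ux sI).
rewrite (@mpd_ext p u _ _ _ (fun=> 1%:M) x U)// ?mpd_cst; last by move=> z Uz; rewrite mulmxV// uA.
move/esym/eqP; rewrite addrC addr_eq0 => /eqP h.
by rewrite -[LHS](mulKmx (uA x Ux)) h mulmxN mulmxA.
Qed.

Lemma pd_cfield p u f y : dom p y -> sfn y f -> pd X p u f y = pd X y (cfield X p u y) f y.
Proof.
move=> py sy; rewrite (pd_chain u py (dom_self X y) sy) (rV_basis (cfield X p u y)) pd_sumv//.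
  by apply: eq_bigr => k _; rewrite cfieldE.
exact: dom_self.
Qed.

Lemma mpd_cfield p u m n (A : M -> 'M[R]_(m, n)) y : dom p y -> sfmxn y A ->
  mpd p u A y = mpd y (cfield X p u y) A y.
Proof. by move=> py sA; apply/matrixP => i j; rewrite [LHS]mxE [RHS]mxE; exact: pd_cfield. Qed.

Lemma bilDl (S : 'M[R]_4) r u v w : bil S (r *: u + v) w = r * bil S u w + bil S v w.
Proof. by rewrite /bil !mulmxDl -!scalemxAl addmxE scalemxE. Qed.

Lemma bilDr (S : 'M[R]_4) r u v w : bil S w (r *: u + v) = r * bil S w u + bil S w v.
Proof. by rewrite /bil linearP mulmxDr -scalemxAr addmxE scalemxE. Qed.

Lemma bilS (r : R) (S S' : 'M[R]_4) v w : bil (r *: S + S') v w = r * bil S v w + bil S' v w.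
Proof. by rewrite /bil mulmxDr mulmxDl -scalemxAr -scalemxAl addmxE scalemxE. Qed.

Lemma bil_mul (S A B : 'M[R]_4) a b : bil (A *m S *m B^T) a b = bil S (a *m A) (b *m B).
Proof. by rewrite /bil trmx_mul !mulmxA. Qed.

End MatrixCalculus.

Section ChangeOfChart.
Context (R : realType) (M : topologicalType) (X : oriented_riemannian4 R M).
Local Notation T := 'rV[R]_4.
Local Notation dom p := (cdom (chart_at X p)).
Local Notation sf := (smooth_fun X).
Local Notation sfn := (smooth_fun_near X).
Local Notation J := (Jm X).
Local Notation chm := (chm X).
Local Notation mpd := (mpd X).
Implicit Types (x y p q : M) (U V : set M) (u v a b c : T) (B : M -> 'M[R]_4).

(** The matrix of the coordinate fields of the chart at p in the basis of
    those of the chart at q. *)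
Definition trans p q z : 'M[R]_4 := \matrix_(i, k) pd X p (dvec i) (xcoord X q k) z.

Lemma trans_J p q z : dom p z -> dom q z -> J p z = trans p q z *m J q z.
Proof.
move=> pz qz; apply/row_matrixP => i; rewrite row_mul !rowE -cfieldJ (cfield_chain _ pz qz).
rewrite [dvec i *m trans _ _ _]rV_basis mulmx_suml; apply: eq_bigr => k _.
by rewrite -scalemxAl -cfieldJ -rowE [row i _ 0 k]mxE [trans _ _ _ _ _]mxE.
Qed.

Lemma chm_trans p q B z : dom p z -> dom q z -> chm p B z = trans p q z *m chm q B z *m (trans p q z)^T.
Proof. by move=> pz qz; rewrite /chm (trans_J pz qz) trmx_mul !mulmxA. Qed.

Lemma trans_self p y : dom p y -> trans p y y = J p y.
Proof.
move=> py; apply/matrixP => i k; rewrite mxE -cfieldE// cfieldJ -rowE [LHS]mxE //.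
Qed.

Lemma sf_trans p q : sfmx X (dom p `&` dom q) (trans p q).
Proof.
move=> i k; have oW : open (dom p `&` dom q) by apply: openI; exact: dom_open.
have h := sf_pd p (dvec i) (dom_open X q) (sf_coord X q k).
apply: (@sf_ext _ _ _ _ (pd X p (dvec i) (xcoord X q k))) => //.
  by move=> z _; rewrite [RHS]mxE.
by apply: sf_sub h => z [].
Qed.

(** Smoothness of a field of bilinear forms can be read in any one chart. *)
Lemma sf_chm_chart p q U B : open U -> U `<=` dom p -> sfmx X U (chm p B) -> sfmx X (U `&` dom q) (chm q B).
Proof.
move=> oU Up sB; have oW := openI oU (dom_open X q).
have sN : sfmx X (U `&` dom q) (trans q p).
  by move=> i j; apply: sf_sub (sf_trans q p i j) => z [/Up].
have h : sfmx X (U `&` dom q) (fun z => trans q p z *m chm p B z *m (trans q p z)^T).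
  apply: (sf_mulmx oW); last exact: (sf_trmx oW).
  by apply: (sf_mulmx oW) => // i j; apply: sf_sub (sB i j) => z [].
move=> i j; apply: sf_ext oW _ (h i j) => z [/Up pz qz].
by rewrite [in RHS](chm_trans _ qz pz).
Qed.

Lemma Jm_self y : J y y = 1%:M.
Proof. by apply/row_matrixP => i; rewrite !rowE -cfieldJ cfield_self mulmx1. Qed.

Lemma chm_self B y : chm y B y = B y.
Proof. by rewrite /chm Jm_self trmx1 mul1mx mulmx1. Qed.

Definition hessm p y u : 'M[R]_4 := mpd p u (trans p y) y.

Lemma hessmE p y u a : dom p y -> a *m hessm p y u = hess X p y u a.
Proof.
move=> py; have sx k : sfn y (xcoord X y k) by apply: sfn_coord; exact: dom_self.
rewrite [a *m _]rV_basis; apply: eq_bigr => k _; congr (_ *: _).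
rewrite mxE {2}(rV_basis a).
have [W [oW Wy sW]] : exists W, [/\ open W, W y & sf W (xcoord X y k)] := sx k.
rewrite (@pd_ext _ _ _ _ _ _ (dom p `&` W) _ (fun z => \sum_i a 0 i * pd X p (dvec i) (xcoord X y k) z)) //; last 2 first.
- by apply: openI => //; exact: dom_open.
- by move=> z [pz Wz]; rewrite pd_sumv//; exists W.
rewrite pd_sum => [|//|i]; last by apply: sfn_mul; [exact: sfn_cst | exact: sfn_pd].
apply: eq_bigr => i _; rewrite pd_scale//; last exact: sfn_pd.
congr (_ * _); rewrite [LHS]mxE; congr (pd _ _ _ _ _); by apply/funext => z; rewrite [LHS]mxE.
Qed.

(** Differentiating the components of a field of bilinear forms in two
    charts: the difference involves the second derivatives of the change of
    coordinates. *)
Lemma mpd_chm p c B y : dom p y -> sfmxn X y (chm y B) ->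
  mpd p c (chm p B) y = hessm p y c *m B y *m (J p y)^T + J p y *m B y *m (hessm p y c)^T
    + J p y *m mpd y (cfield X p c y) (chm y B) y *m (J p y)^T.
Proof.
move=> py sB; have yy := dom_self X y.
have oW : open (dom p `&` dom y) by apply: openI; exact: dom_open.
have sN : sfmxn X y (trans p y) by apply: (sfmx_near oW) => //; exact: sf_trans.
rewrite (mpd_ext c py oW (conj py yy) (B := fun z => trans p y z *m chm y B z *m (trans p y z)^T)); last first.
  by move=> z [pz yz]; exact: chm_trans.
have sNB : sfmxn X y (fun z => trans p y z *m chm y B z) by exact: sfmxn_mul.
rewrite (mpd_mul c py sNB (sfmxn_tr sN)) (mpd_mul c py sN sB) (mpd_tr X p c (trans p y)).
rewrite -/(hessm p y c) (trans_self py) chm_self -mpd_cfield// mulmxDl -!addrA; congr (_ + _).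
by rewrite addrC.
Qed.

End ChangeOfChart.

Local Opaque mpd.

Section LeviCivita.
Context (R : realType) (M : topologicalType) (X : oriented_riemannian4 R M).
Local Notation T := 'rV[R]_4.
Local Notation dom p := (cdom (chart_at X p)).
Local Notation sf := (smooth_fun X).
Local Notation sfn := (smooth_fun_near X).
Local Notation J := (Jm X).
Local Notation G := (Gm X).
Local Notation chm := (chm X).
Local Notation mpd := (mpd X).
Local Notation hessm := (hessm X).
Local Notation LP := (LambdaP X).
Local Notation ss := (@smooth_sec R M X LP).
Local Notation ssn := (@smooth_sec_near R M X LP).
Local Notation hLP := (LambdaP_oriented_euclidean X).
Implicit Types (x y p q : M) (U V : set M) (u v a b c : T) (B : M -> 'M[R]_4).

Lemma sfmxn_G p x : dom p x -> sfmxn X x (G p).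
Proof. by move=> px; apply: (sfmx_near (dom_open X p)) => // i j; exact: sf_Gm. Qed.

Lemma pd_bil p u B a b x : dom p x -> sfmxn X x B ->
  pd X p u (fun z => bil (B z) a b) x = bil (mpd p u B x) a b.
Proof.
move=> px sB; have E (S : 'M[R]_4) : bil S a b = \sum_i \sum_j (a 0 i * b 0 j) * S i j.
  rewrite /bil mxE exchange_big; apply: eq_bigr => j _; rewrite !mxE mulr_suml.
  by apply: eq_bigr => i _; ring.
have -> : (fun z => bil (B z) a b) = (fun z => \sum_i \sum_j (a 0 i * b 0 j) * B z i j) by apply/funext => z; rewrite E.
have s1 i j : sfn x (fun z => (a 0 i * b 0 j) * B z i j) by apply: sfn_mul; [exact: sfn_cst | exact: sB].
rewrite pd_sum => [|//|i]; last exact: sfn_sum.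
rewrite E; apply: eq_bigr => i _; rewrite pd_sum => [|//|j]; last exact: s1.
by apply: eq_bigr => j _; rewrite (pd_scale _ _ px (sB i j)) mpdE.
Qed.

Lemma dfunE f y v : dfun X f y v = pd X y v f y. Proof. exact: erefl. Qed.

(** The Koszul formula in the chart at p. *)
Definition kos p u a b y : R :=
  2^-1 * (bil (mpd p u (G p) y) a b + bil (mpd p a (G p) y) u b - bil (mpd p b (G p) y) u a).

Lemma kos_lc y u v b : inner X y (levi_civita X y u v) b = kos y u v b y.
Proof.
have yy := dom_self X y.
have D w c d : dfun X (fun z => inner X z (cfield X y c z) (cfield X y d z)) y w = bil (mpd y w (G y) y) c d.
  rewrite -pd_bil//; last exact: sfmxn_G.
  rewrite dfunE; congr (pd X y w _ y); apply/funext => z; by rewrite Gm_bil.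
rewrite /inner /levi_civita /bil mulmxKV; last exact: posdef_unit (gram_posdef X y).
rewrite -scalemxAl scalemxE /kos; congr (_ * _).
rewrite mxE (eq_bigr (fun k => b 0 k * (bil (mpd y u (G y) y) v (dvec k) + bil (mpd y v (G y) y) u (dvec k) - bil (mpd y (dvec k) (G y) y) u v))); last first.
  by move=> k _; rewrite [X in X * _ = _]mxE [X in _ * X = _]mxE mulrC !D.
rewrite (eq_bigr (fun k => b 0 k * bil (mpd y u (G y) y) v (dvec k) + b 0 k * bil (mpd y v (G y) y) u (dvec k) - b 0 k * bil (mpd y (dvec k) (G y) y) u v)); last by move=> k _; rewrite mulrBr mulrDr.
rewrite sumrB big_split /= {4 5 6}(rV_basis b).
have L (S : 'M[R]_4) w : bil S w (\sum_i b 0 i *: dvec i) = \sum_i b 0 i * bil S w (dvec i).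
  by apply: (@lin_sum _ _ (bil S w)) => r w1 w2; exact: bilDr.
have L' : bil (mpd y (\sum_i b 0 i *: dvec i) (G y) y) u v = \sum_i b 0 i * bil (mpd y (dvec i) (G y) y) u v.
  apply: (@lin_sum _ _ (fun w => bil (mpd y w (G y) y) u v)) => r w1 w2.
  by rewrite mpd_linv// ?bilS//; exact: sfmxn_G.
by congr (_ + _ - _); [exact: esym (L _ _) | exact: esym (L _ _) | exact: esym L'].
Qed.

Lemma innerC y w w' : inner X y w w' = inner X y w' w.
Proof. exact: (sym_bil w w' (gram_sym X y)). Qed.

Lemma bil_sym p y a b : dom p y -> bil (G p y) a b = bil (G p y) b a.
Proof. by move=> py; have [sG _] := Gm_posdef py; exact: sym_bil. Qed.

Lemma inner_inj y w w' : (forall c, inner X y w c = inner X y w' c) -> w = w'.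
Proof.
move=> h; have ug := posdef_unit (gram_posdef X y).
apply: (can_inj (mulmxK ug)); apply/rowP => j; have := h (dvec j).
have e (z : T) : (z *m gram X y) 0 j = inner X y z (dvec j).
  by rewrite -[RHS]/(bil (gram X y) z (dvec j)) /bil trmx_delta -colE [RHS]mxE.
by rewrite !e.
Qed.

Lemma innerDl y r w w' c : inner X y (r *: w + w') c = r * inner X y w c + inner X y w' c.
Proof. exact: (bilDl (gram X y)). Qed.

Lemma mpd_Gm p c y : dom p y ->
  mpd p c (G p) y = hessm p y c *m gram X y *m (J p y)^T + J p y *m gram X y *m (hessm p y c)^T
    + J p y *m mpd y (cfield X p c y) (G y) y *m (J p y)^T.
Proof. by move=> py; exact: (mpd_chm c py (sfmxn_G (dom_self X y))). Qed.

Lemma innerE y w w' : inner X y w w' = bil (gram X y) w w'. Proof. by []. Qed.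

Local Opaque levi_civita inner hess Gm bil.

Lemma levi_civita_lin y u r v v' :
  levi_civita X y u (r *: v + v') = r *: levi_civita X y u v + levi_civita X y u v'.
Proof.
have kosl c : kos y u (r *: v + v') c y = r * kos y u v c y + kos y u v' c y.
  rewrite /kos (mpd_linv r v v' (dom_self X y) (sfmxn_G (dom_self X y))).
  move: (mpd y u _ y) (mpd y v _ y) (mpd y v' _ y) (mpd y c _ y) => A B C D.
  by rewrite bilS (bilDl A) (bilDr D); ring.
apply: (inner_inj (y := y)) => c; rewrite kos_lc kosl innerDl.
congr (_ * _ + _); exact: esym (kos_lc _ _ _ _).
Qed.

Lemma levi_civita_linu y r u u' v :
  levi_civita X y (r *: u + u') v = r *: levi_civita X y u v + levi_civita X y u' v.
Proof.
have kosl c : kos y (r *: u + u') v c y = r * kos y u v c y + kos y u' v c y.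
  rewrite /kos (mpd_linv r u u' (dom_self X y) (sfmxn_G (dom_self X y))).
  move: (mpd y u _ y) (mpd y u' _ y) (mpd y v _ y) (mpd y c _ y) => A B C D.
  by rewrite bilS (bilDl C) (bilDl D); ring.
apply: (inner_inj (y := y)) => c; rewrite kos_lc kosl innerDl.
congr (_ * _ + _); exact: esym (kos_lc _ _ _ _).
Qed.

Definition lc_mx y u : 'M[R]_4 := \matrix_i levi_civita X y u (dvec i).

Lemma lc_mxE y u v : levi_civita X y u v = v *m lc_mx y u.
Proof.
rewrite {1}(rV_basis v).
have -> : v *m lc_mx y u = \sum_i v 0 i *: levi_civita X y u (dvec i).
  rewrite {1}(rV_basis v) mulmx_suml; apply: eq_bigr => i _.
  by rewrite -scalemxAl -rowE rowK.
elim: index_enum => [|i r IH]; last by rewrite !big_cons levi_civita_lin IH.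
rewrite !big_nil; have := levi_civita_lin y u 1 0 0.
by rewrite scaler0 addr0 scale1r => h; apply: (addrI (levi_civita X y u 0)); rewrite addr0 -h.
Qed.

Lemma kos_alg (b1 b2 b3 c1 c2 c3 i1 i2 i3 : R) :
  b1 = i1 + i2 + c1 -> b2 = i1 + i3 + c2 -> b3 = i2 + i3 + c3 ->
  2^-1 * (b1 + b2 - b3) = i1 + 2^-1 * (c1 + c2 - c3).
Proof. by move=> -> -> ->; field. Qed.

Lemma kos_alg2 (b1 b2 c d : R) : b2 = b1 -> 2^-1 * (b1 + c - d) + 2^-1 * (b2 + d - c) = b1.
Proof. by move=> ->; field. Qed.

(** The Koszul expression changes between charts by the Hessian of the change
    of coordinates: the other Hessian terms cancel in pairs. Therefore the
    Levi-Civita derivative, defined at each point in its own chart, is smooth. *)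
Lemma kos_chart p u a b y : dom p y -> kos p u a b y =
  inner X y (a *m hessm p y u) (cfield X p b y)
  + kos y (cfield X p u y) (cfield X p a y) (cfield X p b y) y.
Proof.
move=> py; have yy := dom_self X y; have sG := sfmxn_G yy.
have st c d e : bil (mpd p c (G p) y) d e = inner X y (hess X p y c d) (cfield X p e y)
    + inner X y (cfield X p d y) (hess X p y c e)
    + bil (mpd y (cfield X p c y) (G y) y) (cfield X p d y) (cfield X p e y).
  rewrite (mpd_Gm c py); have D1 (A B : 'M[R]_4) : bil (A + B) d e = bil A d e + bil B d e.
    by have := bilS 1 A B d e; rewrite scale1r mul1r.
  by rewrite !D1 !bil_mul !(hessmE _ _ py) -!cfieldJ -!innerE.
have sy w w' : inner X y w w' = inner X y w' w by exact: innerC.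
have h1 := st u a b; have h2 := st a u b; have h3 := st b u a.
rewrite (hess_sym a u py) in h2; rewrite (hess_sym b u py) (hess_sym b a py) [inner X y (hess _ _ _ u _) _]sy in h3.
by rewrite (hessmE u a py); exact: (kos_alg h1 h2 h3).
Qed.

(** The matrix of the Levi-Civita derivative along u in the chart at p: the term
    hessm accounts for the passage from the chart at y to the chart at p. *)
Definition christoffel p u y : 'M[R]_4 :=
  (hessm p y u + J p y *m lc_mx y (cfield X p u y)) *m invmx (J p y).

Lemma christoffelJ p u y : dom p y -> christoffel p u y *m J p y = hessm p y u + J p y *m lc_mx y (cfield X p u y).
Proof. by move=> py; rewrite mulmxKV// Jm_unit. Qed.

Lemma GmE p y : G p y = J p y *m gram X y *m (J p y)^T. Proof. by []. Qed.

Lemma innerB y (A B : 'M[R]_4) i j : inner X y (dvec i *m A) (dvec j *m B) = (A *m gram X y *m B^T) i j.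
Proof. by rewrite innerE -bil_mul bil_dvec. Qed.

Lemma inner_D y w w' c : inner X y (w + w') c = inner X y w c + inner X y w' c.
Proof. by have := innerDl y 1 w w' c; rewrite scale1r mul1r. Qed.

Lemma christoffel_kos p u y : dom p y -> christoffel p u y *m G p y = \matrix_(i, j) kos p u (dvec i) (dvec j) y.
Proof.
move=> py; rewrite GmE !mulmxA (christoffelJ u py); apply/matrixP => i j.
by rewrite -innerB mulmxDr inner_D mulmxA -!cfieldJ -lc_mxE kos_lc [RHS]mxE (kos_chart u _ _ py).
Qed.

Lemma sf_mpd p u U m n (A : M -> 'M[R]_(m, n)) : open U -> sfmx X U A -> sfmx X (U `&` dom p) (mpd p u A).
Proof.
move=> oU sA i j; have oW := openI oU (dom_open X p).
by apply: sf_ext oW _ (sf_pd p u oU (sA i j)) => y _; rewrite mpdE.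
Qed.

Lemma sf_bil U B a b : open U -> sfmx X U B -> sf U (fun y => bil (B y) a b).
Proof.
move=> oU sB; have c m n (A : 'M[R]_(m, n)) : sfmx X U (fun=> A) by move=> i j; exact: sf_cst.
exact: (sf_mulmx oU (sf_mulmx oU (c _ _ a) sB) (c _ _ b^T)).
Qed.

Lemma sf_christoffel p u : sfmx X (dom p) (christoffel p u).
Proof.
have od := dom_open X p; have sG : sfmx X (dom p) (G p) by move=> i j; exact: sf_Gm.
have sI : sfmx X (dom p) (fun y => invmx (G p y)) by apply: sf_invmx => // y py; exact: Gm_unit.
have sD c : sfmx X (dom p) (mpd p c (G p)) by have := sf_mpd p c od sG; rewrite setIid.
have sK : sfmx X (dom p) (fun y => \matrix_(i, j) kos p u (dvec i) (dvec j) y).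
  move=> i j; apply: (@sf_ext _ _ _ _ (kos p u (dvec i) (dvec j))) => //; first by move=> y _; rewrite [RHS]mxE.
  apply: sf_scale => //; apply: sf_subr => //; last exact: sf_bil.
  by apply: sf_add => //; exact: sf_bil.
move=> i j; apply: sf_ext od _ (sf_mulmx od sK sI i j) => y py.
by rewrite -(christoffel_kos u py) mulmxK// Gm_unit.
Qed.

(** The Levi-Civita connection preserves the metric. *)
Lemma lc_mx_metric y u : lc_mx y u *m gram X y + gram X y *m (lc_mx y u)^T = mpd y u (G y) y.
Proof.
have yy := dom_self X y.
have e i j : (lc_mx y u *m gram X y) i j = kos y u (dvec i) (dvec j) y.
  have := innerB y (lc_mx y u) 1%:M i j; rewrite trmx1 !mulmx1 => <-.
  by rewrite -lc_mxE kos_lc.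
have -> : gram X y *m (lc_mx y u)^T = (lc_mx y u *m gram X y)^T by rewrite trmx_mul gram_sym.
apply/matrixP => i j; rewrite addmxE [X in _ + X]mxE !e -[RHS]bil_dvec.
have : bil (mpd y u (G y) y) (dvec j) (dvec i) = bil (mpd y u (G y) y) (dvec i) (dvec j).
  rewrite !bil_dvec !mpdE; apply: (pd_ext u yy (dom_open X y) yy) => z yz.
  by rewrite -!bil_dvec bil_sym.
by move=> h; exact: (kos_alg2 _ _ h).
Qed.

(** The Levi-Civita derivative of a field of bilinear forms, as a matrix in the
    chart at x. *)
Definition cov_mx x u (s : M -> 'M[R]_4) : 'M[R]_4 :=
  mpd x u (chm x s) x - lc_mx x u *m s x - s x *m (lc_mx x u)^T.

Lemma conj_alg (N D P Q A1 A2 : 'M[R]_4) : N *m (D - P - Q) *m N^T =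
  A1 + A2 + N *m D *m N^T - (A1 + N *m P *m N^T) - (A2 + N *m Q *m N^T).
Proof.
rewrite !mulmxBr !mulmxBl; move: (N *m D *m _) (N *m P *m _) (N *m Q *m _) => a b c.
by apply/matrixP => i j; rewrite !mxE; ring.
Qed.

Lemma cov_mx_chart p u s y : dom p y -> sfmxn X y (chm y s) ->
  chm p (fun z => cov_mx z (cfield X p u z) s) y =
    mpd p u (chm p s) y - christoffel p u y *m chm p s y - chm p s y *m (christoffel p u y)^T.
Proof.
move=> py ns; rewrite (mpd_chm u py ns).
have e1 : christoffel p u y *m chm p s y = hessm p y u *m s y *m (J p y)^T + J p y *m (lc_mx y (cfield X p u y) *m s y) *m (J p y)^T.
  by rewrite /chm !mulmxA christoffelJ// !mulmxDl.
have e2 : chm p s y *m (christoffel p u y)^T = J p y *m s y *m (hessm p y u)^T + J p y *m (s y *m (lc_mx y (cfield X p u y))^T) *m (J p y)^T.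
  by rewrite /chm -mulmxA -trmx_mul christoffelJ// linearD /= mulmxDr trmx_mul !mulmxA.
by rewrite e1 e2; exact: conj_alg.
Qed.

End LeviCivita.

Local Opaque levi_civita inner hess Gm bil.

Section LeviCivitaConnection.
Context (R : realType) (M : topologicalType) (X : oriented_riemannian4 R M).
Local Notation T := 'rV[R]_4.
Local Notation dom p := (cdom (chart_at X p)).
Local Notation sf := (smooth_fun X).
Local Notation sfn := (smooth_fun_near X).
Local Notation J := (Jm X).
Local Notation G := (Gm X).
Local Notation chm := (chm X).
Local Notation mpd := (mpd X).
Local Notation lc_mx := (lc_mx X).
Local Notation cov_mx := (cov_mx X).
Local Notation LP := (LambdaP X).
Local Notation ss := (@smooth_sec R M X LP).
Local Notation ssn := (@smooth_sec_near R M X LP).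
Local Notation hLP := (LambdaP_oriented_euclidean X).
Implicit Types (x y p q : M) (U V : set M) (u v a b c : T) (B : M -> 'M[R]_4).
Implicit Types (s t : forall y, fib LP y).

Definition mxs s y : 'M[R]_4 := mx_of (s y).

Lemma mxs_selfdual s y : mxs s y \in selfdual X y. Proof. exact: subvsP. Qed.

Lemma coframe_at x : exists th, th *m invmx (gram X x) *m th^T = 1%:M /\ 0 < \det th.
Proof.
have [t ct] := coframe_exists X x; exists (cofm (t x)).
exact: coframe_th ct (dom_self X x).
Qed.

Lemma ss_chm U s : open U -> ss U s <-> forall p, sfmx X (U `&` dom p) (chm p (mxs s)).
Proof.
move=> oU; split=> [sU p i j|sU V e fe i].
  have oW := openI oU (dom_open X p); apply: sf_local => y [Uy py].
  have [V [e [fe Vy]]] := lframe_cover hLP y; exists V; split=> //.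
  have oV := frame_open hLP fe; have oWV := openI oW oV.
  have [t ct te] := lframe_hat fe.
  apply: (@sf_ext _ _ _ _ (fun z => \sum_k ip (s z) (e z k) * chm p (fun z => hatQ (cofm (t z)) (unit3 R k)) z i j)) => //.
    move=> z [[Uz pz] Vz].
    have sE : mxs s z = \sum_k ip (s z) (e z k) *: hatQ (cofm (t z)) (unit3 R k).
      rewrite /mxs {1}(frame_expansion hLP (s z) (frame_on hLP fe Vz)).
      rewrite -[LHS]/(vsval (\sum_i ip (s z) (e z i) *: e z i)) [LHS]linear_sum.
      by apply: eq_bigr => k _; rewrite [LHS]linearZ /= te.
    rewrite /chm sE mulmx_sumr mulmx_suml summxE; apply: eq_bigr => k _.
    by rewrite -[_ *m (ip _ _ *: _)]scalemxAr -[(ip _ _ *: _) *m _]scalemxAl scalemxE.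
  apply: sf_sum => // k _; apply: sf_mul => //.
    by apply: sf_sub (sU V e fe k) => z [[? ?] ?].
  by apply: sf_sub (sf_hatQ p (unit3 R k) ct i j) => z [[? ?] ?].
have [t ct te] := lframe_hat fe; have oV := frame_open hLP fe; have oW := openI oU oV.
apply: (@sf_ext _ _ _ _ (fun y => ip2 X y (mxs s y) (hatQ (cofm (t y)) (unit3 R i)))) => //.
  by move=> y [Uy Vy]; rewrite -te.
apply: sf_ip2 => // p a b.
  by apply: sf_sub (sU p a b) => y [[? ?] ?].
by apply: sf_sub (sf_hatQ p (unit3 R i) ct a b) => y [[? ?] ?].
Qed.

Lemma ssn_chm p x s : dom p x -> ssn x s -> sfmxn X x (chm p (mxs s)).
Proof.
move=> px [U [oU Ux /(ss_chm s oU) h]].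
by apply: (sfmx_near (openI oU (dom_open X p))) (h p).
Qed.

Lemma hodge_mx_lin x r (S S' : 'M[R]_4) :
  hodge_mx X x (r *: S + S') = r *: hodge_mx X x S + hodge_mx X x S'.
Proof.
have := hodge_lin X x r S S'; rewrite scalerBr => h.
by apply: (addIr (- (r *: S + S'))); rewrite h opprD addrACA.
Qed.

(** For antisymmetric S this is the self-dual part of the two-form S; of_mx
    projects to an unspecified point of the fibre otherwise. *)
Definition sdproj x (S : 'M[R]_4) : fib LP x := of_mx X x (2^-1 *: (S + hodge_mx X x S)).

Lemma sdproj_lin x r (S S' : 'M[R]_4) : sdproj x (r *: S + S') = r *: sdproj x S + sdproj x S'.
Proof.
rewrite /sdproj hodge_mx_lin; move: (hodge_mx X x S) (hodge_mx X x S') => H H'.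
have -> : 2^-1 *: (r *: S + S' + (r *: H + H')) = r *: (2^-1 *: (S + H)) + 2^-1 *: (S' + H').
  by apply/matrixP => i j; rewrite !(addmxE, scalemxE); ring.
exact: linearP.
Qed.

Lemma sdprojE x (S : 'M[R]_4) : S^T = - S -> mx_of (sdproj x S) = 2^-1 *: (S + hodge_mx X x S).
Proof.
move=> aS; have [th [on dp]] := coframe_at x; apply: vsprojK; apply/selfdualP; split.
  by rewrite linearZ /= linearD /= aS (hodge_anti on dp aS) -opprD scalerN.
have := hodge_mx_lin x 1 S (hodge_mx X x S); rewrite !scale1r (hodgeK on dp aS) => h.
have h0 : hodge_mx X x 0 = 0.
  have := hodge_mx_lin x 1 0 0; rewrite !scale1r addr0 => h1.
  by apply: (addrI (hodge_mx X x 0)); rewrite addr0 -h1.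
have := hodge_mx_lin x 2^-1 (S + hodge_mx X x S) 0; rewrite !addr0 h0 addr0 h => ->.
by rewrite addrC.
Qed.

Lemma sdproj_id x (w : fib LP x) : sdproj x (mx_of w) = w.
Proof.
have /selfdualP[_ h] : mx_of w \in selfdual X x by exact: subvsP.
rewrite /sdproj h; have -> : 2^-1 *: (mx_of w + mx_of w) = mx_of w.
  by apply/matrixP => i j; rewrite !(addmxE, scalemxE); move: (mx_of w i j) => z; field.
exact: vsvalK.
Qed.

(** The star is self-adjoint and fixes w, so that the projection is not seen by
    the inner product. Smoothness and compatibility with the metric can therefore
    be checked before projecting. *)
Lemma ip_sdproj x (S : 'M[R]_4) (w : fib LP x) : S^T = - S -> ip (sdproj x S) w = ip2 X x S (mx_of w).
Proof.
move=> aS; have [th [on dp]] := coframe_at x.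
rewrite -[LHS]/(ip2 X x (mx_of (sdproj x S)) (mx_of w)) sdprojE//.
have /(selfdual_hat on dp)[c ->] : mx_of w \in selfdual X x by exact: subvsP.
have ipD (A B W : 'M[R]_4) : ip2 X x (2^-1 *: (A + B)) W = 2^-1 * (ip2 X x A W + ip2 X x B W).
  have := ip2_lin X x 2^-1 (A + B) 0 W; have := ip2_lin X x 1 A B W; have := ip2_lin X x 1 0 0 W.
  rewrite !addr0 !scale1r !mul1r => h1 -> ->; move: (ip2 _ _ 0 _) h1 => z; lra.
by rewrite ipD (ip2_hodge on dp c aS); move: (ip2 _ _ _ _) => z; field.
Qed.

Lemma cov_mx_lin x r u u' (B : M -> 'M[R]_4) : sfmxn X x (chm x B) ->
  cov_mx x (r *: u + u') B = r *: cov_mx x u B + cov_mx x u' B.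
Proof.
move=> nB; have lE : lc_mx x (r *: u + u') = r *: lc_mx x u + lc_mx x u'.
  apply/matrixP => i j; rewrite addmxE scalemxE [LHS]mxE [X in _ = r * X + _]mxE [X in _ = _ + X]mxE.
  by rewrite levi_civita_linu addmxE scalemxE.
rewrite /cov_mx lE (mpd_linv r u u' (dom_self X x) nB).
move: (mpd x u _ x) (mpd x u' _ x) (lc_mx x u) (lc_mx x u') => D D' L L'.
rewrite [(_)^T]linearP /= mulmxDl mulmxDr -scalemxAl -scalemxAr.
move: (L *m _) (L' *m _) (B x *m L^T) (B x *m L'^T) => a b c d.
by apply/matrixP => i j; rewrite !mxE; ring.
Qed.

Lemma cov_mx_add x u (B B' : M -> 'M[R]_4) : sfmxn X x (chm x B) -> sfmxn X x (chm x B') ->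
  cov_mx x u (fun z => B z + B' z) = cov_mx x u B + cov_mx x u B'.
Proof.
move=> nB nB'; have -> : cov_mx x u (fun z => B z + B' z) =
    mpd x u (chm x B) x + mpd x u (chm x B') x - lc_mx x u *m (B x + B' x) - (B x + B' x) *m (lc_mx x u)^T.
  congr (_ - _ - _); apply/matrixP => i j; rewrite addmxE !mpdE -pd_add//; last exact: dom_self.
  congr (pd X x u _ x); apply/funext => z.
  by rewrite -addmxE; congr (_ i j); rewrite /chm mulmxDr mulmxDl.
rewrite mulmxDl mulmxDr /cov_mx; move: (mpd x u _ x) (mpd x u _ x) => D D'.
move: (lc_mx x u *m _) (lc_mx x u *m _) (_ *m (lc_mx x u)^T) (_ *m (lc_mx x u)^T) => a b c d.
by apply/matrixP => i j; rewrite !mxE; ring.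
Qed.

Lemma cov_mx_leibniz x u (f : M -> R) (B : M -> 'M[R]_4) : sfn x f -> sfmxn X x (chm x B) ->
  cov_mx x u (fun z => f z *: B z) = pd X x u f x *: B x + f x *: cov_mx x u B.
Proof.
move=> nf nB; have xx := dom_self X x; have -> : cov_mx x u (fun z => f z *: B z) =
    pd X x u f x *: B x + f x *: mpd x u (chm x B) x - lc_mx x u *m (f x *: B x) - (f x *: B x) *m (lc_mx x u)^T.
  congr (_ - _ - _); rewrite -(chm_self X B x); apply/matrixP => i j.
  rewrite addmxE !scalemxE !mpdE -pd_mul//.
  congr (pd X x u _ x); apply/funext => z.
  by rewrite -scalemxE; congr (_ i j); rewrite /chm -scalemxAr -scalemxAl.
rewrite -scalemxAl -scalemxAr /cov_mx; move: (pd X x u f x) (mpd x u _ x) => D D'.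
move: (lc_mx x u *m _) (_ *m (lc_mx x u)^T) => a b.
by apply/matrixP => i j; rewrite !mxE; ring.
Qed.

Lemma cov_mx_anti x u s : ssn x s -> (cov_mx x u (mxs s))^T = - cov_mx x u (mxs s).
Proof.
move=> ns; have aS z : (mxs s z)^T = - mxs s z by have /selfdualP[] := mxs_selfdual s z.
have aD : (mpd x u (chm x (mxs s)) x)^T = - mpd x u (chm x (mxs s)) x.
  rewrite -mpd_tr; apply/matrixP => i j; rewrite [RHS]mxE !mpdE -pd_opp; last 2 first.
  - exact: dom_self.
  - exact: (ssn_chm (dom_self X x) ns).
  congr (pd X x u _ x); apply/funext => z.
  have -> : (chm x (mxs s) z)^T = - chm x (mxs s) z.
    by rewrite /chm !trmx_mul trmxK aS mulNmx mulmxN mulmxA.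
  by rewrite mxE.
rewrite /cov_mx !linearB /= aD !trmx_mul trmxK aS mulNmx mulmxN.
move: (lc_mx x u *m _) (_ *m (lc_mx x u)^T) (mpd x u _ x) => a b c.
by apply/matrixP => i j; rewrite !mxE; ring.
Qed.

Lemma Gamma_sdproj x u s : @Gamma R M X x u s = sdproj x (cov_mx x u (mxs s)).
Proof.
rewrite /Gamma; set S := \matrix_(i, j) _; suff -> : S = cov_mx x u (mxs s) by [].
apply/matrixP => i j; rewrite [LHS]mxE /cov_mx !addmxE [X in _ = _ + X + _]mxE [X in _ = _ + _ + X]mxE.
congr (_ - _ - _).
- rewrite mpdE dfunE; congr (pd X x u _ x); apply/funext => z.
  by rewrite -bil_dvec (chm_bil X x (mxs s)).
- rewrite lc_mxE -[RHS]bil_dvec; have := bil_mul (mxs s x) (lc_mx x u) 1%:M (dvec i) (dvec j).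
  by rewrite trmx1 !mulmx1.
- rewrite lc_mxE -[RHS]bil_dvec; have := bil_mul (mxs s x) 1%:M (lc_mx x u) (dvec i) (dvec j).
  by rewrite mul1mx mulmx1.
Qed.

Lemma ip2_sym x (S S' : 'M[R]_4) : ip2 X x S S' = ip2 X x S' S.
Proof.
rewrite !ip2E trmx_inv gram_sym -mxtrace_tr !trmx_mul trmxK trmx_inv gram_sym.
by rewrite !mulmxA mxtrace_mulC !mulmxA.
Qed.

(** With K the inverse metric and L the matrix of the connection, all terms
    containing L cancel by cyclicity of the trace. *)
Lemma trace_alg (K D D' A B L : 'M[R]_4) :
  \tr ((- (K *m L + L^T *m K)) *m A *m K *m B^T + K *m (D + L *m A + A *m L^T) *m K *m B^T
     + K *m A *m (- (K *m L + L^T *m K)) *m B^T + K *m A *m K *m (D' + L *m B + B *m L^T)^T)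
  = \tr (K *m D *m K *m B^T) + \tr (K *m A *m K *m D'^T).
Proof.
have -> : (D' + L *m B + B *m L^T)^T = D'^T + B^T *m L^T + L *m B^T.
  by rewrite !linearD /= !trmx_mul trmxK.
rewrite !(mulmxDr, mulmxDl, mulmxN, mulNmx) !mulmxA !(mxtraceD, raddfN) /=.
have -> : \tr (K *m A *m K *m B^T *m L^T) = \tr (L^T *m K *m A *m K *m B^T).
  by rewrite mxtrace_mulC !mulmxA.
ring.
Qed.

Lemma gram_self x : G x x = gram X x.
Proof. by rewrite GmE Jm_self mul1mx trmx1 mulmx1. Qed.

Lemma ip2_metric x u (A B : M -> 'M[R]_4) : sfmxn X x (chm x A) -> sfmxn X x (chm x B) ->
  pd X x u (fun z => ip2 X z (A z) (B z)) x = ip2 X x (cov_mx x u A) (B x) + ip2 X x (A x) (cov_mx x u B).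
Proof.
move=> nA nB; have xx := dom_self X x; have od := dom_open X x.
pose K z := invmx (G x z); have sG : sfmx X (dom x) (G x) by move=> i j; exact: sf_Gm.
have nK : sfmxn X x K by apply: (sfmx_near od xx); apply: sf_invmx => // z; exact: Gm_unit.
have nKT := sfmxn_tr nK; have nBT := sfmxn_tr nB.
have n1 := sfmxn_mul nKT nA; have n2 := sfmxn_mul n1 nK; have n3 := sfmxn_mul n2 nBT.
rewrite (@pd_ext _ _ _ x u x (dom x) _ (fun z => 2^-1 * \tr ((K z)^T *m chm x A z *m K z *m (chm x B z)^T)))//; last first.
  by move=> z xz; rewrite (ip2_chart _ _ xz).
rewrite pd_scale//; last by apply: sfn_sum => i; exact: n3.
rewrite mpd_tr_trace// (mpd_mul u xx n2 nBT) (mpd_mul u xx n1 nK) (mpd_mul u xx nKT nA) !mpd_tr.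
have gK : gram X x *m K x = 1%:M by rewrite /K gram_self mulmxV// (posdef_unit (gram_posdef X x)).
have Kg : K x *m gram X x = 1%:M by rewrite /K gram_self mulVmx// (posdef_unit (gram_posdef X x)).
have KT : (K x)^T = K x by rewrite /K trmx_inv gram_self gram_sym.
have dK : mpd x u K x = - (K x *m lc_mx x u + (lc_mx x u)^T *m K x).
  rewrite (mpd_inv u xx od xx (fun z => @Gm_unit _ _ _ x z) sG) -/(K x) -lc_mx_metric.
  rewrite mulmxDr mulmxDl !mulmxA Kg mul1mx -!mulmxA gK mulmx1 //.
have dKT : (mpd x u K x)^T = - (K x *m lc_mx x u + (lc_mx x u)^T *m K x).
  by rewrite dK linearN linearD /= !trmx_mul KT trmxK addrC.
rewrite dKT dK KT !chm_self !ip2E -mulrDr; congr (_ * _).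
have -> : invmx (gram X x) = K x by rewrite /K gram_self.
rewrite KT -(trace_alg _ _ _ _ _ (lc_mx x u)); congr (\tr _).
have cE (C : M -> 'M[R]_4) : mpd x u (chm x C) x = cov_mx x u C + lc_mx x u *m C x + C x *m (lc_mx x u)^T.
  by rewrite /cov_mx addrAC !subrK.
rewrite !cE; move: (cov_mx x u A) (cov_mx x u B) => D D'.
by rewrite !mulmxDl.
Qed.

(** The rules for a covariant derivative are inherited from those of cov_mx, by
    Gamma_sdproj; smoothness is read in one chart by cov_mx_chart. *)
Theorem Gamma_so3 : so3_connection X (@Gamma R M X).
Proof.
have nc x s : ssn x s -> sfmxn X x (chm x (mxs s)) by move=> ns; exact: (ssn_chm (dom_self X x) ns).
split.
- move=> x r u v s ns; rewrite !Gamma_sdproj cov_mx_lin ?sdproj_lin//.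
  exact: nc.
- move=> x v s t ns nt; rewrite !Gamma_sdproj.
  have -> : mxs (fun y => s y + t y) = (fun y => mxs s y + mxs t y) by apply/funext => y; exact: linearD.
  rewrite (cov_mx_add v (nc _ _ ns) (nc _ _ nt)).
  by rewrite -[cov_mx x v (mxs s)]scale1r sdproj_lin !scale1r.
- move=> x v f s nf ns; rewrite !Gamma_sdproj.
  have -> : mxs (fun y => f y *: s y) = (fun y => f y *: mxs s y) by apply/funext => y; exact: linearZ.
  rewrite (cov_mx_leibniz v nf (nc _ _ ns)) -dfunE sdproj_lin sdproj_id; congr (_ + _).
  have := sdproj_lin x (f x) (cov_mx x v (mxs s)) 0.
  have s0 : sdproj x 0 = 0.
    have h := sdproj_lin x 1 0 0; rewrite !scale1r addr0 in h.
    by apply: (addrI (sdproj x 0)); rewrite addr0 -h.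
  by rewrite s0 !addr0.
- move=> U s oU sU p u V e fe i.
  have oW := openI oU (dom_open X p); have oV := frame_open hLP fe; have oWV := openI oW oV.
  apply: (@sf_ext _ _ _ _ (fun y => ip2 X y (cov_mx y (cfield X p u y) (mxs s)) (mxs (fun z => e z i) y))) => //.
    move=> y [[Uy py] Vy]; rewrite Gamma_sdproj [RHS]ip_sdproj//; apply: cov_mx_anti.
    by exists U.
  apply: sf_ip2 => // q.
    apply: (@sf_chm_chart _ _ _ p) => //; first by move=> z [[]].
    have /(ss_chm s oU)/(_ p) sp := sU.
    have sWV (m n : nat) (C : M -> 'M[R]_(m, n)) : sfmx X (U `&` dom p) C -> sfmx X (U `&` dom p `&` V) C.
      by move=> h a b; apply: sf_sub (h a b) => z [].
    have sC : sfmx X (U `&` dom p) (christoffel X p u) by move=> a b; apply: sf_sub (sf_christoffel X p u a b) => z [].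
    have sCT := sf_trmx oW sC.
    have sM : sfmx X (U `&` dom p) (mpd p u (chm p (mxs s))).
      by have := sf_mpd p u oW sp; rewrite -setIA setIid.
    apply: sWV => a b.
    have h := sf_subr oW (sf_subr oW (sM a b) (sf_mulmx oW sC sp a b)) (sf_mulmx oW sp sCT a b).
    apply: sf_ext oW _ h => z [Uz pz].
    rewrite (cov_mx_chart u pz); first by rewrite !addmxE [X in _ = _ + X + _]mxE [X in _ = _ + _ + X]mxE.
    by apply: nc; exists U.
  have /(ss_chm _ oV)/(_ q) h := frame_ss hLP i fe.
  by move=> a b; apply: sf_sub (h a b) => z [[? ?] ?].
- move=> x v s t ns nt; rewrite dfunE !Gamma_sdproj.
  have as_ := cov_mx_anti v ns; have at_ := cov_mx_anti v nt.
  rewrite (ip_sdproj _ as_) [X in _ + X](ip_sym hLP) (ip_sdproj _ at_) [X in _ + X]ip2_sym.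
  exact: (ip2_metric v (nc _ _ ns) (nc _ _ nt)).
Qed.

End LeviCivitaConnection.

(** * Inverting the bracket with a definite triple of two-forms *)

Section QuaternionSystem.
Context (R : realType).
Local Notation T := 'rV[R]_4.

Definition rows3 (a b c : 'I_3 -> R) : 'M[R]_3 :=
  \matrix_(i, j) (if i == 0 then a j else if i == 1 then b j else c j).

(** Twice the real part of a product of three imaginary quaternions. *)
Lemma Qm_antitriple a b c :
  Qm a *m Qm b *m Qm c - Qm c *m Qm b *m Qm a = (- 2 * \det (rows3 a b c))%:M.
Proof.
have E (A B C : 'M[R]_4) i j : (A *m B *m C - C *m B *m A) i j =
  (A *m B) i 0 * C 0 j + (A *m B) i 1 * C 1 j + (A *m B) i 2%:R * C 2%:R j + (A *m B) i 3%:R * C 3%:R j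
  - ((C *m B) i 0 * A 0 j + (C *m B) i 1 * A 1 j + (C *m B) i 2%:R * A 2%:R j + (C *m B) i 3%:R * A 3%:R j).
  by rewrite addmxE [X in _ + X]mxE !mulmx4E.
rewrite det3 /rows3 ![(\matrix_(_, _) _) _ _]mxE !z3eq ?eqxx /=.
apply: mx4P; rewrite !E !mulmx4E !QmE ![(_%:M) _ _]mxE !z4eq /= ?mulr0n ?mulr1n; split; ring.
Qed.

Variable H : 'I_3 -> 'I_3 -> R.
Local Notation Q i := (Qm (H i)).
Local Notation D := (\det (\matrix_(i, j) H i j)).

(** The bracket of a one-form with components a and the two-forms with
    quaternions Q i, after identification of three-forms with covectors. *)
Definition brk (a : 'I_3 -> T) (k : 'I_3) : T := a (k + 1) *m Q (k + 2%:R) - a (k + 2%:R) *m Q (k + 1).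

Definition unbrk (c : 'I_3 -> T) (i : 'I_3) : T := (2 * D)^-1 *: \sum_j c j *m (Q i *m Q j).

Lemma anti3 i j k : Q i *m Q j *m Q k - Q k *m Q j *m Q i = (- 2 * \det (rows3 (H i) (H j) (H k)))%:M.
Proof. exact: Qm_antitriple. Qed.

Lemma det_rows3 i j k : \det (rows3 (H i) (H j) (H k)) =
  if (i == j) || (j == k) || (i == k) then 0 else
  if (j == i + 1) then D else - D.
Proof.
rewrite !det3 /rows3 ![(\matrix_(_, _) _) _ _]mxE !z3eq ?eqxx /=.
move: k j i; do 3!apply: I3P; rewrite ?z3E ?z3eq ?eqxx /=; ring.
Qed.

Hypothesis D0 : D != 0.

Lemma mul_anti (a : T) i j k :
  a *m Q i *m Q j *m Q k = a *m Q k *m Q j *m Q i + (- 2 * \det (rows3 (H i) (H j) (H k))) *: a.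
Proof. by rewrite -[X in _ + X]mul_mx_scalar -anti3 mulmxBr !mulmxA addrC subrK. Qed.

(** By anti3 the terms of the sum in which two of the three indices agree
    cancel, and the remaining one is a multiple of a i by the determinant. *)
Lemma brkK a : unbrk (brk a) = a.
Proof.
apply/funext => i; rewrite /unbrk; apply: (scalerI (a := 2 * D)); first by rewrite mulf_neq0// pnatr_eq0.
rewrite scalerA mulfV ?mulf_neq0 ?pnatr_eq0// scale1r sum3 /brk !mulmxBl !mulmxA.
move: i; apply: I3P; rewrite !z3E.
- rewrite (mul_anti (a 1) 2%:R 0 0) (mul_anti (a 2%:R) 1 0 0) (mul_anti (a 0) 1 0 2%:R).
  rewrite !det_rows3 ?z3E ?z3eq ?eqxx /=.
  move: (_ *m Q 0 *m Q 0 *m Q 2%:R) (_ *m Q 0 *m Q 0 *m Q 1) (_ *m Q 2%:R *m Q 0 *m Q 1) => u v w.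
  by apply/rowP => j; rewrite !mxE; ring.
- rewrite (mul_anti (a 1) 2%:R 1 0) (mul_anti (a 0) 2%:R 1 1) (mul_anti (a 2%:R) 0 1 1).
  rewrite !det_rows3 ?z3E ?z3eq ?eqxx /=.
  move: (_ *m Q 0 *m Q 1 *m Q 2%:R) (_ *m Q 1 *m Q 1 *m Q 2%:R) (_ *m Q 1 *m Q 1 *m Q 0) => u v w.
  by apply/rowP => j; rewrite !mxE; ring.
- rewrite (mul_anti (a 2%:R) 0 2%:R 1) (mul_anti (a 0) 1 2%:R 2%:R) (mul_anti (a 1) 0 2%:R 2%:R).
  rewrite !det_rows3 ?z3E ?z3eq ?eqxx /=.
  move: (_ *m Q 1 *m Q 2%:R *m Q 0) (_ *m Q 2%:R *m Q 2%:R *m Q 1) (_ *m Q 2%:R *m Q 2%:R *m Q 0) => u v w.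
  by apply/rowP => j; rewrite !mxE; ring.
Qed.

Lemma unbrkK c : brk (unbrk c) = c.
Proof.
apply/funext => k; rewrite /brk /unbrk -!scalemxAl -scalerBr; apply: (scalerI (a := 2 * D)).
  by rewrite mulf_neq0// pnatr_eq0.
rewrite scalerA mulfV ?mulf_neq0 ?pnatr_eq0// scale1r !sum3 !mulmxDl !mulmxA.
rewrite !(mul_anti _ (k + 1) _ (k + 2%:R)) !det_rows3.
move: k; apply: I3P; rewrite !z3E ?z3eq ?eqxx /=.
- move: (_ *m Q 2%:R *m Q 0 *m Q 1) (_ *m Q 2%:R *m Q 1 *m Q 1) (_ *m Q 2%:R *m Q 2%:R *m Q 1) => u v w.
  by apply/rowP => j; rewrite !mxE; ring.
- move: (_ *m Q 0 *m Q 0 *m Q 2%:R) (_ *m Q 0 *m Q 1 *m Q 2%:R) (_ *m Q 0 *m Q 2%:R *m Q 2%:R) => u v w.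
  by apply/rowP => j; rewrite !mxE; ring.
- move: (_ *m Q 1 *m Q 0 *m Q 0) (_ *m Q 1 *m Q 1 *m Q 0) (_ *m Q 1 *m Q 2%:R *m Q 0) => u v w.
  by apply/rowP => j; rewrite !mxE; ring.
Qed.

End QuaternionSystem.

Section Trilinear.
Context (R : realType).
Local Notation T := 'rV[R]_4.

(** An alternating trilinear form on a four-dimensional space is encoded by
    a covector. *)
Definition dual3 (F : T -> T -> T -> R) (N : 'M[R]_4) : T :=
  let f (i j k : 'I_4) := F (dvec i *m N) (dvec j *m N) (dvec k *m N) in
  \row_b (fun b : 'I_4 => if b == 0 then f 1 2%:R 3%:R else if b == 1 then - f 0 2%:R 3%:R
    else if b == 2%:R then f 0 1 3%:R else - f 0 1 2%:R) b.

Lemma dual3_ext F F' N : (forall u v w, F u v w = F' u v w) -> dual3 F N = dual3 F' N.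
Proof. by move=> h; congr (dual3 _ _); apply/funext => u; apply/funext => v; apply/funext => w. Qed.

Lemma tri_zero (F : T -> T -> T -> R) (N : 'M[R]_4) : N \in unitmx ->
  (forall r u u' v w, F (r *: u + u') v w = r * F u v w + F u' v w) ->
  (forall u v w, F u v w = - F v u w) -> (forall u v w, F u v w = - F u w v) ->
  dual3 F N = 0 -> forall u v w, F u v w = 0.
Proof.
move=> uN lin1 s12 s23 d0.
pose f i j k := F (dvec i *m N) (dvec j *m N) (dvec k *m N).
have dE b := congr1 (fun r : T => r 0 b) d0.
have := dE 0; have := dE 1; have := dE 2%:R; have := dE 3%:R.
rewrite /dual3 ![(\row__ _) _ _]mxE ![(0 : T) _ _]mxE !z4eq /= => /eqP; rewrite oppr_eq0 => /eqP f3 f2 /eqP.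
rewrite oppr_eq0 => /eqP f1 f0.
have f12 i j k : f i j k = - f j i k by exact: s12.
have f23 i j k : f i j k = - f i k j by exact: s23.
have f_0 i j k : f i j k = 0.
  have a1 i' k' : f i' i' k' = 0 by have := f12 i' i' k'; move: (f _ _ _) => z; lra.
  have a2 i' k' : f k' i' i' = 0 by have := f23 k' i' i'; move: (f _ _ _) => z; lra.
  have a3 i' k' : f i' k' i' = 0 by rewrite f12 a2 oppr0.
  have z0 : f 1 2%:R 3%:R = 0 by []. have z1 : f 0 2%:R 3%:R = 0 by [].
  have z2 : f 0 1 3%:R = 0 by []. have z3 : f 0 1 2%:R = 0 by [].
  have P (b c d : 'I_4) : f b c d = 0 -> [/\ f b d c = 0, f c b d = 0, f c d b = 0, f d b c = 0 & f d c b = 0].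
    move=> z; have e1 : f b d c = 0 by rewrite f23 z oppr0.
    have e2 : f c b d = 0 by rewrite f12 z oppr0.
    have e3 : f c d b = 0 by rewrite f23 e2 oppr0.
    have e4 : f d b c = 0 by rewrite f12 e1 oppr0.
    by split=> //; rewrite f12 e3 oppr0.
  have [p1 p2 p3 p4 p5] := P _ _ _ z0; have [q1 q2 q3 q4 q5] := P _ _ _ z1.
  have [r1 r2 r3 r4 r5] := P _ _ _ z2; have [t1 t2 t3 t4 t5] := P _ _ _ z3.
  by move: k j i; do 3!apply: I4P; rewrite ?a1 ?a2 ?a3.
have ex (u : T) : u = \sum_i (u *m invmx N) 0 i *: (dvec i *m N).
  rewrite -{1}(mulmxKV uN u) {1}(rV_basis (u *m invmx N)) mulmx_suml.
  by apply: eq_bigr => i _; rewrite scalemxAl.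
move=> u v w; rewrite (ex u) (@lin_sum _ _ (fun z => F z v w))// big1// => i _; apply/eqP.
rewrite mulf_eq0; apply/orP; right; apply/eqP.
rewrite s12 (ex v) (@lin_sum _ _ (fun z => F z _ w))// big1 ?oppr0// => j _; apply/eqP.
rewrite mulf_eq0; apply/orP; right; apply/eqP.
rewrite s23 s12 (ex w) (@lin_sum _ _ (fun z => F z _ _))// big1 ?oppr0// => k _; apply/eqP.
by rewrite mulf_eq0; apply/orP; right; apply/eqP; exact: f_0.
Qed.

End Trilinear.

Section ThreeForms.
Context (R : realType) (M : topologicalType) (X : oriented_riemannian4 R M).
Local Notation T := 'rV[R]_4.
Local Notation dom p := (cdom (chart_at X p)).
Local Notation sf := (smooth_fun X).
Context (E : bundle3 R M) (hE : oriented_euclidean3 X E).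
Local Notation ss := (@smooth_sec R M X E).
Implicit Types (x y p q : M) (U V : set M) (a b c u v : T).

Lemma ip_frame_sum x (e : 'I_3 -> fib E x) (c : 'I_3 -> R) k : orthonormal e ->
  ip (\sum_i c i *: e i) (e k) = c k.
Proof.
move=> oe; rewrite (ip_suml hE) (bigD1 k)//= big1 => [|j jk]; rewrite (ipZl hE) oe ?eqxx ?(negbTE jk) ?mulr0//.
by rewrite mulr1 addr0.
Qed.

Lemma posdef_frame x (g : 'End(fib E x)) (e : 'I_3 -> fib E x) : orthonormal e ->
  (forall u v : fib E x, ip (g u) v = ip u (g v)) -> (forall u : fib E x, u != 0 -> 0 < ip (g u) u) ->
  posdef (\matrix_(i, j) ip (g (e i)) (e j)).
Proof.
move=> oe hs hp; split; first by apply/matrixP => i j; rewrite !mxE hs (ip_sym hE).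
move=> v v0; pose u : fib E x := \sum_i v 0 i *: e i.
have u0 : u != 0.
  apply: contra v0 => /eqP u0; apply/eqP/rowP => i; rewrite [RHS]mxE.
  by have := congr1 (fun w => ip w (e i)) u0; rewrite (ip0l hE) (ip_frame_sum _ _ oe).
have := hp u u0; congr (0 < _).
have -> : (v *m (\matrix_(i, j) ip (g (e i)) (e j)) *m v^T) 0 0 = \sum_i v 0 i * \sum_j v 0 j * ip (g (e i)) (e j).
  rewrite mxE (eq_bigr (fun k => \sum_i v 0 i * (v 0 k * ip (g (e i)) (e k)))) => [|k _].
    by rewrite exchange_big; apply: eq_bigr => i _; rewrite -mulr_sumr.
  rewrite [(v^T) _ _]mxE [(v *m _) _ _]mxE mulr_suml; apply: eq_bigr => i _.
  by rewrite [(\matrix_(_, _) _) _ _]mxE; ring.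
rewrite {1}/u linear_sum (ip_suml hE); apply: eq_bigr => i _.
rewrite linearZ (ipZl hE) (ip_sumr hE); congr (_ * _); apply: eq_bigr => j _.
by rewrite (ip_sym hE) (ipZl hE) (ip_sym hE).
Qed.

Section Form3.
Context (w : Form E 3) (hw : is_form X w).

Definition val3 x a b c : fib E x := w x (fam 3 [:: a; b; c]).

Lemma val3E x (v : 'I_3 -> T) : w x v = val3 x (v 0) (v 1) (v 2%:R).
Proof. by congr (w x _); apply/funext; apply: I3P. Qed.

Lemma val3_lin1 x r a a' b c : val3 x (r *: a + a') b c = r *: val3 x a b c + val3 x a' b c.
Proof. by have [h _ _] := hw; have := h x (fam 3 [:: a; b; c]) 0 r a a'; rewrite !val3E /upd /= /fam. Qed.

Lemma val3_lin2 x r a a' b c : val3 x b (r *: a + a') c = r *: val3 x b a c + val3 x b a' c.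
Proof. by have [h _ _] := hw; have := h x (fam 3 [:: b; a; c]) 1 r a a'; rewrite !val3E /upd /= /fam. Qed.

Lemma val3_lin3 x r a a' b c : val3 x b c (r *: a + a') = r *: val3 x b c a + val3 x b c a'.
Proof. by have [h _ _] := hw; have := h x (fam 3 [:: b; c; a]) 2%:R r a a'; rewrite !val3E /upd /= /fam. Qed.

Lemma val3_swap12 x a b c : val3 x a b c = - val3 x b a c.
Proof.
have alt d : val3 x d d c = 0 by have [_ h _] := hw; apply: (h x _ 0 1).
have := alt (1 *: a + b); rewrite val3_lin1 !val3_lin2 !alt !scale1r addr0 add0r.
by move/eqP; rewrite addr_eq0 => /eqP.
Qed.

Lemma val3_swap23 x a b c : val3 x a b c = - val3 x a c b.
Proof.
have alt d : val3 x a d d = 0 by have [_ h _] := hw; apply: (h x _ 1 2%:R).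
have := alt (1 *: b + c); rewrite val3_lin2 !val3_lin3 !alt !scale1r addr0 add0r.
by move/eqP; rewrite addr_eq0 => /eqP.
Qed.

Lemma fib_lin_sum (V : lmodType R) x (f : V -> fib E x) (I : Type) (r : seq I) (k : I -> R) (u : I -> V) :
  (forall s (u v : V), f (s *: u + v) = s *: f u + f v) ->
  f (\sum_(i <- r) k i *: u i) = \sum_(i <- r) k i *: f (u i).
Proof.
move=> h; have f0 : f 0 = 0.
  by have := h 1 0 0; rewrite !scale1r addr0 => e; apply: (addrI (f 0)); rewrite addr0 -e.
elim: r => [|i r IH]; first by rewrite !big_nil.
by rewrite !big_cons h IH.
Qed.

Lemma form3_smooth p U (a b c : M -> T) : open U -> U `<=` dom p ->
  sfmx X U a -> sfmx X U b -> sfmx X U c ->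
  ss U (fun y => val3 y (cfield X p (a y) y) (cfield X p (b y) y) (cfield X p (c y) y)).
Proof.
move=> oU Up sa sb sc.
apply: (@ss_ext _ _ _ _ hE _ (fun y => \sum_i a y 0 i *: \sum_j b y 0 j *: \sum_k c y 0 k *:
    val3 y (cfield X p (dvec i) y) (cfield X p (dvec j) y) (cfield X p (dvec k) y))) => //.
  move=> y Uy; rewrite {2}(rV_basis (a y)) cfield_sum (fib_lin_sum (f := fun z => val3 y z _ _)); last first.
    by move=> *; exact: val3_lin1.
  apply: eq_bigr => i _; congr (_ *: _).
  rewrite {2}(rV_basis (b y)) cfield_sum (fib_lin_sum (f := fun z => val3 y _ z _)); last first.
    by move=> *; exact: val3_lin2.
  apply: eq_bigr => j _; congr (_ *: _).
  rewrite {2}(rV_basis (c y)) cfield_sum (fib_lin_sum (f := fun z => val3 y _ _ z)) //.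
  by move=> *; exact: val3_lin3.
apply: ss_sum => // i; apply: ss_scale => //; apply: ss_sum => // j; apply: ss_scale => //.
apply: ss_sum => // k; apply: ss_scale => //.
have [_ _ h] := hw; apply: (ss_sub Up); have := h p (fam 3 [:: dvec i; dvec j; dvec k]).
congr (ss _ _); by apply: functional_extensionality_dep => y; rewrite val3E.
Qed.

End Form3.

End ThreeForms.

Section AdInverse.
Context (R : realType) (M : topologicalType) (X : oriented_riemannian4 R M).
Local Notation T := 'rV[R]_4.
Local Notation dom p := (cdom (chart_at X p)).
Local Notation sf := (smooth_fun X).
Local Notation kap := (@kap R).
Local Notation LP := (LambdaP X).
Local Notation ss := (@smooth_sec R M X LP).
Local Notation hLP := (LambdaP_oriented_euclidean X).
Context (h : Endo X) (hh : Omega0p h).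
Implicit Types (x y p q : M) (U V : set M) (u v z : T).
Local Notation B := (B_of h).

Lemma hom_smooth : smooth_hom X h. Proof. by case: hh. Qed.

Lemma bil_sumS (I : Type) (r : seq I) (k : I -> R) (S : I -> 'M[R]_4) (a b : T) :
  bil (\sum_(i <- r) k i *: S i) a b = \sum_(i <- r) k i * bil (S i) a b.
Proof. by apply: (@lin_sum _ _ (fun S => bil S a b)) => *; exact: bilS. Qed.

Lemma mx_of_sum x (I : Type) (r : seq I) (k : I -> R) (s : I -> fib LP x) :
  mx_of (\sum_(i <- r) k i *: s i) = \sum_(i <- r) k i *: mx_of (s i).
Proof. by rewrite [LHS]linear_sum; apply: eq_bigr => i _; exact: linearZ. Qed.

Lemma B_ip x (v : 'I_2 -> T) (w : fib LP x) : ip (B x v) w = bil (mx_of (h x w)) (v 0) (v 1).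
Proof.
rewrite /B_of (ip_suml hLP) [in RHS](frame_expansion hLP w (onb_on hLP x)).
rewrite [h x _]linear_sum (eq_bigr (fun i => ip w (onb LP x i) *: h x (onb LP x i))) => [|i _]; last exact: linearZ.
rewrite mx_of_sum bil_sumS; apply: eq_bigr => i _.
by rewrite (ipZl hLP) mulrC (ip_sym hLP).
Qed.

Lemma mx_of_anti x (w : fib LP x) : (mx_of w)^T = - mx_of w.
Proof. by have /selfdualP[] : mx_of w \in selfdual X x by exact: subvsP. Qed.

Lemma bil_alt (S : 'M[R]_4) u : S^T = - S -> bil S u u = 0.
Proof.
move=> aS; have tr11 (A : 'M[R]_1) : A 0 0 = A^T 0 0 by rewrite mxE.
have : bil S u u = - bil S u u.
  by rewrite -[LHS]/((u *m S *m u^T) 0 0) tr11 !trmx_mul trmxK aS mulNmx mulmxN mxE mulmxA.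
by move: (bil S u u) => z; lra.
Qed.

Lemma B_form : is_form X B.
Proof.
split.
- move=> x v i r u u'; apply: (fib_inj hLP) => k; rewrite (ipDl hLP) (ipZl hLP) !B_ip.
  by move: i; apply: I2P; rewrite /upd /= ?eqxx /=; [exact: bilDl | exact: bilDr].
- move=> x v i j ij vij; apply: (fib_inj hLP) => k; rewrite (ip0l hLP) B_ip.
  have -> : v 0 = v 1.
    by move: i j ij vij; apply: I2P; apply: I2P; rewrite ?eqxx.
  exact: bil_alt (mx_of_anti _).
- move=> p u V e fe i; have oV := frame_open hLP fe.
  have oW := openI (dom_open X p) oV.
  have se : ss V (fun y => h y (e y i)) by apply: (hom_ss hLP hLP hom_smooth oV); exact: (frame_ss hLP i fe).
  have /(ss_chm _ oV)/(_ p) sc := se.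
  apply: (@sf_ext _ _ _ _ (fun y => bil (chm X p (mxs (fun y => h y (e y i))) y) (u 0) (u 1))) => //.
    by move=> y _; rewrite B_ip chm_bil.
  by apply: sf_bil => // a b; apply: sf_sub (sc a b) => y [].
Qed.

Definition ad_at x (f : T -> fib LP x) u v z : fib LP x :=
  cross (f u) (val2 B x v z) - cross (f v) (val2 B x u z) + cross (f z) (val2 B x u v).

Lemma ad_atE x (f : T -> fib LP x) u v z : ad_at f u v z =
  cross (f u) (val2 B x v z) - cross (f v) (val2 B x u z) + cross (f z) (val2 B x u v).
Proof. by []. Qed.

Lemma ad_ad_at (a : Form LP 1) x (v : 'I_3 -> T) : ad h a x v = ad_at (val1 a x) (v 0) (v 1) (v 2%:R).
Proof.
rewrite /ad (wedge_bracket12 hLP _ _ _ B_form) sum3 /ad_at !lift3E.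
have s0 : (-1) ^+ (0%R : 'I_3) = 1 :> R by [].
have s1 : (-1) ^+ (1%R : 'I_3) = -1 :> R by exact: expr1.
have s2 : (-1) ^+ (2%:R%R : 'I_3) = 1 :> R by rewrite sqrrN expr1n.
by rewrite s0 s1 s2 !scale1r scaleN1r.
Qed.

Lemma ad_at_swap12 x (f : T -> fib LP x) u v z : ad_at f u v z = - ad_at f v u z.
Proof.
rewrite /ad_at (val2_anti B_form x v u) (crossNr hLP).
move: (cross (f u) _) (cross (f v) _) (cross (f z) _) => a b c.
by rewrite !opprD !opprK; congr (_ + _); rewrite addrC.
Qed.

Lemma ad_at_swap23 x (f : T -> fib LP x) u v z : ad_at f u v z = - ad_at f u z v.
Proof.
rewrite /ad_at (val2_anti B_form x z v) (crossNr hLP).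
move: (cross (f u) _) (cross (f v) _) (cross (f z) _) => a b c.
by rewrite !opprD !opprK addrAC.
Qed.

Definition linf x (f : T -> fib LP x) := forall r u v, f (r *: u + v) = r *: f u + f v.

Lemma ad_at_lin1 x (f : T -> fib LP x) r u u' v z : linf f -> ad_at f (r *: u + u') v z = r *: ad_at f u v z + ad_at f u' v z.
Proof.
move=> lf; rewrite /ad_at lf !(val2_linl B_form) (crossDl hLP) (crossZl hLP) !(crossDr hLP) !(crossZr hLP).
move: (cross _ _) (cross _ _) (cross _ _) (cross _ _) (cross _ _) (cross _ _) => a b c d e g.
by rewrite !scalerDr scalerN; apply: (fib_inj hLP) => i; rewrite !(ipE hLP); ring.
Qed.

Section Frame.
Context (y : M) (th : 'M[R]_4) (e : 'I_3 -> fib LP y).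
Hypotheses (dpos : 0 < \det th) (oe : oframe e).
Hypothesis eE : forall i, mx_of (e i) = hatQ th (unit3 R i).

Local Notation N := ((invmx th)^T).
Definition Ev (b : 'I_4) : T := dvec b *m N.
Definition Hc (j m : 'I_3) : R := ip (h y (e j)) (e m).

Lemma N_unit : N \in unitmx.
Proof. by rewrite unitmx_tr unitmx_inv; exact: th_unit. Qed.

Lemma mx_he j : mx_of (h y (e j)) = hatQ th (Hc j).
Proof.
have [ob _] := oe; rewrite {1}(frame_expansion hLP (h y (e j)) ob) mx_of_sum hatQ_sum.
by apply: eq_bigr => i _; rewrite eE.
Qed.

Lemma B_frame b c j : ip (val2 B y (Ev b) (Ev c)) (e j) = kap * Qm (Hc j) b c.
Proof.
rewrite /val2 B_ip mx_he /fam /= -bil_mul bil_dvec hatQE trmxK.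
have -> : N *m (th^T *m (kap *: Qm (Hc j)) *m th) *m invmx th = kap *: Qm (Hc j).
  by rewrite !mulmxA (NthT dpos) mul1mx -mulmxA (thN dpos) mulmx1.
by rewrite scalemxE.
Qed.

Definition al (f : T -> fib LP y) (i : 'I_3) : T := \row_b ip (f (Ev b)) (e i).

(** For a self-dual form Q on R^4, the star of the product of a covector a with Q
    is, up to sign, the covector a Q. The bracket equation thus becomes a system
    in covectors. *)
Lemma dual_ad_at f k : dual3 (fun u v z => ip (ad_at f u v z) (e k)) N = - kap *: brk Hc (al f) k.
Proof.
have F a b c : ip (ad_at f (dvec a *m N) (dvec b *m N) (dvec c *m N)) (e k) =
   kap * (al f (k + 1) 0 a * Qm (Hc (k + 2%:R)) b c - al f (k + 2%:R) 0 a * Qm (Hc (k + 1)) b c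
   - (al f (k + 1) 0 b * Qm (Hc (k + 2%:R)) a c - al f (k + 2%:R) 0 b * Qm (Hc (k + 1)) a c)
   + (al f (k + 1) 0 c * Qm (Hc (k + 2%:R)) a b - al f (k + 2%:R) 0 c * Qm (Hc (k + 1)) a b)).
  rewrite -[LHS]/(ip (ad_at f (Ev a) (Ev b) (Ev c)) (e k)) /ad_at.
  rewrite (ipDl hLP) (ipBl hLP) !(cross_frame hLP _ _ _ oe) !B_frame /al ![(\row__ _) _ _]mxE; ring.
apply/rowP => b; rewrite scalemxE /brk [LHS]mxE [X in _ = _ * X]mxE [X in _ = _ * (_ + X)]mxE !F.
have m4 (a : T) (A : 'M[R]_4) j : (a *m A) 0 j = a 0 0 * A 0 j + a 0 1 * A 1 j + a 0 2%:R * A 2%:R j + a 0 3%:R * A 3%:R j.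
  by rewrite mxE sum4.
rewrite !m4; move: (al f (k + 1)) (al f (k + 2%:R)) (Hc (k + 1)) (Hc (k + 2%:R)) => a1 a2 H1 H2.
by move: b; apply: I4P; rewrite ?z4eq ?eqxx /= !QmE; ring.
Qed.

Local Notation Hm := (\matrix_(i, j) Hc i j : 'M[R]_3).

Lemma Hm_det : \det Hm != 0.
Proof.
have [ob _] := oe; have [_ [hs hp]] := hh.
by have := posdef_unit (posdef_frame hLP ob (hs y) (hp y)); rewrite unitmxE unitfE.
Qed.

Local Opaque ad_at val3.

(** The condition that the one-form f solves the bracket equation becomes a
    linear system for the covectors al f, which the quaternion identities
    solve. *)
Lemma solve_al (w : Form LP 3) (f : T -> fib LP y) : is_form X w -> linf f ->
  (forall u v z, ad_at f u v z = val3 w y u v z) <->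
  (forall i, al f i = unbrk Hc (fun k => (- kap)^-1 *: dual3 (fun u v z => ip (val3 w y u v z) (e k)) N) i).
Proof.
move=> hw lf; have [ob _] := oe; have k0 : - kap != 0 by rewrite oppr_eq0 kap_neq0.
split=> H.
  move=> i; rewrite -[LHS](congr1 (fun g => g i) (brkK Hm_det (al f))); congr (unbrk _ _ _).
  apply/funext => k; apply: (scalerI k0); rewrite scalerA mulfV// scale1r -dual_ad_at.
  by apply: dual3_ext => u v z; exact: (congr1 (fun s => ip s (e k)) (H u v z)).
move=> u v z; apply: (frame_inj hLP ob) => k; apply/eqP; rewrite -subr_eq0; apply/eqP.
pose F u v z := ip (ad_at f u v z) (e k) - ip (val3 w y u v z) (e k).
apply: (@tri_zero R F N N_unit).
- move=> r a a' b c; rewrite /F (ad_at_lin1 _ _ _ _ _ lf) (val3_lin1 hw).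
  move: (ad_at f a b c) (ad_at f a' b c) (val3 w y a b c) (val3 w y a' b c) => t t' s s'.
  by rewrite !(ipDl hLP) !(ipZl hLP) opprD addrACA -mulrBr.
- move=> a b c; rewrite /F ad_at_swap12 (val3_swap12 hw).
  by move: (ad_at f b a c) (val3 w y b a c) => t s; rewrite !(ipNl hLP) opprD.
- move=> a b c; rewrite /F ad_at_swap23 (val3_swap23 hw).
  by move: (ad_at f a c b) (val3 w y a c b) => t s; rewrite !(ipNl hLP) opprD.
have -> : dual3 F N = dual3 (fun u v z => ip (ad_at f u v z) (e k)) N - dual3 (fun u v z => ip (val3 w y u v z) (e k)) N.
  apply/rowP => b; rewrite [LHS]mxE [RHS]mxE [X in _ = X + _]mxE [X in _ = _ + X]mxE [X in _ = _ - X]mxE /F.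
  by move: b; apply: I4P; rewrite ?z4eq ?eqxx /=; ring.
rewrite dual_ad_at; have -> : al f = unbrk Hc (fun k => (- kap)^-1 *: dual3 (fun u v z => ip (val3 w y u v z) (e k)) N).
  by apply/funext => i; exact: H.
by rewrite (unbrkK Hm_det) scalerA mulfV// scale1r subrr.
Qed.

Lemma Ev_th b : Ev b *m th^T = dvec b.
Proof. by rewrite /Ev -mulmxA (NthT dpos) mulmx1. Qed.

Lemma al_expand (f : T -> fib LP y) u : linf f -> f u = \sum_i (\sum_b (u *m th^T) 0 b * al f i 0 b) *: e i.
Proof.
move=> lf; have [ob _] := oe; have uE : u = \sum_b (u *m th^T) 0 b *: Ev b.
  rewrite -{1}[u]mulmx1 -(thNT dpos) mulmxA {1}(rV_basis (u *m th^T)) mulmx_suml.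
  by apply: eq_bigr => b _; rewrite scalemxAl.
rewrite {1}(frame_expansion hLP (f u) ob); apply: eq_bigr => i _; congr (_ *: _).
rewrite {1}uE (fib_lin_sum (f := f))// (ip_suml hLP); apply: eq_bigr => b _.
by rewrite (ipZl hLP) [al f i 0 b]mxE.
Qed.

Lemma solve_unique (w : Form LP 3) (f f' : T -> fib LP y) : is_form X w -> linf f -> linf f' ->
  (forall u v z, ad_at f u v z = val3 w y u v z) -> (forall u v z, ad_at f' u v z = val3 w y u v z) ->
  forall u, f u = f' u.
Proof.
move=> hw lf lf' /(solve_al hw lf) a1 /(solve_al hw lf') a2 u.
rewrite (al_expand u lf) (al_expand u lf'); apply: eq_bigr => i _; congr (_ *: _).
by apply: eq_bigr => b _; rewrite a1 a2.
Qed.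

Definition solf (w : Form LP 3) u : fib LP y := \sum_i (\sum_b (u *m th^T) 0 b *
  unbrk Hc (fun k => (- kap)^-1 *: dual3 (fun u v z => ip (val3 w y u v z) (e k)) N) i 0 b) *: e i.

Lemma solf_lin w : linf (solf w).
Proof.
move=> r u v; rewrite /solf; move: (unbrk _ _) => c.
rewrite scaler_sumr -big_split /=; apply: eq_bigr => i _; rewrite scalerA -scalerDl; congr (_ *: _).
rewrite mulr_sumr -big_split /=; apply: eq_bigr => b _.
by rewrite mulmxDl -scalemxAl addmxE scalemxE; ring.
Qed.

Lemma solf_sol w : is_form X w -> forall u v z, ad_at (solf w) u v z = val3 w y u v z.
Proof.
move=> hw; apply/(solve_al hw (solf_lin w)) => i; have [ob _] := oe.
apply/rowP => b; rewrite [LHS]mxE /solf; move: (unbrk _ _) => c.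
rewrite (ip_frame_sum hLP _ _ ob) Ev_th (bigD1 b)//= big1 => [|d db].
  by rewrite addr0 [dvec b 0 b]mxE !eqxx mul1r.
by rewrite [dvec b 0 d]mxE eqxx (negbTE db) mul0r.
Qed.

End Frame.

Lemma frame_data y : exists V (e : forall y, 'I_3 -> fib LP y) t,
  [/\ @lframe R M LP V e, V y, oriented_coframe X V t &
    forall z : M, V z -> [/\ 0 < \det (cofm (t z)), oframe (e z) & forall i, mx_of (e z i) = hatQ (cofm (t z)) (unit3 R i)]].
Proof.
have [V [e [fe Vy]]] := lframe_cover hLP y; have [t ct te] := lframe_hat fe.
exists V, e, t; split=> // z Vz; have [on dp] := coframe_th ct Vz.
by split=> //; [exact: (lframe_oframe hLP fe Vz) | exact: te].
Qed.

Lemma ad_inj (a a' : Form LP 1) : is_form X a -> is_form X a' -> is_form X (ad h a') -> ad h a = ad h a' -> a = a'.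
Proof.
move=> ha ha' hw E; apply: functional_extensionality_dep => y; apply/funext => v.
have [V [e [t [fe Vy ct fd]]]] := frame_data y; have [dp oe eE] := fd y Vy.
have s2 u w z : ad_at (val1 a' y) u w z = val3 (ad h a') y u w z.
  exact: esym (ad_ad_at a' y (fam 3 [:: u; w; z])).
have s1 u w z : ad_at (val1 a y) u w z = val3 (ad h a') y u w z.
  rewrite -E; exact: esym (ad_ad_at a y (fam 3 [:: u; w; z])).
have la : linf (val1 a y) := fun r u u' => val1_lin y r u u' ha.
have la' : linf (val1 a' y) := fun r u u' => val1_lin y r u u' ha'.
rewrite (val1E a) (val1E a'); exact: (solve_unique dp oe eE hw la la' s1 s2).
Qed.

Lemma sf_Qm U (H : M -> 'I_3 -> R) : open U -> (forall m, sf U (fun y => H y m)) ->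
  sfmx X U (fun y => Qm (H y)).
Proof.
move=> oU sH i j; apply: (@sf_ext _ _ _ _ (fun y => \sum_m H y m * Qm (unit3 R m) i j)) => //.
  move=> y _; rewrite sum3; move: (H y) => c; move: i j.
  by apply: I4P; apply: I4P; rewrite !QmE /unit3 ?z3eq ?eqxx /=; ring.
by apply: sf_sum => // m _; apply: sf_mul => //; exact: sf_cst.
Qed.

Lemma sf_const_mx U m n (A : 'M[R]_(m, n)) : sfmx X U (fun=> A).
Proof. by move=> i j; exact: sf_cst. Qed.

Lemma sf_solf p V (e : forall y, 'I_3 -> fib LP y) t (w : Form LP 3) (u : T) i : is_form X w ->
  @lframe R M LP V e -> oriented_coframe X V t ->
  (forall z : M, V z -> [/\ 0 < \det (cofm (t z)), oframe (e z) & forall i, mx_of (e z i) = hatQ (cofm (t z)) (unit3 R i)]) ->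
  sf (dom p `&` V) (fun y => \sum_b (cfield X p u y *m (cofm (t y))^T) 0 b *
    unbrk (Hc (e y)) (fun k => (- kap)^-1 *: dual3 (fun u v z => ip (val3 w y u v z) (e y k)) (invmx (cofm (t y)))^T) i 0 b).
Proof.
move=> hw fe ct fd; set W := dom p `&` V.
have oV := frame_open hLP fe; have oW : open W := openI (dom_open X p) oV.
have WV : W `<=` V by move=> z [].
have Wp : W `<=` dom p by move=> z [].
have sT : sfmx X W (tpm X p t) by move=> a b; apply: sf_sub (tpm_smooth p ct a b) => z [].
have uT y : W y -> tpm X p t y \in unitmx.
  move=> [py Vy]; have [dp _ _] := fd y Vy.
  by rewrite /tpm unitmx_mul (th_unit dp) unitmx_tr Jm_unit.
have sI := sf_trmx oW (sf_invmx oW uT sT).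
have sA (b : 'I_4) : sfmx X W (fun y => dvec b *m (invmx (tpm X p t y))^T).
  exact: (sf_mulmx oW (sf_const_mx W (dvec b))).
have AE (b : 'I_4) y : W y -> dvec b *m (invmx (cofm (t y)))^T = cfield X p (dvec b *m (invmx (tpm X p t y))^T) y.
  move=> [py Vy]; rewrite cfieldJ -mulmxA; congr (_ *m _); have [dp _ _] := fd y Vy.
  have uc := th_unit dp; have uJ : (Jm X p y)^T \in unitmx by rewrite unitmx_tr Jm_unit.
  have ut : tpm X p t y \in unitmx by apply: uT; split.
  apply: trmx_inj; rewrite trmx_mul !trmxK; apply: (can_inj (mulmxK uc)); rewrite mulVmx//.
  have -> : (Jm X p y)^T *m invmx (tpm X p t y) = invmx (cofm (t y)).
    apply: (can_inj (mulKmx uc)); rewrite mulmxV// mulmxA -/(tpm X p t y) mulmxV//.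
  by rewrite mulVmx.
have sH j m : sf W (fun y => Hc (e y) j m).
  have se : ss V (fun y => h y (e y j)) by apply: (hom_ss hLP hLP hom_smooth oV); exact: (frame_ss hLP j fe).
  by apply: sf_sub (se V e fe m) => z [].
have sQ j := sf_Qm oW (sH j).
have s3 (a b c : 'I_4) k : sf W (fun y => ip (val3 w y (dvec a *m (invmx (cofm (t y)))^T)
    (dvec b *m (invmx (cofm (t y)))^T) (dvec c *m (invmx (cofm (t y)))^T)) (e y k)).
  have := sf_ip hLP oW (form3_smooth hLP hw oW Wp (sA a) (sA b) (sA c)) (ss_sub WV (frame_ss hLP k fe)).
  by apply: sf_ext oW _ => y Wy; rewrite -!AE.
have sC k : sfmx X W (fun y => (- kap)^-1 *: dual3 (fun u v z => ip (val3 w y u v z) (e y k)) (invmx (cofm (t y)))^T).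
  move=> i' b; apply: (@sf_ext _ _ _ _ (fun y => (- kap)^-1 * dual3 (fun u v z => ip (val3 w y u v z) (e y k)) (invmx (cofm (t y)))^T i' b)) => //.
    by move=> y _; rewrite scalemxE.
  apply: sf_scale => //; rewrite ord1; move: b; apply: I4P.
  - by apply: sf_ext oW _ (s3 1 2%:R 3%:R k) => y _; rewrite [RHS]mxE.
  - by apply: sf_ext oW _ (sf_opp oW (s3 0 2%:R 3%:R k)) => y _; rewrite [RHS]mxE.
  - by apply: sf_ext oW _ (s3 0 1 3%:R k) => y _; rewrite [RHS]mxE.
  - by apply: sf_ext oW _ (sf_opp oW (s3 0 1 2%:R k)) => y _; rewrite [RHS]mxE.
apply: sf_sum => // b _; apply: sf_mul => //.
  apply: sf_ext oW _ (sf_mulmx oW (sf_const_mx W u) (sf_trmx oW sT) 0 b) => y _.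
  by rewrite /tpm trmx_mul trmxK mulmxA.
pose D y := \det (\matrix_(i, j) Hc (e y) i j : 'M[R]_3).
apply: (@sf_ext _ _ _ _ (fun y => (2 * D y)^-1 * \sum_j ((- kap)^-1 *: dual3 (fun u v z => ip (val3 w y u v z) (e y j)) (invmx (cofm (t y)))^T *m (Qm (Hc (e y) i) *m Qm (Hc (e y) j))) 0 b)) => //.
  by move=> y _; rewrite /unbrk scalemxE summxE.
apply: sf_mul => //.
  apply: sf_inv => //.
    move=> y [py Vy]; have [_ oe _] := fd y Vy; rewrite mulf_neq0 ?pnatr_eq0//; exact: Hm_det oe.
  apply: sf_scale => //; apply: sf_det => // a c.
  by apply: sf_ext oW _ (sH a c) => y _; rewrite mxE.
apply: sf_sum => // j _; exact: (sf_mulmx oW (sC j) (sf_mulmx oW (sQ i) (sQ j)) 0 b).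
Qed.

(** The local formula solf gives smooth solutions; they agree on overlaps since
    the solution at each point is unique. *)
Lemma ad_surj (w : Form LP 3) : is_form X w -> exists2 a, is_form X a & ad h a = w.
Proof.
move=> hw.
have ex y : exists f : T -> fib LP y, linf f /\ forall u v z, ad_at f u v z = val3 w y u v z.
  have [V [e [t [fe Vy ct fd]]]] := frame_data y; have [dp oe eE] := fd y Vy.
  exists (solf (cofm (t y)) (e y) w); split; first exact: solf_lin.
  exact: (solf_sol dp oe eE hw).
pose f y := proj1_sig (cid (ex y)).
have lf y : linf (f y) by rewrite /f; case: cid => g /= [].
have sf_ y u v z : ad_at (f y) u v z = val3 w y u v z by rewrite /f; case: cid => g /= [].
exists (fun y (v : 'I_1 -> T) => f y (v 0)); last first.
  apply: functional_extensionality_dep => y; apply/funext => v; rewrite (ad_ad_at _ y v) (val3E w y v); exact: sf_.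
split.
- by move=> y /= v i r u u'; rewrite /upd !ord1 !eqxx; exact: lf.
- by move=> y v i j; rewrite !ord1.
move=> p u; apply: (ss_local) => y py.
have [V [e [t [fe Vy ct fd]]]] := frame_data y; exists V; split=> //.
have oV := frame_open hLP fe; have oW := openI (dom_open X p) oV.
have WV : dom p `&` V `<=` V by move=> z [].
have Wp : dom p `&` V `<=` dom p by move=> z [].
have sol_ss : ss (dom p `&` V) (fun z : M => solf (cofm (t z)) (e z) w (cfield X p (u 0) z)).
  apply: (ss_sum hLP) => // i; apply: (ss_scale hLP) => //; last by apply: (ss_sub WV); exact: (frame_ss hLP i fe).
  exact: (sf_solf p (u 0) i hw fe ct fd).
apply: (ss_ext hLP oW _ sol_ss) => z [pz Vz]; have [dp oe eE] := fd z Vz.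
exact: (solve_unique dp oe eE hw (solf_lin (cofm (t z)) (e z) w) (lf z) (solf_sol dp oe eE hw) (sf_ z)).
Qed.

End AdInverse.

Local Opaque ad_at val3.

(** * The curvature homomorphism and the equation for h *)

Section CurvatureHom.
Context (R : realType) (M : topologicalType) (X : oriented_riemannian4 R M).
Local Notation T := 'rV[R]_4.
Local Notation dom p := (cdom (chart_at X p)).
Local Notation sf := (smooth_fun X).
Local Notation LP := (LambdaP X).
Local Notation hLP := (LambdaP_oriented_euclidean X).
Context (E : bundle3 R M) (hE : oriented_euclidean3 X E).
Implicit Types (x y p q : M) (U V : set M) (u v a b : T).

Lemma det4_lin3 r (u u' v w z : T) : det4 v w (r *: u + u') z = r * det4 v w u z + det4 v w u' z.
Proof. by rewrite !det4E /= !(addmxE, scalemxE); ring. Qed.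

Lemma det4_lin4 r (u u' v w z : T) : det4 v w z (r *: u + u') = r * det4 v w z u + det4 v w z u'.
Proof. by rewrite !det4E /= !(addmxE, scalemxE); ring. Qed.

Lemma bil_ext (phi : T -> T -> R) u v :
  (forall r a a' b, phi (r *: a + a') b = r * phi a b + phi a' b) ->
  (forall r a a' b, phi b (r *: a + a') = r * phi b a + phi b a') ->
  phi u v = bil (\matrix_(i, j) phi (dvec i) (dvec j)) u v.
Proof.
move=> l1 l2.
rewrite {1}(rV_basis u) (@lin_sum _ _ (fun a => phi a v)); last by move=> *; exact: l1.
rewrite {2}(rV_basis u) (@lin_sum _ _ (fun a => bil _ a v)); last by move=> *; exact: bilDl.
apply: eq_bigr => i _; congr (_ * _).
rewrite {1}(rV_basis v) (@lin_sum _ _ (phi _)); last by move=> *; exact: l2.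
rewrite {2}(rV_basis v) (@lin_sum _ _ (bil _ _)); last by move=> *; exact: bilDr.
by apply: eq_bigr => j _; rewrite bil_dvec mxE.
Qed.

Section Form.
Context (w : Form E 2) (hw : is_form X w).

(** The two-form obtained by pairing the coefficients of w with s. *)
Definition pairm x (s : fib E x) : 'M[R]_4 := \matrix_(i, j) ip (val2 w x (dvec i) (dvec j)) s.

Lemma pairmE x s u v : ip (val2 w x u v) s = bil (pairm s) u v.
Proof.
apply: (bil_ext (phi := fun u v => ip (val2 w x u v) s)) => [r a a' b|r a a' b].
  by rewrite (val2_linl hw) (ipDl hE) (ipZl hE).
by rewrite (val2_linr hw) (ipDl hE) (ipZl hE).
Qed.

Lemma pairm_anti x (s : fib E x) : (pairm s)^T = - pairm s.
Proof. by apply/matrixP => i j; rewrite !mxE (val2_anti hw) (ipNl hE). Qed.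

Lemma starc_lin1 x i j r u u' v : starc X x i j (r *: u + u') v = r * starc X x i j u v + starc X x i j u' v.
Proof.
rewrite /starc [r * (_ * _)]mulrCA -mulrDr; congr (_ * _); rewrite mulr_sumr -big_split /=.
apply: eq_bigr => k _; rewrite mulr_sumr -big_split /=; apply: eq_bigr => l _.
by rewrite /vol -!/(det4 _ _ _ _) det4_lin3; ring.
Qed.

Lemma starc_lin2 x i j r u u' v : starc X x i j v (r *: u + u') = r * starc X x i j v u + starc X x i j v u'.
Proof.
rewrite /starc [r * (_ * _)]mulrCA -mulrDr; congr (_ * _); rewrite mulr_sumr -big_split /=.
apply: eq_bigr => k _; rewrite mulr_sumr -big_split /=; apply: eq_bigr => l _.
by rewrite /vol -!/(det4 _ _ _ _) det4_lin4; ring.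
Qed.

(** The star acts on the form factor and commutes with pairing of coefficients. *)
Lemma hodge_pairm x s u v : ip (val2 (hodge X w) x u v) s = bil (hodge_mx X x (pairm s)) u v.
Proof.
have hE' a b : ip (val2 (hodge X w) x a b) s =
    \sum_i \sum_j starc X x i j a b * ip (val2 w x (dvec i) (dvec j)) s.
  rewrite /val2 /hodge (ip_suml hE); apply: eq_bigr => i _; rewrite (ip_suml hE).
  by apply: eq_bigr => j _; rewrite (ipZl hE).
rewrite (bil_ext (phi := fun u v => ip (val2 (hodge X w) x u v) s)).
- congr (bil _ u v); apply/matrixP => a b; rewrite mxE [RHS]mxE hE'.
  by apply: eq_bigr => i _; apply: eq_bigr => j _; rewrite [pairm s i j]mxE.
- move=> r a a' b; rewrite !hE' mulr_sumr -big_split; apply: eq_bigr => i _.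
  by rewrite mulr_sumr -big_split; apply: eq_bigr => j _ /=; rewrite starc_lin1; ring.
- move=> r a a' b; rewrite !hE' mulr_sumr -big_split; apply: eq_bigr => i _.
  by rewrite mulr_sumr -big_split; apply: eq_bigr => j _ /=; rewrite starc_lin2; ring.
Qed.

Lemma bil_half (S S' : 'M[R]_4) u v : bil (2^-1 *: (S + S')) u v = 2^-1 * (bil S u v + bil S' u v).
Proof.
have := bilS 2^-1 (S + S') 0 u v; have := bilS 1 S S' u v; have := bilS 1 0 0 u v.
rewrite !scale1r !addr0 !mul1r => h1 -> ->; move: (bil 0 u v) h1 => z; lra.
Qed.

Lemma sdpart_sdproj x s (v : 'I_2 -> T) :
  ip (sdpart X w x v) s = bil (mx_of (sdproj X x (pairm s))) (v 0) (v 1).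
Proof.
rewrite (sdprojE X x (pairm_anti s)) bil_half /sdpart (ipZl hE) (ipDl hE).
by rewrite (val2E w x v) (val2E (hodge X w) x v) pairmE hodge_pairm.
Qed.

Lemma pairm_lin x r (s s' : fib E x) : pairm (r *: s + s') = r *: pairm s + pairm s'.
Proof.
by apply/matrixP => i j; rewrite addmxE scalemxE !mxE !(ip_sym hE (val2 _ _ _ _)) (ipDl hE) (ipZl hE).
Qed.

Lemma pairm_smooth p U (s : forall y, fib E y) : open U -> smooth_sec X U s ->
  sfmx X (U `&` dom p) (chm X p (fun y => pairm (s y))).
Proof.
move=> oU sU i j; have oW := openI oU (dom_open X p).
apply: (@sf_ext _ _ _ _ (fun y => ip (W X w p (dvec i) (dvec j) y) (s y))) => //.
  by move=> y _; rewrite /W pairmE -(chm_bil X p (fun y => pairm (s y))) bil_dvec.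
apply: (sf_ip hE oW); last by apply: ss_sub sU => y [].
by apply: ss_sub (W_ss hw p (dvec i) (dvec j)) => y [].
Qed.

End Form.

Section Curvature.
Context (D : Conn E) (hD : so3_connection X D).
Local Notation F := (curv X D).
Local Notation hF := (curv_form hE hD).

(** The projection in the definition of curv_hom is applied to a form which is
    self-dual already. *)
Lemma curv_homE x (s : fib E x) : curv_hom X D x s = sdproj X x (pairm F s).
Proof.
have key (s' : fib E x) : of_mx X x (\matrix_(i, j) ip (sdpart X F x (fam 2 [:: dvec i; dvec j])) s') = sdproj X x (pairm F s').
  apply: val_inj; rewrite -[LHS]/(vsval _) -[RHS]/(mx_of (sdproj X x (pairm F s'))).
  have -> : \matrix_(i, j) ip (sdpart X F x (fam 2 [:: dvec i; dvec j])) s' = mx_of (sdproj X x (pairm F s')).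
    by apply/matrixP => i j; rewrite mxE (sdpart_sdproj hF) /fam /= bil_dvec.
  by rewrite vsprojK//; exact: subvsP.
rewrite /curv_hom linfunE ?key// => r s1 s2.
by rewrite !key pairm_lin sdproj_lin.
Qed.

Lemma curv_hom_smooth : smooth_hom X (curv_hom X D).
Proof.
move=> U V e e' fe fe' i j; have oU := frame_open hE fe; have oV := frame_open hLP fe'.
have oW := openI oU oV.
apply: (@sf_ext _ _ _ _ (fun y => ip2 X y (pairm F (e y i)) (mxs (fun z => e' z j) y))) => //.
  by move=> y _; rewrite curv_homE ip_sdproj//; exact: (pairm_anti hF).
apply: sf_ip2 => // p a b.
  by apply: sf_sub (pairm_smooth hF p oU (frame_ss hE i fe) a b) => y [[? ?] ?].
have /(ss_chm _ oV)/(_ p) sc := frame_ss hLP j fe'.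
by apply: sf_sub (sc a b) => y [[? ?] ?].
Qed.

Lemma sdpart_curv x (v : 'I_2 -> T) s : ip (sdpart X F x v) s = bil (mx_of (curv_hom X D x s)) (v 0) (v 1).
Proof. by rewrite curv_homE (sdpart_sdproj hF). Qed.

End Curvature.
End CurvatureHom.

Section Equation.
Context (R : realType) (M : topologicalType) (X : oriented_riemannian4 R M).
Local Notation T := 'rV[R]_4.
Local Notation dom p := (cdom (chart_at X p)).
Local Notation LP := (LambdaP X).
Local Notation hLP := (LambdaP_oriented_euclidean X).
Local Notation Gam := (@Gamma R M X).
Local Notation hG := (Gamma_so3 X).
Implicit Types (x y p q : M).

Lemma positive_bij (h : Endo X) x : positive_selfadjoint h -> bijective (h x).
Proof.
move=> [_ hp]; have k0 : lker (h x) == 0%VS.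
  apply/lker0P => u v huv; apply/eqP; rewrite -subr_eq0; apply/negPn/negP => uv0.
  have e : h x (u - v) = 0 by rewrite linearB /=; apply/eqP; rewrite subr_eq0; apply/eqP.
  by have := hp x _ uv0; rewrite e (ip0l hLP) ltxx.
by exists ((h x)^-1)%VF; [exact: lker0_lfunK | exact: lker0_lfunVK].
Qed.

Lemma form_opp (a : Form LP 1) : is_form X a -> is_form X (fun x v => - a x v).
Proof.
move=> [h1 h2 h3]; split.
- by move=> x v i r u u'; rewrite h1 opprD scalerN.
- by move=> x v i j ij vij; rewrite (h2 x v i j ij vij) oppr0.
- move=> p u; have od := dom_open X p; have := ss_scale hLP od (sf_cst X _ (-1)) (h3 p u).
  by apply: (ss_ext hLP od) => y _; rewrite scaleN1r.
Qed.

Section FixedEndomorphism.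
Context (h : Endo X) (hh : Omega0p h).
Local Notation B := (B_of h).
Local Notation hB := (B_form hh).
Local Notation dB := (dcov X Gam B).

Lemma dB_form : is_form X dB. Proof. exact: (dcov_form hLP hB hG). Qed.

Lemma ad_invP : is_form X (ad_inv h dB) /\ ad h (ad_inv h dB) = dB.
Proof.
rewrite /ad_inv; set S := [set a | _]; have [a ha aw] := ad_surj hh dB_form.
have : S (xget (fun _ _ => 0) S) by apply: (@xgetPex _ _ S); exists a.
by [].
Qed.

Local Notation A1 := (fun x v => - ad_inv h dB x v).

Lemma A1_form : is_form X A1.
Proof. by apply: form_opp; case: ad_invP. Qed.

Lemma conn_of_so3 : so3_connection X (conn_of h).
Proof. exact: (conn_plus_so3 hLP hG A1_form). Qed.

Lemma ad_opp (a : Form LP 1) x v : ad h (fun x v => - a x v) x v = - ad h a x v.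
Proof.
rewrite !(ad_ad_at hh).
have -> : val1 (fun x v => - a x v) x = (fun u => - val1 a x u) by [].
move: (v 0) (v 1) (v 2%:R) (val1 a x) => u1 u2 u3 f.
by rewrite !ad_atE !(crossNl hLP) !opprD !opprK.
Qed.

(** This is the equation which defines the one-form added to the Levi-Civita
    connection. *)
Lemma dcov_conn_of x v : dcov X (conn_of h) B x v = 0.
Proof.
rewrite /conn_of (dcov_plus hLP _ _ _ _ hB) -/(ad h A1) ad_opp.
by have [_ ->] := ad_invP; rewrite subrr.
Qed.

End FixedEndomorphism.

Lemma hodge_sdpart (w : Form LP 2) : hodge X w = (fun x v => 2 *: sdpart X w x v + (-1) *: w x v).
Proof.
apply: functional_extensionality_dep => x; apply/funext => v.
rewrite /sdpart scalerA mulfV ?pnatr_eq0// scale1r scaleN1r addrC addKr //.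
Qed.

(** The star of the curvature is twice its self-dual part minus the curvature,
    and the latter is closed by the Bianchi identity. *)
Lemma dcov_hodge (D : Conn LP) (h : Endo X) x v : so3_connection X D -> Omega0p h ->
  (forall x, curv_hom X D x = h x) -> dcov X D (hodge X (curv X D)) x v = 2 *: dcov X D (B_of h) x v.
Proof.
move=> hD hh cD; have hF := curv_form hLP hD.
rewrite hodge_sdpart; have -> : sdpart X (curv X D) = B_of h.
  apply: functional_extensionality_dep => y; apply/funext => u; apply: (fib_inj hLP) => i.
  by rewrite (sdpart_curv hLP hD) (B_ip h) cD.
by rewrite (dcov_lin hLP _ _ _ _ hD (B_form hh) hF) (bianchi hLP hD) scaler0 addr0.
Qed.

(** When Phi h = 0 the self-dual curvature of conn_of h is B_of h, which is
    closed for this connection by construction. *)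
Theorem equation_yang_mills (h : Endo X) : Omega0p h -> (forall x, Phi h x = 0) ->
  yang_mills X (conn_of h) /\ forall x, curv_hom X (conn_of h) x = h x.
Proof.
move=> hh P0; have [_ ph] := hh; have hD := conn_of_so3 hh.
have cD x : curv_hom X (conn_of h) x = h x.
  have bh := positive_bij x ph; have /eqP := P0 x; rewrite /Phi subr_eq0 => /eqP e.
  apply/lfunP => u; have := congr1 (fun g : 'End(fib LP x) => g (h x u)) e.
  by rewrite comp_lfunE id_lfunE (bij_lfunK bh).
split=> //; split=> // x v.
by rewrite (dcov_hodge _ _ hD hh cD) (dcov_conn_of hh) scaler0.
Qed.

(** Conversely, a Yang-Mills connection with positive curvature endomorphism h
    differs from the Levi-Civita connection by the solution of the bracket
    equation for the exterior derivative of B_of h. *)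
Theorem yang_mills_equation (D : Conn LP) : yang_mills X D ->
  positive_selfadjoint (curv_hom X D) ->
  [/\ Omega0p (curv_hom X D), same_conn X D (conn_of (curv_hom X D)) &
    forall x, Phi (curv_hom X D) x = 0].
Proof.
move=> [hD ymD] ph; set h : Endo X := curv_hom X D.
have hh : Omega0p h by split=> //; exact: (curv_hom_smooth hLP hD).
have hB := B_form hh.
have dB0 x v : dcov X D (B_of h) x v = 0.
  have := dcov_hodge x v hD hh (fun=> erefl); rewrite ymD => /esym/eqP.
  by rewrite scaler_eq0 pnatr_eq0 /= => /eqP.
have [a ha sa] := conn_difference hLP hG hD.
have aE : (fun x v => - a x v) = ad_inv h (dcov X Gam (B_of h)).
  have [fi ai] := ad_invP hh.
  apply: (ad_inj hh (form_opp ha) fi); rewrite ai; first exact: (dB_form hh).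
  apply: functional_extensionality_dep => x; apply/funext => v; rewrite ad_opp//.
  have := dB0 x v; rewrite (same_conn_dcov hB sa) (dcov_plus hLP _ _ _ _ hB) -/(ad h a).
  by move/eqP; rewrite addr_eq0 => /eqP ->.
have sc : same_conn X D (conn_of h).
  move=> x v s ns; rewrite (sa x v s ns) /conn_of -aE; congr (_ + cross _ _).
  by rewrite opprK.
split=> // x.
have cE : curv_hom X (conn_of h) x = h x.
  apply/lfunP => u; rewrite (curv_homE hLP (conn_of_so3 hh)) (curv_homE hLP hD).
  by rewrite (same_conn_curv hLP hD (conn_of_so3 hh) sc).
apply/eqP; rewrite /Phi subr_eq0; apply/eqP/lfunP => u.
by rewrite comp_lfunE id_lfunE cE (bij_lfunVK (positive_bij x ph)).
Qed.

End Equation.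

(** * Polar decomposition of bundle homomorphisms *)

Section Polar.
Context (R : realType) (M : topologicalType) (X : oriented_riemannian4 R M).
Local Notation dom p := (cdom (chart_at X p)).
Context (E F : bundle3 R M) (hE : oriented_euclidean3 X E) (hF : oriented_euclidean3 X F).
Implicit Types (x y p q : M) (U V : set M).

Definition hmx (E1 E2 : bundle3 R M) x (g : 'Hom(fib E1 x, fib E2 x)) (b : 'I_3 -> fib E1 x) (b' : 'I_3 -> fib E2 x) : 'M[R]_3 :=
  \matrix_(i, j) ip (g (b i)) (b' j).

Lemma isometry_orthogonal x (f : 'Hom(fib E x, fib F x)) b b' : orthonormal b -> orthonormal b' ->
  (forall u v, ip (f u) (f v) = ip u v) -> orthogonal (hmx f b b').
Proof.
move=> ob ob' hf; apply/matrixP => i k; rewrite mxE [RHS]mxE -ob -hf (parseval hF _ _ ob').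
by apply: eq_bigr => j _; rewrite /hmx !mxE.
Qed.

Lemma hmx_comp x (f : 'Hom(fib E x, fib F x)) (g : 'End(fib F x)) (c : 'Hom(fib E x, fib F x)) b b' :
  orthonormal b' -> (forall u, c u = g (f u)) -> hmx c b b' = hmx f b b' *m hmx g b' b'.
Proof.
move=> ob' cE; apply/matrixP => i k; rewrite !mxE cE {1}(frame_expansion hF (f (b i)) ob').
rewrite linear_sum (ip_suml hF); apply: eq_bigr => j _.
by rewrite linearZ (ipZl hF) /hmx !mxE.
Qed.

Lemma hmx_inj x (f f' : 'Hom(fib E x, fib F x)) b b' : orthonormal b -> orthonormal b' ->
  hmx f b b' = hmx f' b b' -> f = f'.
Proof.
move=> ob ob' /matrixP e; apply/lfunP => u; rewrite (frame_expansion hE u ob) !linear_sum.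
apply: eq_bigr => i _; rewrite !linearZ; congr (_ *: _); apply: (frame_inj hF ob') => j.
by have := e i j; rewrite !mxE.
Qed.

Definition positive_at x (g : 'End(fib F x)) :=
  (forall u v, ip (g u) v = ip u (g v)) /\ (forall u : fib F x, u != 0 -> 0 < ip (g u) u).

(** The two factors of c = g f, for f an isometry and g positive, are
    determined by the square of g. *)
Lemma hmx_square x (f : 'Hom(fib E x, fib F x)) (g : 'End(fib F x)) (c : 'Hom(fib E x, fib F x)) b b' :
  orthonormal b -> orthonormal b' -> (forall u v, ip (f u) (f v) = ip u v) ->
  positive_at g -> (forall u, c u = g (f u)) ->
  [/\ posdef (hmx g b' b'), hmx g b' b' *m hmx g b' b' = (hmx c b b')^T *m hmx c b b' &
      hmx f b b' = hmx c b b' *m invmx (hmx g b' b')].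
Proof.
move=> ob ob' hf [sg pg] cE; have pH := posdef_frame hF ob' sg pg.
have oQ := isometry_orthogonal ob ob' hf; have e := hmx_comp b ob' cE.
have [sH _] := pH; rewrite -/(hmx g b' b') in pH sH; split=> //.
  by rewrite e trmx_mul sH -mulmxA (mulmxA _ (hmx f b b')) (mulmx1C oQ) mul1mx.
by rewrite e mulmxK// posdef_unit.
Qed.

Lemma posdef_det n (S : 'M[R]_n) : posdef S -> 0 < \det S.
Proof.
move=> pS; have [||t [_ tS t0]] := @smooth_cholesky R n setT (fun=> S) openT.
- by [].
- by move=> k i j; exact: Ck_cst.
by rewrite -(tS 0 I) det_mulmx det_tr mulr_gt0// t0.
Qed.

Lemma polar_unique x (f f' : 'Hom(fib E x, fib F x)) (g g' : 'End(fib F x)) (c : 'Hom(fib E x, fib F x)) :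
  (forall u v, ip (f u) (f v) = ip u v) -> (forall u v, ip (f' u) (f' v) = ip u v) ->
  positive_at g -> positive_at g' ->
  (forall u, c u = g (f u)) -> (forall u, c u = g' (f' u)) -> f = f'.
Proof.
move=> hf hf' pg pg' cE cE'; have ob := onb_on hE x; have ob' := onb_on hF x.
have [p1 s1 e1] := hmx_square ob ob' hf pg cE; have [p2 s2 e2] := hmx_square ob ob' hf' pg' cE'.
apply: (hmx_inj ob ob'); rewrite e1 e2; congr (_ *m invmx _).
by apply: posdef_sqrt_inj p1 p2 _; rewrite s1 s2.
Qed.

(** In oriented orthonormal bases c has a matrix C, and a polar decomposition of
    its transpose gives a rotation Q; f has matrix Q and c f^-1 has the symmetric
    positive matrix Q^T C. *)
Lemma polar_exists x (c : 'Hom(fib E x, fib F x)) : orientation_preserving_iso c ->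
  exists f : 'Hom(fib E x, fib F x), [/\ forall u v, ip (f u) (f v) = ip u v,
    orientation_preserving_iso f & positive_at (c \o f^-1)%VF].
Proof.
move=> [bc dc]; have ob := onb_on hE x; have ob' := onb_on hF x.
pose b := onb E x; pose b' := onb F x; pose C := hmx c b b'.
have uC : C^T \in unitmx by rewrite unitmx_tr unitmxE unitfE gt_eqF.
have [Q oQ pQ] := polar_decomposition uC.
pose f0 u := \sum_i ip u (b i) *: \sum_j Q i j *: b' j.
have f0l : linear f0.
  move=> r u v; rewrite /f0 scaler_sumr -big_split; apply: eq_bigr => i _ /=.
  by rewrite (ipDl hE) (ipZl hE) scalerDl scalerA.
pose f := linfun f0 : 'Hom(fib E x, fib F x).
have fE u : f u = f0 u := linfunE f0l u.
have fb i : f (b i) = \sum_j Q i j *: b' j.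
  rewrite fE /f0; set w := fun i => \sum_j Q i j *: b' j.
  transitivity (\sum_k (i == k)%:R *: w k); first by apply: eq_bigr => k _; rewrite ob.
  rewrite -[RHS]/(w i); move: w => w; rewrite (bigD1 i)//= big1 => [|j ji]; first by rewrite eqxx scale1r addr0.
  by rewrite eq_sym (negbTE ji) scale0r.
have fbb i j : ip (f (b i)) (b' j) = Q i j by rewrite fb (ip_frame_sum hF _ _ ob').
have ff i k : ip (f (b i)) (f (b k)) = (i == k)%:R.
  rewrite (parseval hF _ _ ob'); have := congr1 (fun A : 'M[R]_3 => A i k) oQ.
  rewrite !mxE => <-; by apply: eq_bigr => j _; rewrite !fbb mxE.
have hf u v : ip (f u) (f v) = ip u v.
  rewrite {1}(frame_expansion hE u ob) {1}(frame_expansion hE v ob) !linear_sum (ip_suml hF).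
  rewrite (parseval hE u v ob); apply: eq_bigr => i _; rewrite linearZ (ipZl hF); congr (_ * _).
  rewrite (ip_sumr hF) (bigD1 i)//= big1 => [|j ji].
    by rewrite linearZ (ip_sym hF) (ipZl hF) ff eqxx mulr1 addr0.
  by rewrite linearZ (ip_sym hF) (ipZl hF) ff (negbTE ji) mulr0.
have k0 : lker f == 0%VS.
  apply/lker0P => u v uv; apply/(frame_inj hE ob) => i; by rewrite -!hf uv.
have fVf u : f ((f^-1)%VF u) = u.
  pose u' := \sum_i (\sum_j ip u (b' j) * Q i j) *: b i.
  have -> : u = f u'.
    apply: (frame_inj hF ob') => j; rewrite /u' linear_sum (ip_suml hF).
    rewrite (eq_bigr (fun i => \sum_k ip u (b' k) * (Q i k * Q i j))) => [|i _]; last first.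
      rewrite linearZ (ipZl hF) fbb mulr_suml; apply: eq_bigr => k _; ring.
    have QQ k : \sum_i Q i k * Q i j = (k == j)%:R.
      have := congr1 (fun A : 'M[R]_3 => A k j) (mulmx1C oQ); rewrite !mxE => <-.
      by apply: eq_bigr => i _; rewrite mxE.
    rewrite exchange_big (eq_bigr (fun k => ip u (b' k) * (k == j)%:R)) => [|k _]; last by rewrite -mulr_sumr QQ.
    rewrite (bigD1 j)//= big1 => [|k kj]; first by rewrite eqxx mulr1 addr0.
    by rewrite (negbTE kj) mulr0.
  by rewrite lker0_lfunK.
have fK u : (f^-1)%VF (f u) = u := lker0_lfunK k0 u.
pose g := (c \o f^-1)%VF.
have gE u : g u = c ((f^-1)%VF u) by rewrite comp_lfunE.
have hg : hmx g b' b' = Q^T *m C.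
  have e : C = Q *m hmx g b' b'.
    have -> : Q = hmx f b b' by apply/matrixP => i j; rewrite !mxE fbb.
    by apply: hmx_comp => // u; rewrite gE fK.
  by rewrite e mulmxA (mulmx1C oQ) mul1mx.
have [sQ _] := pQ; have hgP : hmx g b' b' = C^T *m Q by rewrite hg -sQ trmx_mul trmxK.
have gb u i : ip (g u) (b' i) = ((\row_j ip u (b' j)) *m (C^T *m Q)) 0 i.
  rewrite -hgP {1}(frame_expansion hF u ob') linear_sum (ip_suml hF) mxE.
  by apply: eq_bigr => j _; rewrite linearZ (ipZl hF) !mxE.
have gbil u v : ip (g u) v = ((\row_j ip u (b' j)) *m (C^T *m Q) *m (\row_j ip v (b' j))^T) 0 0.
  by rewrite (parseval hF _ _ ob') mxE; apply: eq_bigr => i _; rewrite gb !mxE.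
exists f; split=> //.
- split; first by exists (f^-1)%VF.
  have -> : \matrix_(i, j) ip (f (onb E x i)) (onb F x j) = Q by apply/matrixP => i j; rewrite mxE fbb.
  by have := posdef_det pQ; rewrite det_mulmx det_tr pmulr_rgt0.
- split=> [u v|u u0]; first by rewrite [RHS](ip_sym hF) !gbil; exact: sym_bil.
  rewrite gbil; have [_ pp] := pQ; apply: pp; apply: contra u0 => /eqP r0; apply/eqP.
  apply: (frame_inj hF ob') => i; rewrite (ip0l hF).
  by have := congr1 (fun r : 'rV[R]_3 => r 0 i) r0; rewrite !mxE.
Qed.

(** The isometric factor is smooth because the positive factor is the square
    root of a smooth positive definite matrix. *)
Lemma polar_smooth (c f : forall x, 'Hom(fib E x, fib F x)) (g : forall x, 'End(fib F x)) :
  smooth_hom X c -> (forall x u v, ip (f x u) (f x v) = ip u v) ->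
  (forall x, positive_at (g x)) -> (forall x u, c x u = g x (f x u)) -> smooth_hom X f.
Proof.
move=> sc hf pg cE U V e e' fe fe' i j.
have oU := frame_open hE fe; have oV := frame_open hF fe'; have oW := openI oU oV.
pose C y := hmx (c y) (e y) (e' y); pose H y := hmx (g y) (e' y) (e' y).
have sC : sfmx X (U `&` V) C.
  by move=> a b; apply: sf_ext oW _ (sc U V e e' fe fe' a b) => y _; rewrite [RHS]mxE.
have data y : (U `&` V) y -> [/\ posdef (H y), H y *m H y = (C y)^T *m C y &
    hmx (f y) (e y) (e' y) = C y *m invmx (H y)].
  move=> [Uy Vy]; exact: (hmx_square (frame_on hE fe Uy) (frame_on hF fe' Vy) (hf y) (pg y) (cE y)).
have sCC : sfmx X (U `&` V) (fun y => (C y)^T *m C y) := sf_mulmx oW (sf_trmx oW sC) sC.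
have sH : sfmx X (U `&` V) H.
  apply/sfmx_Ck => p k.
  apply: (@smooth_sqrtm R 3 _ _ ((fun y => (C y)^T *m C y) \o cinv (chart_at X p))) => //.
  - exact: (im_open (p := p) oW).
  - by move=> z /im_inv[_ Wz _] /=; have [] := data _ Wz.
  - by move=> z /im_inv[_ Wz _] /=; have [] := data _ Wz.
  - by move=> k'; have /sfmx_Ck := sCC; exact.
have sI : sfmx X (U `&` V) (fun y => invmx (H y)).
  by apply: sf_invmx => // y Wy; have [pH _ _] := data y Wy; exact: posdef_unit.
apply: sf_ext oW _ (sf_mulmx oW sC sI i j) => y Wy.
by have [_ _ <-] := data y Wy; rewrite mxE.
Qed.

End Polar.

Section Normalisation.
Context (R : realType) (M : topologicalType) (X : oriented_riemannian4 R M).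
Local Notation LP := (LambdaP X).
Local Notation hLP := (LambdaP_oriented_euclidean X).
Context (E : bundle3 R M) (hE : oriented_euclidean3 X E).
Context (A : Conn E) (hA : so3_connection X A).

Lemma curv_hom_push (f : forall x, 'Hom(fib E x, fib LP x)) x u :
  orientation_preserving_isometry X f ->
  curv_hom X (push_conn f A) x u = curv_hom X A x ((f x)^-1%VF u).
Proof.
move=> hf; rewrite (curv_homE hLP (push_so3 hE hLP hf hA)) (curv_homE hE hA); congr (sdproj X x _).
apply/matrixP => i j; rewrite !mxE /val2 (push_curv hE hLP hf hA).
by rewrite -{1}(isoVK hf u) (iso_ip hf).
Qed.

Theorem normalise : (forall x, orientation_preserving_iso (curv_hom X A x)) ->
  exists! f : forall x, 'Hom(fib E x, fib LP x),
    orientation_preserving_isometry X f /\ positive_selfadjoint (curv_hom X (push_conn f A)).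
Proof.
move=> hc; set c := curv_hom X A.
have ex x := polar_exists hE hLP (hc x).
pose f x := proj1_sig (cid (ex x)).
have fP x : [/\ forall u v, ip (f x u) (f x v) = ip u v,
    orientation_preserving_iso (f x) & positive_at (c x \o (f x)^-1)%VF] by rewrite /f; case: cid.
have f1 x u v : ip (f x u) (f x v) = ip u v by have [h _ _] := fP x.
have f2 x : orientation_preserving_iso (f x) by have [_ h _] := fP x.
have f3 x : positive_at (c x \o (f x)^-1)%VF by have [_ _ h] := fP x.
have cE x u : c x u = (c x \o (f x)^-1)%VF (f x u).
  by rewrite comp_lfunE (bij_lfunK (proj1 (f2 x))).
have sf := polar_smooth hE hLP (curv_hom_smooth hE hA) f1 f3 cE.
have hf : orientation_preserving_isometry X f by split.
exists f; split.
  split=> //; split=> [x u v|x u u0].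
    by rewrite !curv_hom_push//; have [h _] := f3 x; have := h u v; rewrite !comp_lfunE.
  by rewrite curv_hom_push//; have [_ h] := f3 x; have := h u u0; rewrite comp_lfunE.
move=> f' [hf' [sa pa]]; apply: functional_extensionality_dep => x.
have cE' u : c x u = curv_hom X (push_conn f' A) x (f' x u).
  by rewrite curv_hom_push// (isoK hf').
apply: (polar_unique hE hLP (f1 x) (iso_ip hf' (x := x)) (f3 x) _ (cE x) cE').
by split=> [u v|u u0]; [exact: sa | exact: pa].
Qed.

End Normalisation.

Theorem theorem2p11 (R : realType) (M : topologicalType)
    (X : oriented_riemannian4 R M)
    (M_hausdorff : hausdorff_space M)
    (M_compact : compact [set: M])
    (M_connected : connected [set: M]) :
  (forall h : Endo X, Omega0p h -> (forall x, Phi h x = 0) ->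
     yang_mills X (conn_of h) /\ forall x, curv_hom X (conn_of h) x = h x)
  /\
  (forall (E : bundle3 R M) (A : Conn E),
     oriented_euclidean3 X E -> yang_mills X A ->
     (forall x, orientation_preserving_iso (curv_hom X A x)) ->
     (exists! f : forall x, 'Hom(fib E x, fib (LambdaP X) x),
        orientation_preserving_isometry X f /\
        positive_selfadjoint (curv_hom X (push_conn f A)))
     /\
     (forall f : forall x, 'Hom(fib E x, fib (LambdaP X) x),
        orientation_preserving_isometry X f ->
        positive_selfadjoint (curv_hom X (push_conn f A)) ->
        let h : Endo X := curv_hom X (push_conn f A) in
        [/\ Omega0p h,
            same_conn X (push_conn f A) (conn_of h) &
            forall x, Phi h x = 0]))
  /\
  (forall A : Conn (LambdaP X), yang_mills X A ->
     (forall x, orientation_preserving_iso (curv_hom X A x)) ->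
     forall f : forall x, 'Hom(fib (LambdaP X) x, fib (LambdaP X) x),
       orientation_preserving_isometry X f ->
       positive_selfadjoint (curv_hom X (push_conn f A)) ->
       gauge_transformation f).
Proof.
split; [|split].
- by move=> h hh P0; exact: equation_yang_mills.
- move=> E A hE ym iso; have [hA _] := ym.
  split; first exact: (normalise hE hA iso).
  move=> f hf ph; have ymf := push_yang_mills hE (LambdaP_oriented_euclidean X) hf hA ym.
  exact: (yang_mills_equation ymf ph).
- by move=> A _ _ f hf _.
Qed.
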